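(* Let $\mathcal K,\mathcal J$ be ideals in a right tensor $C^*$-precategory $\mathcal T$ with $\mathcal J\subset J(\mathcal K)$. Let $\pi=\{\pi_{n,m}\}_{n,m\in\mathbb N}$ be a right tensor representation of $\mathcal K$ coisometric on $\mathcal J$, and let $\mathcal R_{\mathcal J}$ be the reduction ideal associated with $\mathcal J$. The following conditions are equivalent: i) $\pi$ integrates to a representation faithful on the $0$-spectral subspace of $\mathcal O_{\mathcal T}(\mathcal K,\mathcal J)$; ii) $\pi$ integrates to a representation faithful on all of the spectral subspaces of $\mathcal O_{\mathcal T}(\mathcal K,\mathcal J)$; iii) $\ker\widetilde\pi$ coincides with $\mathcal R_{\mathcal J}$ embedded into $\mathcal K_{\mathcal J}$ via $\mathcal K(n,m)\ni a\mapsto\iota^{\mathcal M}_{n,m}(a)\in\mathcal K_{\mathcal J}(n,m)$; iv) $\ker\pi=\mathcal R_{\mathcal J}$ and, for every $n\in\mathbb N$, $$\mathcal J(n,n)=\pi_{n,n}^{-1}\Big(\sum_{j=1}^{k}\pi_{n+j,n+j}(\mathcal K(n+j,n+j))\Big)\qquad\text{for all }k>0.$$ In particular, $\pi$ integrates to a faithful representation of $\mathcal O_{\mathcal T}(\mathcal K,\mathcal J)$ if and only if $\pi$ admits a gauge action and one of the equivalent conditions i)–iv) holds.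
   Context: $\mathbb N=\{0,1,2,\dots\}$. A $C^*$-precategory $\mathcal T$ with object set $\mathbb N$ consists of complex Banach spaces $\mathcal T(n,m)$, bilinear associative compositions $\mathcal T(n,m)\times\mathcal T(m,l)\to\mathcal T(n,l)$ with $\|ab\|\le\|a\|\|b\|$, and antilinear involutive maps $*:\mathcal T(n,m)\to\mathcal T(m,n)$ with $(ab)^*=b^*a^*$, $\|a^*a\|=\|a\|^2$ and $a^*a$ positive in the $C^*$-algebra $\mathcal T(m,m)$ for $a\in\mathcal T(n,m)$. An ideal $\mathcal K$ in $\mathcal T$ is a family of closed subspaces $\mathcal K(n,m)\subset\mathcal T(n,m)$ stable under left and right composition with morphisms of $\mathcal T$; inclusions, intersections, sums are entrywise; $q_{\mathcal J}:\mathcal T\to\mathcal T/\mathcal J$ is the entrywise quotient map. A right tensor $C^*$-precategory is such a $\mathcal T$ with linear maps $\otimes1:\mathcal T(n,m)\to\mathcal T(n+1,m+1)$ preserving composition and involution; $\otimes1^k$ is the $k$-th iterate; $(\otimes1)^{-1}(\mathcal N)(n,m)=\{a\in\mathcal T(n,m):a\otimes1\in\mathcal N(n+1,m+1)\}$; $J(\mathcal K)=\mathcal K\cap(\otimes1)^{-1}(\mathcal K)$. The reduction ideal is $\mathcal R_{\mathcal J}=\overline{\bigcup_k\mathcal S_k}$ (entrywise), $\mathcal S_0=\{0\}$, $\mathcal S_k=\mathcal J\cap(\otimes1)^{-1}(\mathcal S_{k-1})+\mathcal S_{k-1}$; it is contained in $\mathcal J$. A right tensor representation of $\mathcal K$ in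 a $C^*$-algebra $B$ is a family of linear maps $\pi_{n,m}:\mathcal K(n,m)\to B$ with $\pi_{n,m}(a)^*=\pi_{m,n}(a^* )$ and $\pi_{n,m}(a)\pi_{m+k,l}(b)=\pi_{n+k,l}((a\otimes1^k)b)$ for $a\in\mathcal K(n,m)$, $b\in\mathcal K(m+k,l)$; $\ker\pi=\{\ker\pi_{n,m}\}$; it is coisometric on $\mathcal J\subset J(\mathcal K)$ if $\pi_{n,m}(a)=\pi_{n+1,m+1}(a\otimes1)$ for $a\in\mathcal J(n,m)$. $(\mathcal O_{\mathcal T}(\mathcal K,\mathcal J),\iota)$ is the universal pair: $\iota$ is a right tensor representation of $\mathcal K$ coisometric on $\mathcal J$ whose image generates the $C^*$-algebra, and each such $\pi$ integrates to a representation $\Psi_\pi$ of $\mathcal O_{\mathcal T}(\mathcal K,\mathcal J)$ with $\Psi_\pi\circ\iota_{n,m}=\pi_{n,m}$. The gauge action is $\gamma_z(\iota_{n,m}(a))=z^{n-m}\iota_{n,m}(a)$; the $k$-spectral subspace is $\{b:\gamma_z(b)=z^kb\ \forall z\in S^1\}$. $\pi$ admits a gauge action if for every $z\in S^1$ the relations $\beta_z(\pi_{n,m}(a))=z^{n-m}\pi_{n,m}(a)$, $a\in\mathcal K(n,m)$, $n,m\in\mathbb N$, give a well defined $*$-homomorphism $\beta_z$ of the $C^*$-algebra $C^*(\pi)$ generated by the images of the $\pi_{n,m}$. $\mathcal K_{\mathcal J}$ and $\widetilde\pi$: let $\mathcal M_{\mathcal T}(\mathcal K)$ be the $*$-algebra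 of matrices $\{a_{n,m}\}$, $a_{n,m}\in\mathcal K(n,m)$, finitely many nonzero, with entrywise linear structure, $(a^* )_{n,m}=(a_{m,n})^*$ and bilinear product where, with $\iota^{\mathcal M}_{n,m}(a)$ the matrix with single entry $a$ at $(n,m)$, $\iota^{\mathcal M}_{n,m}(a)\star\iota^{\mathcal M}_{p,l}(b)$ is $\iota^{\mathcal M}_{n+p-m,l}((a\otimes1^{p-m})b)$ if $m\le p$ and $\iota^{\mathcal M}_{n,l+m-p}(a(b\otimes1^{m-p}))$ if $p<m$. $\mathcal M(r+k,r)$ is the set of matrices with $a_{n,m}\neq0\Rightarrow n-m=k,\ m\le r$, with seminorm $\|a\|^{\mathcal J}_{r+k,r}=\max\{\max_{s<r}\|q_{\mathcal J}(x_s)\|,\|x_r\|\}$, $x_s=\sum_{0\le i\le s,\,i+k\ge0}a_{i+k,i}\otimes1^{s-i}$, and $\mathcal K_{\mathcal J}(n,m)=\mathcal M(n,m)/\|\cdot\|^{\mathcal J}_{n,m}$ (quotient by zero-seminorm elements). $\mathcal K_{\mathcal J}$ is a right tensor $C^*$-precategory with right tensoring induced by the inclusions $\mathcal M(n,m)\subset\mathcal M(n+1,m+1)$, and $a\mapsto\iota^{\mathcal M}_{n,m}(a)$ embeds $\mathcal K$ into $\mathcal K_{\mathcal J}$. For $\pi$ coisometric on $\mathcal J$, $\widetilde\pi$ is the right tensor representation of $\mathcal K_{\mathcal J}$ given by $\widetilde\pi_{r+k,r}\big(\sum_j\iota^{\mathcal M}_{j+k,j}(a_{j+k,j})\big)=\sum_j\pi_{j+k,j}(a_{j+k,j})$.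 *)

(* Defs.v *)
(* The complex numbers are R[i] for R : realType. *)
From HB Require Import structures.
From mathcomp Require Import all_boot all_order all_algebra.
From mathcomp Require Import complex zify.
From mathcomp Require Import all_classical all_reals all_analysis.

Set Implicit Arguments.
Unset Strict Implicit.
Unset Printing Implicit Defensive.

Import Order.TTheory GRing.Theory Num.Theory.
Import numFieldNormedType.Exports.

Local Open Scope classical_set_scope.
Local Open Scope ring_scope.

(* Algebras are not assumed unital. Invertibility of 1 - x in the unitization
   is quasi-invertibility of x: (1 - x)(1 - y) = 1 iff x + y = xy. *)
Definition quasi_invertible (A : zmodType) (mul : A -> A -> A) (x : A) : Prop :=
  exists y, x + y = mul x y /\ x + y = mul y x.

(* Self-adjoint with spectrum in [0, +oo[; a nonzero scalar [l] lies in the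
   spectrum of [a] iff 1 - a/l is not invertible in the unitization. The order
   of R[i] satisfies [0 <= l] iff [l] is real and nonnegative. *)
Definition cs_positive (R : realType) (A : lmodType R[i])
    (mul : A -> A -> A) (star : A -> A) (a : A) : Prop :=
  star a = a /\
  forall l : R[i], l != 0 -> ~ quasi_invertible mul (l^-1 *: a) -> 0 <= l.

Record cstarAlg (R : realType) := CstarAlg {
  calg_sort :> completeNormedModType R[i];
  cmul : calg_sort -> calg_sort -> calg_sort;
  cstar : calg_sort -> calg_sort;
  cmulDl : forall (c : R[i]) a b x, cmul (c *: a + b) x = c *: cmul a x + cmul b x;
  cmulDr : forall (c : R[i]) x a b, cmul x (c *: a + b) = c *: cmul x a + cmul x b;
  cmulA : forall a b c, cmul a (cmul b c) = cmul (cmul a b) c;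
  cnormM : forall a b, `|cmul a b| <= `|a| * `|b|;
  cstarD : forall (c : R[i]) a b, cstar (c *: a + b) = c^* *: cstar a + cstar b;
  cstarK : forall a, cstar (cstar a) = a;
  cstarM : forall a b, cstar (cmul a b) = cmul (cstar b) (cstar a);
  cstar_norm : forall a, `|cmul (cstar a) a| = `|a| ^+ 2
}.

Section CstarAlgebras.
Variable R : realType.
Implicit Types A B : cstarAlg R.

Definition is_cstar_subalg A (S : set A) : Prop :=
  [/\ closed S, S 0,
      forall (c : R[i]) a b, S a -> S b -> S (c *: a + b),
      forall a b, S a -> S b -> S (cmul a b) &
      forall a, S a -> S (cstar a)].

Definition cstar_generated A (G : set A) : set A := smallest (@is_cstar_subalg A) G.

Definition star_hom_on A B (S : set A) (f : A -> B) : Prop :=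
  [/\ forall (c : R[i]) a b, S a -> S b -> f (c *: a + b) = c *: f a + f b,
      forall a b, S a -> S b -> f (cmul a b) = cmul (f a) (f b) &
      forall a, S a -> f (cstar a) = cstar (f a)].

Definition star_hom A B (f : A -> B) : Prop := star_hom_on setT f.

Lemma cstar0 A : cstar (0 : A) = 0.
Proof.
have := cstarD 1 (0 : A) 0; rewrite scaler0 addr0 rmorph1 scale1r.
by move=> h; apply: (@addrI _ (cstar (0 : A))); rewrite addr0.
Qed.

Lemma cstarZ A (c : R[i]) (a : A) : cstar (c *: a) = c^* *: cstar a.
Proof. by rewrite -[c *: a]addr0 cstarD cstar0 addr0. Qed.

Lemma cmul0l A (x : A) : cmul 0 x = 0.
Proof.
have := cmulDl 1 (0 : A) 0 x; rewrite scaler0 addr0 scale1r => h.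
by apply: (@addrI _ (cmul 0 x)); rewrite addr0.
Qed.

Lemma cmul0r A (x : A) : cmul x 0 = 0.
Proof.
have := cmulDr 1 x (0 : A) 0; rewrite scaler0 addr0 scale1r => h.
by apply: (@addrI _ (cmul x 0)); rewrite addr0.
Qed.

Lemma cmulZ A (c d : R[i]) (a b : A) :
  cmul (c *: a) (d *: b) = (c * d) *: cmul a b.
Proof.
rewrite -[c *: a]addr0 cmulDl cmul0l addr0.
by rewrite -[d *: b]addr0 cmulDr cmul0r addr0 scalerA.
Qed.

End CstarAlgebras.

(* [T n m] is the space of morphisms written T(n,m) and composition is
   T(n,m) x T(m,l) -> T(n,l), [ccomp a b] being the product ab. *)
Record cprecat (R : realType) := Cprecat {
  mor :> nat -> nat -> completeNormedModType R[i];
  ccomp : forall n m l, mor n m -> mor m l -> mor n l;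
  cadj : forall n m, mor n m -> mor m n;
  ccompDl : forall n m l (c : R[i]) (a b : mor n m) (x : mor m l),
    ccomp (c *: a + b) x = c *: ccomp a x + ccomp b x;
  ccompDr : forall n m l (c : R[i]) (x : mor n m) (a b : mor m l),
    ccomp x (c *: a + b) = c *: ccomp x a + ccomp x b;
  ccompA : forall n m l k (a : mor n m) (b : mor m l) (c : mor l k),
    ccomp a (ccomp b c) = ccomp (ccomp a b) c;
  ccomp_norm : forall n m l (a : mor n m) (b : mor m l),
    `|ccomp a b| <= `|a| * `|b|;
  cadjD : forall n m (c : R[i]) (a b : mor n m),
    cadj (c *: a + b) = c^* *: cadj a + cadj b;
  cadjK : forall n m (a : mor n m), cadj (cadj a) = a;
  cadjM : forall n m l (a : mor n m) (b : mor m l),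
    cadj (ccomp a b) = ccomp (cadj b) (cadj a);
  cadj_norm : forall n m (a : mor n m), `|ccomp (cadj a) a| = `|a| ^+ 2;
  cadj_pos : forall n m (a : mor n m),
    cs_positive (@ccomp m m m) (@cadj m m) (ccomp (cadj a) a)
}.

Record rtcat (R : realType) := Rtcat {
  rt_precat :> cprecat R;
  tens : forall n m, rt_precat n m -> rt_precat n.+1 m.+1;
  tensD : forall n m (c : R[i]) (a b : rt_precat n m),
    tens (c *: a + b) = c *: tens a + tens b;
  tensM : forall n m l (a : rt_precat n m) (b : rt_precat m l),
    tens (ccomp a b) = ccomp (tens a) (tens b);
  tens_adj : forall n m (a : rt_precat n m), tens (cadj a) = cadj (tens a)
}.

Unset Implicit Arguments.

Section RightTensor.
Context {R : realType} {T : rtcat R}.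

Fixpoint tensk (k : nat) {n m : nat} (a : T n m) : T (k + n)%N (k + m)%N :=
  match k with
  | 0 => a
  | k'.+1 => tens (tensk k' a)
  end.

Definition hcast {n n' m m' : nat} (en : n = n') (em : m = m') (a : T n m) : T n' m' :=
  match en in _ = n1, em in _ = m1 return T n1 m1 with
  | erefl, erefl => a
  end.

Definition morset := forall n m, set (T n m).

Definition morset_sub (N1 N2 : morset) : Prop :=
  forall n m, N1 n m `<=` N2 n m.

Definition is_ideal (N : morset) : Prop :=
  [/\ forall n m, closed (N n m),
      forall n m, N n m 0,
      forall n m (c : R[i]) a b, N n m a -> N n m b -> N n m (c *: a + b),
      forall n m l (a : T n m) (b : T m l), N n m a -> N n l (ccomp a b) &
      forall n m l (a : T n m) (b : T m l), N m l b -> N n l (ccomp a b)].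

Definition pretens (N : morset) : morset :=
  fun n m => [set a | N n.+1 m.+1 (tens a)].

Definition Jideal (K : morset) : morset := fun n m => K n m `&` pretens K n m.

Fixpoint Sfam (J : morset) (k : nat) : morset :=
  match k with
  | 0 => fun n m => [set 0]
  | k'.+1 => fun n m =>
      [set x + y | x in J n m `&` pretens (Sfam J k') n m & y in Sfam J k' n m]
  end.

Definition reduction_ideal (J : morset) : morset :=
  fun n m => closure (\bigcup_k Sfam J k n m).

(* A family of maps on an ideal [K] is given by total maps on [T n m] of which only the
   restrictions to [K n m] are ever used. *)
Definition mor_maps (B : Type) := forall n m, T n m -> B.

Section Representations.
Context {B : cstarAlg R} (K : morset).
Implicit Type p : mor_maps B.

Definition is_rt_repr p : Prop :=
  [/\ forall n m (c : R[i]) (a b : T n m), K n m a -> K n m b ->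
        p n m (c *: a + b) = c *: p n m a + p n m b,
      forall n m (a : T n m), K n m a -> cstar (p n m a) = p m n (cadj a) &
      forall n m k l (a : T n m) (b : T (k + m)%N l),
        K n m a -> K (k + m)%N l b ->
        cmul (p n m a) (p (k + m)%N l b) = p (k + n)%N l (ccomp (tensk k a) b)].

Definition ker_repr p : morset := fun n m => [set a | K n m a /\ p n m a = 0].

Definition coisometric_on (J : morset) p : Prop :=
  forall n m (a : T n m), J n m a -> p n m a = p n.+1 m.+1 (tens a).

Definition repr_image p : set B :=
  [set b | exists n m (a : T n m), K n m a /\ b = p n m a].

Definition Cstar_of p : set B := cstar_generated (repr_image p).

Definition admits_gauge_action p : Prop :=
  forall z : R[i], `|z| = 1 ->
    exists beta : B -> B,
      [/\ forall b, Cstar_of p b -> Cstar_of p (beta b),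
          star_hom_on (Cstar_of p) beta &
          forall n m (a : T n m), K n m a ->
            beta (p n m a) = z ^ (n%:Z - m%:Z) *: p n m a].

End Representations.

Definition integrates_to (K : morset) {O B : cstarAlg R} (iota : mor_maps O)
    (p : mor_maps B) (Psi : O -> B) : Prop :=
  star_hom Psi /\ forall n m (a : T n m), K n m a -> Psi (iota n m a) = p n m a.

(* [(O, iota)] is a model of the universal pair (O_T(K,J), iota). *)
Definition is_universal_pair (K J : morset) {O : cstarAlg R}
    (iota : mor_maps O) : Prop :=
  [/\ is_rt_repr K iota,
      coisometric_on J iota,
      Cstar_of K iota = setT &
      forall (B : cstarAlg R) (p : mor_maps B),
        is_rt_repr K p -> coisometric_on J p ->
        exists Psi, integrates_to K iota p Psi].

Definition gauge_at (K : morset) {O : cstarAlg R} (iota : mor_maps O)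
    (z : R[i]) (g : O -> O) : Prop :=
  integrates_to K iota (fun n m a => z ^ (n%:Z - m%:Z) *: iota n m a) g.

(* For [z] on the circle the choice is unique and its existence is [gaugeP]. *)
Definition gauge (K : morset) {O : cstarAlg R} (iota : mor_maps O)
    (z : R[i]) : O -> O :=
  xget (@idfun O : O -> O) (gauge_at K iota z).

Lemma gaugeP (K J : morset) (O : cstarAlg R) (iota : mor_maps O) (z : R[i]) :
  is_ideal K -> morset_sub J K -> is_universal_pair K J iota -> `|z| = 1 ->
  gauge_at K iota z (gauge K iota z).
Proof.
move=> [_ _ _ Kl Kr] JK [[lin adj mul] cois gen univ] z1.
have z0 : z != 0 by rewrite -normr_gt0 z1.
apply: xgetPex; apply: univ; first split.
- move=> n m c a b Ka Kb; rewrite lin// scalerDr !scalerA; congr (_ *: _ + _).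
  exact: mulrC.
- move=> n m a Ka; rewrite cstarZ adj//; congr (_ *: _).
  rewrite rmorphXz ?unitfE//=.
  have -> : z^* = z^-1 by rewrite invC_norm z1 expr1n invr1 mul1r.
  by rewrite exprz_inv opprB.
- move=> n m k l a b Ka Kb; rewrite cmulZ (mul _ _ _ _ _ _ Ka Kb).
  rewrite -(expfzDr _ _ z0).
  have e : (k + n)%N%:Z - l%:Z = (n%:Z - m%:Z) + ((k + m)%N%:Z - l%:Z).
    by lia.
  rewrite -e.
  reflexivity.
- move=> n m a Ja.
  have -> : n.+1%:Z - m.+1%:Z = n%:Z - m%:Z by lia.
  by rewrite cois.
Qed.

Definition spectral_subspace (K : morset) {O : cstarAlg R} (iota : mor_maps O)
    (k : int) : set O :=
  [set b | forall z : R[i], `|z| = 1 -> gauge K iota z b = z ^ k *: b].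

Definition faithful_on {O B : cstarAlg R} (E : set O) (Psi : O -> B) : Prop :=
  forall x y, E x -> E y -> Psi x = Psi y -> x = y.

Section KJ.
Variables K J : morset.

Definition matrices := forall n m, T n m.

Definition matrix_algebra : set matrices :=
  [set x | (forall n m, K n m (x n m)) /\
           finite_set [set ij : nat * nat | x ij.1 ij.2 != 0]].

Definition iotaM {n m : nat} (a : T n m) : matrices := fun i j =>
  match n =P i, m =P j with
  | ReflectT en, ReflectT em => hcast en em a
  | _, _ => 0
  end.

Definition Mset (n m : nat) : set matrices :=
  [set x | matrix_algebra x /\
     forall i j, x i j != 0 -> i%:Z - j%:Z = n%:Z - m%:Z /\ (j <= m)%N].

Lemma diag_leq1 {n m : nat} (j : 'I_(minn n m).+1) : (j + (n - j))%N = n.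
Proof. by rewrite subnKC// (leq_trans _ (geq_minl n m))// -ltnS. Qed.

Lemma diag_leq2 {n m : nat} (j : 'I_(minn n m).+1) : (j + (m - j))%N = m.
Proof. by rewrite subnKC// (leq_trans _ (geq_minr n m))// -ltnS. Qed.

(* With n = s + k and m = s, the sum over 0 <= i <= s, 0 <= i + k of
   x_{i+k,i} (x) 1^{s-i}; the summation index is j = s - i. *)
Definition diag_sum (x : matrices) (n m : nat) : T n m :=
  \sum_(j < (minn n m).+1)
    hcast (diag_leq1 j) (diag_leq2 j) (tensk j (x (n - j)%N (m - j)%N)).

Definition rnorm {V : normedModType R[i]} (v : V) : R := complex.Re `|v|.

Definition quot_norm {n m : nat} (a : T n m) : R :=
  inf [set rnorm (a - b) | b in J n m].

(* With k = n - m, r = m: the indices s < r with s + k < 0, for which x_s is an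
   empty sum, are left out; the others are s = m - j with 1 <= j <= min n m. *)
Definition seminormJ (n m : nat) (x : matrices) : R :=
  Num.max
    (\big[Num.max/0]_(1 <= j < (minn n m).+1)
        quot_norm (diag_sum x (n - j) (m - j)))
    (rnorm (diag_sum x n m)).

Definition matrix_sub (x y : matrices) : matrices := fun i j => x i j - y i j.

Definition KJclass (n m : nat) (x : matrices) : set matrices :=
  [set y | Mset n m y /\ seminormJ n m (matrix_sub x y) = 0].

(* The quotient space K_J(n,m), as a set of equivalence classes. *)
Definition KJ (n m : nat) : set (set matrices) :=
  [set KJclass n m x | x in Mset n m].

Definition embKJ {n m : nat} (a : T n m) : set matrices := KJclass n m (iotaM a).

Definition diag_eval {B : cstarAlg R} (p : mor_maps B) (n m : nat)
    (x : matrices) : B :=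
  \sum_(j < (minn n m).+1) p (n - j)%N (m - j)%N (x (n - j)%N (m - j)%N).

(* Independence of the representative is [tilde_reprE]. *)
Definition tilde_repr {B : cstarAlg R} (p : mor_maps B) (n m : nat)
    (c : set matrices) : B :=
  diag_eval p n m (xget ((fun _ _ => 0) : matrices) c).

Definition ker_tilde {B : cstarAlg R} (p : mor_maps B) (n m : nat) :
    set (set matrices) :=
  [set c | KJ n m c /\ tilde_repr p n m c = 0].

Section TildeWellDefined.
Hypotheses (hK : is_ideal K) (hJ : is_ideal J) (hJK : morset_sub J (Jideal K)).

Lemma hcast_id n m (en : n = n) (em : m = m) (a : T n m) : hcast en em a = a.
Proof. by rewrite (eq_irrelevance en erefl) (eq_irrelevance em erefl). Qed.

Lemma tens_hcast n n' m m' (en : n = n') (em : m = m') (en' : n.+1 = n'.+1)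
    (em' : m.+1 = m'.+1) (a : T n m) :
  tens (hcast en em a) = hcast en' em' (tens a).
Proof. by case: _ / en en'; case: _ / em em' => em' en'; rewrite !hcast_id. Qed.

Lemma tens0 n m : tens (0 : T n m) = 0.
Proof.
have := tensD 1 (0 : T n m) 0; rewrite scaler0 addr0 scale1r => h.
by apply: (@addrI _ (tens (0 : T n m))); rewrite addr0.
Qed.

Lemma tensDD n m (a b : T n m) : tens (a + b) = tens a + tens b.
Proof. by have := tensD 1 a b; rewrite !scale1r. Qed.

Lemma tens_sum n m (I : Type) (r : seq I) (F : I -> T n m) :
  tens (\sum_(i <- r) F i) = \sum_(i <- r) tens (F i).
Proof. exact: (big_morph _ (@tensDD n m) (@tens0 n m)). Qed.

Lemma diag_sumE x n m N (e : minn n m = N)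
    (e1 : forall j : 'I_N.+1, (j + (n - j))%N = n)
    (e2 : forall j : 'I_N.+1, (j + (m - j))%N = m) :
  diag_sum x n m =
  \sum_(j < N.+1) hcast (e1 j) (e2 j) (tensk j (x (n - j)%N (m - j)%N)).
Proof.
case: _ / e e1 e2 => e1 e2; apply: eq_bigr => j _.
by rewrite (eq_irrelevance (diag_leq1 j) (e1 j)) (eq_irrelevance (diag_leq2 j) (e2 j)).
Qed.

Lemma diag_sumS x n m :
  diag_sum x n.+1 m.+1 = x n.+1 m.+1 + tens (diag_sum x n m).
Proof.
have l1 (j : 'I_(minn n m).+2) : (j + (n.+1 - j))%N = n.+1.
  by apply: subnKC; have := ltn_ord j; lia.
have l2 (j : 'I_(minn n m).+2) : (j + (m.+1 - j))%N = m.+1.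
  by apply: subnKC; have := ltn_ord j; lia.
rewrite (diag_sumE x n.+1 m.+1 _ (minnSS n m) l1 l2) big_ord_recl hcast_id.
congr (_ + _); rewrite tens_sum; apply: eq_bigr => j _.
by rewrite (tens_hcast _ _ _ _ _ _ (l1 (lift ord0 j)) (l2 (lift ord0 j))).
Qed.

Lemma diag_sum0 x n m : minn n m = 0%N -> diag_sum x n m = x n m.
Proof.
move=> e.
have l1 (j : 'I_1) : (j + (n - j))%N = n by have := ltn_ord j; lia.
have l2 (j : 'I_1) : (j + (m - j))%N = m by have := ltn_ord j; lia.
rewrite (diag_sumE x n m _ e l1 l2) big_ord1 /=.
move: (l1 ord0) (l2 ord0) => /=; rewrite !subn0 => h1 h2.
exact: hcast_id.
Qed.

Lemma diag_evalE (B : cstarAlg R) (p : mor_maps B) x n m :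
  is_rt_repr K p -> coisometric_on J p -> (forall i j, K i j (x i j)) ->
  (forall n' m' j, (0 < j)%N -> (n' + j)%N = n -> (m' + j)%N = m ->
     J n' m' (diag_sum x n' m')) ->
  diag_eval p n m x = p n m (diag_sum x n m).
Proof.
move=> [lin _ _] cois Kx.
have base n' m' : minn n' m' = 0%N ->
    diag_eval p n' m' x = p n' m' (diag_sum x n' m').
  by move=> e; rewrite diag_sum0// /diag_eval e big_ord1 /= !subn0.
elim: n m => [m _|n IH [|m] H]; [exact/base/min0n|exact/base/minn0|].
have Jd : J n m (diag_sum x n m) by apply: (H n m 1%N) => //; lia.
have -> : diag_eval p n.+1 m.+1 x = p n.+1 m.+1 (x n.+1 m.+1) + diag_eval p n m x.
  rewrite /diag_eval minnSS big_ord_recl; congr (_ + _).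
have [_ Kd] := hJK _ _ _ Jd.
rewrite diag_sumS IH; last first.
  by move=> n' m' j j0 en em; apply: (H n' m' j.+1); lia.
rewrite (cois _ _ _ Jd).
have := lin _ _ 1 _ _ (Kx n.+1 m.+1) Kd.
by rewrite !scale1r => ->.
Qed.

Lemma rnorm_ge0 (V : normedModType R[i]) (v : V) : 0 <= rnorm v.
Proof. by have := normr_ge0 v; rewrite lecE => /andP[]. Qed.

Lemma rnormE (V : normedModType R[i]) (v : V) : `|v| = (rnorm v)%:C%C.
Proof.
rewrite /rnorm; have := normr_ge0 v; case: `|v| => a b.
by rewrite lecE /= => /andP[/eqP -> _].
Qed.

Lemma quot_norm_ge0 n m (a : T n m) : 0 <= quot_norm a.
Proof.
apply: lb_le_inf; last by move=> _ [b _ <-]; exact: rnorm_ge0.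
by case: hJ => _ J0 _ _ _; exists (rnorm (a - 0)), 0.
Qed.

Lemma quot_norm_eq0 n m (a : T n m) : quot_norm a = 0 -> J n m a.
Proof.
case: hJ => Jc J0 _ _ _ q0; apply: Jc; move=> U /nbhs_ballP [e /= e0 eU].
have e0' : 0 < complex.Re e by move: e0; rewrite ltcE /= => /andP[].
have hi : has_inf [set rnorm (a - b) | b in J n m].
  split; first by exists (rnorm (a - 0)), 0.
  by exists 0 => _ [b _ <-]; exact: rnorm_ge0.
have [_ [b Jb <-]] := inf_adherent e0' hi.
rewrite -/(quot_norm a) q0 add0r => lt.
exists b; split=> //; apply: eU; rewrite -ball_normE /= rnormE.
move: e0 lt; case: e {e0'} => er ei; rewrite !ltcE /= => /andP[/eqP -> _] ->.
by rewrite eqxx.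
Qed.

Lemma quot_norm0 n m : quot_norm (0 : T n m) = 0.
Proof.
apply/eqP; rewrite eq_le quot_norm_ge0 andbT; apply: ge_inf.
  by exists 0 => _ [b _ <-]; exact: rnorm_ge0.
case: hJ => _ J0 _ _ _; exists 0; first exact: J0.
by rewrite subrr /rnorm normr0.
Qed.

Lemma seminormJ_eq0 n m x : seminormJ n m x = 0 ->
  diag_sum x n m = 0 /\
  forall n' m' j, (0 < j)%N -> (n' + j)%N = n -> (m' + j)%N = m ->
     J n' m' (diag_sum x n' m').
Proof.
rewrite /seminormJ => s0.
have /andP[h1 h2] :
    (\big[Num.max/0]_(1 <= j < (minn n m).+1)
        quot_norm (diag_sum x (n - j) (m - j)) <= 0)
    && (rnorm (diag_sum x n m) <= 0) by rewrite -ge_max s0.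
split.
  apply/eqP; rewrite -normr_eq0 rnormE.
  by rewrite (le_anti (introT andP (conj h2 (rnorm_ge0 _ _)))).
move=> n' m' j j0 en em; apply: quot_norm_eq0; apply/eqP.
rewrite eq_le quot_norm_ge0 andbT.
have en' : n' = (n - j)%N by lia.
have em' : m' = (m - j)%N by lia.
rewrite en' em'; apply: le_trans h1.
apply: (@le_bigmax_seq _ _ _ _ _ _ xpredT
  (fun j => quot_norm (diag_sum x (n - j) (m - j)))) => //.
by rewrite mem_index_iota; lia.
Qed.

Lemma diag_sum_zero n m : diag_sum (fun _ _ => 0) n m = 0.
Proof.
elim: n m => [m|n IH [|m]].
- by rewrite diag_sum0 ?min0n.
- by rewrite diag_sum0 ?minn0.
by rewrite diag_sumS IH tens0 addr0.
Qed.

Lemma seminormJ_refl n m x : seminormJ n m (matrix_sub x x) = 0.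
Proof.
have -> : matrix_sub x x = fun _ _ => 0.
  by apply: functional_extensionality_dep => i;
     apply: functional_extensionality_dep => j; rewrite /matrix_sub subrr.
rewrite /seminormJ diag_sum_zero [rnorm 0]/rnorm normr0.
rewrite (big_ind (fun r : R => r = 0)) ?maxxx//.
- by move=> a b -> ->; rewrite maxxx.
- by move=> j _; rewrite diag_sum_zero quot_norm0.
Qed.

Lemma tilde_reprE (B : cstarAlg R) (p : mor_maps B) n m x :
  is_rt_repr K p -> coisometric_on J p -> Mset n m x ->
  tilde_repr p n m (KJclass n m x) = diag_eval p n m x.
Proof.
move=> hp cois Mx; rewrite /tilde_repr.
case: xgetP => [y yE [My s0]|/(_ x)[]]; last first.
  by split=> //; exact: seminormJ_refl.
have [[[Kx _] _] [[Ky _] _]] := (Mx, My).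
have [_ K0 KD _ _] := hK; have [lin _ _] := hp.
have KB i j (a b : T i j) : K i j a -> K i j b -> K i j (a - b).
  by move=> Ka Kb; rewrite addrC -scaleN1r; exact: KD.
have pB i j (a b : T i j) : K i j a -> K i j b -> p i j (a - b) = p i j a - p i j b.
  by move=> Ka Kb; rewrite addrC -scaleN1r lin// scaleN1r addrC.
have p0 i j : p i j 0 = 0 by rewrite -(subrr (0 : T i j)) pB// subrr.
have [d0 dJ] := seminormJ_eq0 _ _ _ s0.
have : diag_eval p n m (matrix_sub x y) = 0.
  rewrite diag_evalE// ?d0//; move=> i j; exact: KB.
rewrite /diag_eval /matrix_sub.
under eq_bigr do rewrite pB//.
by rewrite sumrB => /eqP; rewrite subr_eq0 => /eqP ->.
Qed.

End TildeWellDefined.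

End KJ.

Section Conditions.
Context (K J : morset) {O B : cstarAlg R} (iota : mor_maps O) (p : mor_maps B).

Definition faithful_on_0_spectral : Prop :=
  exists Psi : O -> B,
    integrates_to K iota p Psi /\ faithful_on (spectral_subspace K iota 0) Psi.

Definition faithful_on_all_spectral : Prop :=
  exists Psi : O -> B,
    integrates_to K iota p Psi /\
    forall k : int, faithful_on (spectral_subspace K iota k) Psi.

Definition ker_tilde_is_reduction : Prop :=
  forall n m, ker_tilde K J p n m =
              [set embKJ K J a | a in reduction_ideal J n m].

Definition ker_and_preimage_condition : Prop :=
  (forall n m, ker_repr K p n m = reduction_ideal J n m) /\
  forall n k : nat, (0 < k)%N ->
    J n n = [set a | K n n a /\
               exists b : forall j, T (n + j)%N (n + j)%N,
                 (forall j, (1 <= j <= k)%N -> K (n + j)%N (n + j)%N (b j)) /\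
                 p n n a = \sum_(1 <= j < k.+1) p (n + j)%N (n + j)%N (b j)].

Definition integrates_faithfully : Prop :=
  exists Psi : O -> B, integrates_to K iota p Psi /\ injective Psi.

End Conditions.

End RightTensor.

Arguments morset {R} T.
Arguments mor_maps {R} T B.
Arguments matrices {R} T.

(* Main.v *)
Require Import Defs.
From HB Require Import structures.
From mathcomp Require Import all_boot all_order all_algebra.
From mathcomp Require Import complex generic_quotient ring_quotient zify ring lra.
From mathcomp Require Import all_classical all_reals all_analysis.

Set Implicit Arguments.
Unset Strict Implicit.
Unset Printing Implicit Defensive.

Import Order.TTheory GRing.Theory Num.Theory.
Import numFieldNormedType.Exports.

Local Open Scope classical_set_scope.
Local Open Scope ring_scope.

(* All conditions are compared with the following: if the value of [pi] on a matrix
   over [K] along one diagonal is 0, then the lower diagonal sums lie in [J] and the top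
   one lies in the reduction ideal. For the universal representation this holds
   because of a Fock representation taken modulo [J]-compact operators: there an operator
   of degree k remembers its diagonal sums modulo [J], and the top sum [D] satisfies
   [D (x) 1^i] in [J] with norms tending to 0, which characterizes the reduction ideal.

   Conversely, if the condition holds for [pi], then on elements of degree 0 the norm of
   the universal representation is at most that of [pi]: both are homomorphisms on a
   C*-algebra of towers [(D_0, ..., D_r)] in which kernels are approximated by functional
   calculus. Averaging over 2^s-th roots of unity passes from graded sums to spectral
   subspaces. With a gauge action on the range, a sum [y] of 2d + 1 homogeneous parts
   satisfies |y| <= (2d + 1) |Psi y|; applying this to the powers [w^(2^i)], where
   [w = y* y], removes the constant. *)

(** * Square roots in unital C*-algebras *)

(** Everything is nonunital and the spectrum enters only through the definition of positivity, so
    functional calculus is rebuilt from one iteration: square roots of 1 - y give polynomial bounds,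
    these give cutoff polynomials, and a cutoff of y* y measures the distance of y to the kernel of
    a homomorphism without forming a quotient. The zero homomorphism yields approximate units, hence
    self-adjointness of ideals and C*-seminorms on quotients by ideals that are not closed.
    Condition iv) speaks only of the spaces indexed by (n,n), whereas matrices have diagonals of
    every degree. The passage is from D to D* D: a closed ideal contains D as soon as it contains D*
    D. The same device reduces every degree to degree 0. The Fock operators are Toeplitz: a in
    T(n,m) acts in row n + k through a (x) 1^k. For a in J the operators of a and a (x) 1 differ by
    the single matrix entry a, so dividing out finite J-matrices makes the representation
    coisometric on J. Averages are iterated means of two elements, so no integral over the circle
    occurs. *)

(* The norm is real valued, and completeness is only required for sequences whose
   increments are dominated by those of a bounded real sequence. *)
Record ucstar (R : realType) := Ucstar {
  uc_sort :> algType R[i];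
  ustar : uc_sort -> uc_sort;
  unorm : uc_sort -> R;
  ustarD : forall x y, ustar (x + y) = ustar x + ustar y;
  ustarZ : forall (c : R[i]) x, ustar (c *: x) = c^* *: ustar x;
  ustarM : forall x y, ustar (x * y) = ustar y * ustar x;
  ustarK : forall x, ustar (ustar x) = x;
  unorm_ge0 : forall x, 0 <= unorm x;
  unorm_eq0 : forall x, unorm x = 0 -> x = 0;
  unormD : forall x y, unorm (x + y) <= unorm x + unorm y;
  unormZ : forall (c : R[i]) x, unorm (c *: x) = complex.Re `|c| * unorm x;
  unormM : forall x y, unorm (x * y) <= unorm x * unorm y;
  unormC : forall x, unorm (ustar x * x) = unorm x ^+ 2;
  ucomplete : forall (u : nat -> uc_sort) (e : nat -> R) (M : R),
    (forall n, unorm (u n.+1 - u n) <= e n.+1 - e n) -> (forall n, e n <= M) ->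
    exists l, forall eps, 0 < eps -> exists n0, forall n, (n0 <= n)%N ->
      unorm (u n - l) <= eps
}.

Section UnitalCstar.
Variables (R : realType) (V : ucstar R).
Implicit Types (x y z h : V) (r t : R).
Local Notation N := (@unorm R V).
Local Notation star := (@ustar R V).
Local Notation "r *' x" := ((r%:C)%C *: x) (at level 40).

Lemma Re_normC (r : R) : complex.Re `|(r%:C)%C| = `|r|.
Proof. by rewrite normc_def /= expr0n addr0 sqrtr_sqr. Qed.

Lemma conjC_real (r : R) : ((r%:C)%C : R[i])^* = (r%:C)%C.
Proof. by rewrite /Num.conj /= oppr0. Qed.

Lemma unorm_rs r x : N (r *' x) = `|r| * N x.
Proof. by rewrite unormZ Re_normC. Qed.

Lemma unormN x : N (- x) = N x.
Proof.
have -> : - x = (-1)%R *' x by rewrite rmorphN rmorph1 scaleN1r.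
by rewrite unorm_rs normrN1 mul1r.
Qed.

Lemma unormB x y : N (x - y) <= N x + N y.
Proof. by rewrite -(unormN y) unormD. Qed.

Lemma unormBC x y : N (x - y) = N (y - x).
Proof. by rewrite -unormN opprB. Qed.

Lemma unorm0 : N 0 = 0.
Proof. by rewrite -(scaler0 _ (0%:C)%C) unorm_rs normr0 mul0r. Qed.

Lemma unorm_tri y x z : N (x - z) <= N (x - y) + N (y - z).
Proof. by have := unormD (x - y) (y - z); rewrite addrA subrK. Qed.

Lemma unorm_eps x : (forall eps, 0 < eps -> N x <= eps) -> x = 0.
Proof.
move=> h; apply: unorm_eq0; apply/eqP; rewrite eq_le unorm_ge0 andbT.
by apply/ler_addgt0Pl => e /h; rewrite addr0.
Qed.

Lemma ustar0 : star 0 = 0.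
Proof. by apply: (@addrI _ (star 0)); rewrite -ustarD !addr0. Qed.

Lemma ustarN x : star (- x) = - star x.
Proof. by apply/eqP; rewrite -subr_eq0 opprK -ustarD addNr ustar0. Qed.

Lemma ustarB x y : star (x - y) = star x - star y.
Proof. by rewrite ustarD ustarN. Qed.

Lemma ustar1 : star 1 = 1.
Proof. by have := ustarM (star 1) 1; rewrite mulr1 ustarK mulr1 => <-. Qed.

Lemma ustar_rs r x : star (r *' x) = r *' star x.
Proof. by rewrite ustarZ conjC_real. Qed.

Lemma unorm_star x : N (star x) = N x.
Proof.
have le y : N y <= N (star y).
  have [->|n0] := eqVneq (N y) 0; first exact: unorm_ge0.
  have p : 0 < N y by rewrite lt_neqAle eq_sym n0 unorm_ge0.
  by rewrite -(ler_pM2r p) -expr2 -unormC unormM.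
by apply/eqP; rewrite eq_le -{2}(ustarK x) !le.
Qed.

Lemma unorm_sa_sqr x : star x = x -> N (x * x) = N x ^+ 2.
Proof. by move=> sx; rewrite -unormC sx. Qed.

Lemma unorm1_le1 : N 1 <= 1.
Proof.
have e : N 1 = N 1 ^+ 2 by rewrite -unormC ustar1 mulr1.
have := unorm_ge0 (1 : V); rewrite le_eqVlt => /orP[/eqP <-//|p].
by rewrite -(ler_pM2r p) mul1r -expr2 -e.
Qed.

(** Properties of the iterates of [sqseq] pass to the limit in this form: self-adjointness,
    commutation with an element, membership in a closed subalgebra. *)
Definition uclosed (Q : V -> Prop) :=
  forall x, (forall eps, 0 < eps -> exists2 z, Q z & N (x - z) <= eps) -> Q x.

Lemma uclosed_sa : uclosed (fun x => star x = x).
Proof.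
move=> x h; apply/eqP; rewrite -subr_eq0; apply/eqP.
apply: unorm_eps => e e0.
have [|z zs ze] := h (e / 2); first by lra.
have := unorm_tri z (star x) x; rewrite -{1}zs -ustarB unorm_star (unormBC z); lra.
Qed.

Lemma comm_le z c x : z * c = c * z -> N (x * z - z * x) <= 2 * N z * N (x - c).
Proof.
move=> zc.
have -> : x * z - z * x = (x - c) * z - z * (x - c).
  by rewrite mulrBl mulrBr opprB zc addrA subrK.
apply: le_trans (unormB _ _) _.
have := unormM (x - c) z; have := unormM z (x - c); lra.
Qed.

Lemma uclosed_comm z : uclosed (fun x => x * z = z * x).
Proof.
move=> x h; apply/eqP; rewrite -subr_eq0; apply/eqP.
apply: unorm_eps => e e0.
have p : 0 < 2 * N z + 1 by have := unorm_ge0 z; lra.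
have [|c cz ce] := h (e / (2 * N z + 1)); first by rewrite divr_gt0.
apply: le_trans (comm_le x (esym cz)) _.
apply: (@le_trans _ _ ((2 * N z + 1) * N (x - c))).
  by rewrite ler_wpM2r ?unorm_ge0//; lra.
by rewrite mulrC -ler_pdivlMr.
Qed.

Fixpoint sqseq (y : V) n : V :=
  if n is n'.+1 then 2^-1 *' (y + sqseq y n' * sqseq y n') else 0.

(** The scalar iteration for y = 1. It increases, stays below 1, and its increments dominate those
    of [sqseq] when |y| <= 1. *)
Fixpoint sqmaj n : R :=
  if n is n'.+1 then 2^-1 * (1 + sqmaj n' ^+ 2) else 0.

Lemma sqmaj_bd n : 0 <= sqmaj n <= 1.
Proof.
elim: n => [|n /andP[h0 h1]] /=; first by rewrite lexx ler01.
have : sqmaj n ^+ 2 <= 1 by rewrite expr_le1.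
by have := sqr_ge0 (sqmaj n); apply: (fun _ _ => _); lra.
Qed.

Lemma sqseq_comm y z : y * z = z * y -> forall n, sqseq y n * z = z * sqseq y n.
Proof.
move=> yz; elim=> [|n IH] /=; first by rewrite mul0r mulr0.
by rewrite -scalerAl -scalerAr mulrDl mulrDr yz -mulrA IH !mulrA IH.
Qed.

Lemma sqseq_bd y : N y <= 1 -> forall n, N (sqseq y n) <= sqmaj n.
Proof.
move=> y1; elim=> [|n IH] /=; first by rewrite unorm0.
rewrite unorm_rs ger0_norm ?invr_ge0// ler_wpM2l ?invr_ge0//.
apply: le_trans (unormD _ _) _; apply: lerD => //.
apply: le_trans (unormM _ _) _; rewrite expr2.
by apply: ler_pM => //; exact: unorm_ge0.
Qed.

(** Consecutive iterates commute, so the difference of their squares factors as (c_{n+1} -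
    c_n)(c_{n+1} + c_n); the majorant satisfies the same recursion with equality. *)
Lemma sqseq_step y : N y <= 1 -> forall n,
  N (sqseq y n.+1 - sqseq y n) <= sqmaj n.+1 - sqmaj n.
Proof.
move=> y1; elim=> [|n IH].
  by rewrite /= subr0 mulr0 addr0 expr0n /= addr0 subr0 mulr1 unorm_rs
    ger0_norm ?invr_ge0// -[leRHS]mulr1 ler_wpM2l ?invr_ge0.
have cc := @sqseq_comm y (sqseq y n) (esym (@sqseq_comm y y erefl n)) n.+1.
have -> : sqseq y n.+2 - sqseq y n.+1 = 2^-1 *'
    ((sqseq y n.+1 - sqseq y n) * (sqseq y n.+1 + sqseq y n)).
  rewrite [sqseq y n.+2]/= [in X in _ - X]/= -scalerBr; congr (_ *: _).
  rewrite mulrDr !mulrBl opprD addrACA subrr add0r -cc addrA subrK //.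
have -> : sqmaj n.+2 - sqmaj n.+1 =
    2^-1 * ((sqmaj n.+1 - sqmaj n) * (sqmaj n.+1 + sqmaj n)).
  have eS k : sqmaj k.+1 = 2^-1 * (1 + sqmaj k ^+ 2) by [].
  rewrite (eS n.+1); have := eS n; move: (sqmaj n.+1) (sqmaj n) => a b; lra.
rewrite unorm_rs ger0_norm ?invr_ge0// ler_wpM2l ?invr_ge0//.
apply: le_trans (unormM _ _) _; apply: ler_pM => //; try exact: unorm_ge0.
by apply: le_trans (unormD _ _) _; apply: lerD; exact: sqseq_bd.
Qed.

(* The square root of 1 - y, with no constant term: 1 - c is the limit of the
   iteration solving c = (y + c^2)/2. *)
Lemma sqrt1m y : N y <= 1 -> exists c,
  (1 - c) * (1 - c) = 1 - y /\
  forall Q : V -> Prop, uclosed Q -> Q 0 ->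
    (forall x, Q x -> Q (2^-1 *' (y + x * x))) -> Q c.
Proof.
move=> y1.
have [|c cl] := ucomplete (sqseq_step y1) (M := 1).
  by move=> n; have /andP[] := sqmaj_bd n.
exists c; split; last first.
  move=> Q clQ Q0 QS; apply: clQ => e /cl [n0 h].
  exists (sqseq y n0); last by rewrite unormBC h.
  by elim: n0 {h} => [//|n IH] /=; exact: QS.
suff e : c = 2^-1 *' (y + c * c).
  have e2 : c + c = y + c * c.
    rewrite {1 2}e -scalerDl -rmorphD /=.
    by rewrite (_ : 2^-1 + 2^-1 = 1 :> R) ?scale1r//; lra.
  by rewrite mulrBl mul1r mulrBr mulr1 opprB addrACA -opprD e2 opprD addrACA subrr addr0.
apply/eqP; rewrite -subr_eq0; apply/eqP; apply: unorm_eps => e e0.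
(* If both iterates are within d of [c], the total error is at most d + (1 + |c|) d / 2; the factor
   3 + |c| covers this and is positive. *)
have p : 0 < 3 + N c by have := unorm_ge0 c; lra.
have [|n0 h] := cl (e / (3 + N c)); first by rewrite divr_gt0.
have h0 := h n0 (leqnn _); have h1 := h n0.+1 (leqnSn _).
have b : N (sqseq y n0) <= 1.
  by apply: le_trans (sqseq_bd y1 n0) _; have /andP[] := sqmaj_bd n0.
apply: le_trans (unorm_tri (sqseq y n0.+1) _ _) _.
have -> : sqseq y n0.+1 - 2^-1 *' (y + c * c) =
   2^-1 *' (sqseq y n0 * (sqseq y n0 - c) + (sqseq y n0 - c) * c).
  rewrite /= -scalerBr opprD addrACA subrr add0r; congr (_ *: _).
  by rewrite mulrBr mulrBl addrA subrK.
rewrite unorm_rs ger0_norm ?invr_ge0//.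
have h2 : N (sqseq y n0 * (sqseq y n0 - c) + (sqseq y n0 - c) * c) <=
    (1 + N c) * (e / (3 + N c)).
  apply: le_trans (unormD _ _) _; rewrite [leRHS]mulrDl mul1r; apply: lerD.
    apply: le_trans (unormM _ _) _; rewrite -[leRHS]mul1r.
    by apply: ler_pM => //; exact: unorm_ge0.
  apply: le_trans (unormM _ _) _; rewrite [leRHS]mulrC.
  by apply: ler_pM => //; exact: unorm_ge0.
rewrite (unormBC c).
set d := e / _ in h0 h1 h2.
have -> : e = (3 + N c) * d by rewrite /d mulrC divfK// gt_eqF.
have d0 : 0 < d by rewrite /d divr_gt0.
have := unorm_ge0 c; nra.
Qed.

End UnitalCstar.

(** * Polynomial functional calculus *)

Section PolynomialCalculus.
Variables (R : realType) (V : ucstar R).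
Implicit Types (x y z h : V) (r t : R).
Local Notation N := (@unorm R V).
Local Notation star := (@ustar R V).
Local Notation "r *' x" := ((r%:C)%C *: x) (at level 40).

Lemma rsA r t x : r *' (t *' x) = (r * t) *' x.
Proof. by rewrite scalerA -rmorphM. Qed.

Lemma rsDl r t x : (r + t) *' x = r *' x + t *' x.
Proof. by rewrite -scalerDl -rmorphD. Qed.

Lemma rsM r t x y : (r *' x) * (t *' y) = (r * t) *' (x * y).
Proof. by rewrite -scalerAl -scalerAr rsA. Qed.

Lemma rs1 x : 1 *' x = x.
Proof. by rewrite rmorph1 scale1r. Qed.

(** [x] is the real part of u = x + iy, and u* u = x^2 + y^2 because [x] and [y] commute. So |u| <=
    r, and the mean of u and its adjoint has norm at most r. *)
Lemma norm_le_of_sum_sqr x y r : 0 <= r -> star x = x -> star y = y ->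
  x * y = y * x -> x * x + y * y = (r ^+ 2) *' 1 -> N x <= r.
Proof.
move=> r0 sx sy xy e.
pose i : R[i] := 'i%C; pose u := x + i *: y.
have ii : i * i = -1 by rewrite -expr2 /i sqr_i.
have ci : i^* = - i by rewrite /i /Num.conj /=; congr (_ +i* _)%C; rewrite oppr0.
have su : star u = x - i *: y by rewrite ustarD ustarZ sx sy ci scaleNr.
have Nu : N u <= r.
  have : N u ^+ 2 <= r ^+ 2.
    have xw : x * (i *: y) = (i *: y) * x by rewrite -scalerAl -scalerAr xy.
    have ww : (i *: y) * (i *: y) = - (y * y).
      by rewrite -scalerAl -scalerAr scalerA ii scaleN1r.
    rewrite -unormC su /u mulrDr !mulrBl ww opprK xw.
    rewrite addrA subrK e unorm_rs.
    rewrite ger0_norm ?sqr_ge0// -[leRHS]mulr1 ler_wpM2l ?sqr_ge0//.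
    exact: unorm1_le1.
  by rewrite ler_sqr ?nnegrE ?unorm_ge0.
have -> : x = 2^-1 *' (u + star u).
  rewrite su /u addrACA subrr addr0 -[x in RHS]rs1 -rsDl rsA.
  by rewrite (_ : 2^-1 * (1 + 1) = 1 :> R) ?rs1//; lra.
rewrite unorm_rs ger0_norm ?invr_ge0//.
have := unormD u (star u); rewrite unorm_star; lra.
Qed.

(** The bicommutant of [h] stands in for the unital C*-algebra generated by [h]: it is commutative
    and closed, and it contains the square roots built from its elements. *)
Definition bicomm h x := forall z, z * h = h * z -> z * x = x * z.

Lemma bicommC h x y : bicomm h x -> bicomm h y -> x * y = y * x.
Proof. by move=> bx by_; apply: by_; rewrite (bx h). Qed.

Lemma bicomm_id h : bicomm h h. Proof. by []. Qed.

Lemma bicommD h x y : bicomm h x -> bicomm h y -> bicomm h (x + y).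
Proof. by move=> bx by_ z zh; rewrite mulrDl mulrDr bx// by_. Qed.

Lemma bicommM h x y : bicomm h x -> bicomm h y -> bicomm h (x * y).
Proof. by move=> bx by_ z zh; rewrite mulrA bx// -mulrA by_// mulrA. Qed.

Lemma bicommZ h (c : R[i]) x : bicomm h x -> bicomm h (c *: x).
Proof. by move=> bx z zh; rewrite -scalerAl -scalerAr bx. Qed.

Lemma bicomm1 h : bicomm h 1.
Proof. by move=> z _; rewrite mul1r mulr1. Qed.

Lemma bicommN h x : bicomm h x -> bicomm h (- x).
Proof. by rewrite -scaleN1r; exact: bicommZ. Qed.

Lemma bicomm_closed h : uclosed (bicomm h).
Proof.
move=> x hx z zh; apply/esym; apply: (uclosed_comm (z := z)) => e /hx [y yb ye].
by exists y => //; rewrite yb.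
Qed.

Lemma sqrt1m_bicomm h y : star y = y -> bicomm h y -> N y <= 1 ->
  exists c, [/\ star c = c, bicomm h c & c * c = 1 - y].
Proof.
move=> sy hy /sqrt1m [c [ce cQ]]; exists (1 - c); split=> //.
  rewrite ustarB ustar1; congr (_ - _).
  apply: (cQ (fun x => star x = x)); first exact: uclosed_sa.
    exact: ustar0.
  by move=> x sx; rewrite ustar_rs ustarD ustarM sy sx.
apply: bicommD; first exact: bicomm1.
apply: bicommN; apply: cQ; first exact: bicomm_closed.
  by move=> z _; rewrite mul0r mulr0.
by move=> x bx; apply: bicommZ; apply: bicommD => //; apply: bicommM.
Qed.

(** Positivity without a spectrum: for self-adjoint [x], |t - x| <= t says that the spectrum lies in
    [0, 2t]. In this form sums are immediate; products go through square roots. *)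
Definition upos h x :=
  [/\ star x = x, bicomm h x & exists2 t, 0 <= t & N (t *' 1 - x) <= t].

(** For t > 0, x = t (1 - y) with y = 1 - x/t of norm at most 1, and the root of 1 - y is scaled by
    the root of t. If t = 0 then x = 0. *)
Lemma upos_sqrt h x : upos h x ->
  exists w, [/\ star w = w, bicomm h w & x = w * w].
Proof.
move=> [sx bx [t]]; rewrite le_eqVlt => /orP[/eqP <-|t0].
  rewrite rmorph0 scale0r sub0r unormN => n0; exists 0.
  have -> : x = 0.
    by apply: unorm_eq0; apply/eqP; rewrite eq_le n0 unorm_ge0.
  by split; rewrite ?ustar0 ?mul0r// => z _; rewrite mul0r mulr0.
move=> n; have tn0 : t != 0 by rewrite gt_eqF.
have [|||] := @sqrt1m_bicomm h (1 - t^-1 *' x).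
- by rewrite ustarB ustar1 ustar_rs sx.
- by apply: bicommD; [exact: bicomm1|apply/bicommN/bicommZ].
- have -> : 1 - t^-1 *' x = t^-1 *' (t *' 1 - x).
    by rewrite scalerBr rsA mulVf// rs1.
  by rewrite unorm_rs ger0_norm ?invr_ge0 ?(ltW t0)// ler_pdivrMl ?mulr1.
move=> c [sc bc ce]; exists (Num.sqrt t *' c); split.
- by rewrite ustar_rs sc.
- exact: bicommZ.
rewrite rsM -expr2 sqr_sqrtr ?ltW// ce opprB addrC subrK rsA divff// rs1 //.
Qed.

(** After scaling to |v| = 1 there is a self-adjoint c with c^2 = 1 - v^2. From c^2 + v^2 = 1
    follows |c| <= 1, so |1 - v^2| = |c|^2 <= 1. *)
Lemma upos_sqr h w : star w = w -> bicomm h w -> upos h (w * w).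
Proof.
move=> sw bw; split; [by rewrite ustarM sw|exact: bicommM|].
exists (N w ^+ 2); first exact: sqr_ge0.
have [->|n0] := eqVneq w 0.
  by rewrite unorm0 expr0n mulr0 rmorph0 scale0r subr0 unorm0.
have Nw : 0 < N w.
  by rewrite lt_neqAle unorm_ge0 andbT eq_sym; apply: contra_neq n0 => /unorm_eq0.
pose v := (N w)^-1 *' w.
have sv : star v = v by rewrite ustar_rs sw.
have bv : bicomm h v by exact: bicommZ.
have Nv : N v = 1 by rewrite unorm_rs ger0_norm ?invr_ge0 ?(ltW Nw)// mulVf ?gt_eqF.
have [||| c [sc bc ce]] := @sqrt1m_bicomm h (v * v).
- by rewrite ustarM sv.
- exact: bicommM.
- by rewrite unorm_sa_sqr// Nv expr1n.
have wv : w * w = (N w ^+ 2) *' (v * v).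
  rewrite rsM rsA.
  have -> : N w ^+ 2 * ((N w)^-1 * (N w)^-1) = 1.
    by rewrite expr2 mulrACA divff ?mulr1// gt_eqF.
  by rewrite rs1.
have Nc : N c <= 1.
  apply: (@norm_le_of_sum_sqr c v) => //; first exact: bicommC bc bv.
  by rewrite ce subrK expr1n rs1.
rewrite wv -scalerBr -ce unorm_rs ger0_norm ?sqr_ge0//.
rewrite -[leRHS]mulr1 ler_wpM2l ?sqr_ge0// unorm_sa_sqr// expr_le1//.
exact: unorm_ge0.
Qed.

Lemma uposD h x y : upos h x -> upos h y -> upos h (x + y).
Proof.
move=> [sx bx [s s0 xs]] [sy by_ [t t0 yt]]; split.
- by rewrite ustarD sx sy.
- exact: bicommD.
exists (s + t); first exact: addr_ge0.
rewrite rsDl opprD addrACA; apply: le_trans (unormD _ _) _; exact: lerD.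
Qed.

Lemma uposM h x y : upos h x -> upos h y -> upos h (x * y).
Proof.
move=> /upos_sqrt [a [sa ba ->]] /upos_sqrt [b [sb bb ->]].
have ab := bicommC ba bb.
have -> : a * a * (b * b) = (a * b) * (a * b) by rewrite mulrA -(mulrA a a b) [in LHS]ab !mulrA.
apply: upos_sqr; last exact: bicommM.
by rewrite ustarM sa sb ab.
Qed.

Lemma upos_rs h r : 0 <= r -> upos h (r *' 1).
Proof.
move=> r0; split; [by rewrite ustar_rs ustar1|apply: bicommZ; exact: bicomm1|].
by exists r => //; rewrite subrr unorm0.
Qed.

Definition peval h (p : {poly R}) : V := horner_alg h (map_poly (real_complex R) p).

Lemma pevalC h r : peval h r%:P = r *' 1.
Proof. by rewrite /peval map_polyC /= horner_algC. Qed.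

Lemma pevalX h : peval h 'X = h.
Proof. by rewrite /peval map_polyX horner_algX. Qed.

Lemma pevalD h p q : peval h (p + q) = peval h p + peval h q.
Proof. by rewrite /peval !rmorphD. Qed.

Lemma pevalB h p q : peval h (p - q) = peval h p - peval h q.
Proof. by rewrite /peval !rmorphB. Qed.

Lemma pevalN h p : peval h (- p) = - peval h p.
Proof. by rewrite /peval !rmorphN. Qed.

Lemma pevalM h p q : peval h (p * q) = peval h p * peval h q.
Proof. by rewrite /peval !rmorphM. Qed.

Lemma peval_bicomm h p : bicomm h (peval h p).
Proof.
elim/poly_ind: p => [|p r IH].
  by rewrite /peval !rmorph0 => z _; rewrite mul0r mulr0.
rewrite pevalD pevalM pevalX pevalC; apply: bicommD; last first.
  by apply: bicommZ; exact: bicomm1.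
by apply: bicommM.
Qed.

Lemma peval_sa h p : star h = h -> star (peval h p) = peval h p.
Proof.
move=> sh; elim/poly_ind: p => [|p r IH]; first by rewrite /peval !rmorph0 ustar0.
rewrite pevalD pevalM pevalX pevalC ustarD ustarM ustar_rs ustar1 sh IH.
by rewrite (bicommC (peval_bicomm (h := h) p) (bicomm_id (h := h))).
Qed.

(** Induction on the degree by removing a complex root. A real root lies outside [-1, 1], and up to
    sign its factor is a nonnegative constant plus 1 - h or 1 + h. A nonreal root a + ib gives the
    real factor (X - a)^2 + b^2, a sum of squares at [h]. The remaining cofactor is again positive
    on [-1, 1]. *)
Lemma peval_pos h : star h = h -> N h <= 1 -> forall p : {poly R},
  (forall s : R, -1 <= s <= 1 -> 0 < p.[s]) -> upos h (peval h p).
Proof.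
move=> sh h1 p; move: {2}(size p) (leqnn (size p)) => n; elim: n p => [|n IH] p.
  rewrite leqn0 size_poly_eq0 => /eqP -> /(_ 0); rewrite horner0 ltxx.
  by rewrite lerN10 ler01 => /(_ isT).
move=> sp p0; have p00 : 0 < p.[0] by apply: p0; rewrite lerN10 ler01.
have [sp1|sp1] := eqVneq (size p) 1%N.
  have [c c0 pc] := size_poly1P _ (introT eqP sp1).
  by rewrite pc pevalC; apply: upos_rs; move: p00; rewrite pc hornerC => /ltW.
have pn0 : p != 0 by apply: contraTneq p00 => ->; rewrite horner0 ltxx.
have sp2 : (1 < size p)%N.
  by rewrite ltn_neqAle eq_sym sp1 lt0n size_poly_eq0.
have := sp1; rewrite -(size_map_poly (real_complex R)) => /closed_rootP [[a b]].
have [b0|b0] := eqVneq b 0.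
  rewrite b0 -[(a +i* 0)%C]/(real_complex R a) fmorph_root => /factor_theorem [q pq].
  have qn0 : q != 0 by apply: contra_neq pn0 => q0; rewrite pq q0 mul0r.
  have sq : (size q <= n)%N.
    by move: sp; rewrite pq size_Mmonic ?monicXsubC// size_XsubC addn2 /=.
  have pa : p.[a] = 0 by rewrite pq hornerM hornerXsubC subrr mulr0.
  have [a1|a1] := ltP 1 a.
    have -> : peval h p = peval h (- q) * (peval h (a - 1)%:P + (1 - h)).
      rewrite pq !pevalM !(pevalB, pevalN) pevalX !pevalC rsDl rmorphN scaleNr rs1.
      by rewrite addrA subrK mulNr -mulrN opprB.
    apply: uposM; [apply: IH|apply: uposD].
    - by rewrite size_polyN.
    - move=> s s1; have := p0 s s1; rewrite pq hornerM hornerXsubC hornerN.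
      have : s - a < 0 by lra.
      by move=> sa; rewrite nmulr_lgt0// oppr_gt0.
    - by rewrite pevalC; apply: upos_rs; lra.
    - split; [by rewrite ustarB ustar1 sh| |].
        by apply: bicommD; [exact: bicomm1|apply: bicommN].
      by exists 1; rewrite ?ler01 ?rs1 ?opprB 1?addrCA ?subrr ?addr0.
  have [a2|a2] := ltP a (-1).
    have -> : peval h p = peval h q * (peval h (- 1 - a)%:P + (1 + h)).
      rewrite pq !pevalM !(pevalB, pevalN) pevalX !pevalC rsDl rmorphN scaleNr rs1.
      rewrite rmorphN scaleNr; congr (_ * _).
      by rewrite [in RHS]addrC addrACA subrr add0r.
    apply: uposM; [apply: IH|apply: uposD] => //.
    - move=> s s1; have := p0 s s1; rewrite pq hornerM hornerXsubC.
      have : 0 < s - a by lra.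
      by move=> sa; rewrite pmulr_lgt0.
    - by rewrite pevalC; apply: upos_rs; lra.
    - split; [by rewrite ustarD ustar1 sh|by apply: bicommD; first exact: bicomm1|].
      by exists 1; rewrite ?rs1// opprD addrA subrr sub0r unormN.
  by move: (p0 a); rewrite pa ltxx a1 a2 => /(_ isT).
move=> rt; pose d : {poly R} := ('X - a%:P) ^+ 2 + (b ^+ 2)%:P.
have sd2 : size (('X - a%:P) ^+ 2) = 3%N by rewrite size_exp_XsubC.
have sd : size d = 3%N by rewrite size_polyDl sd2// (leq_ltn_trans (size_polyC_leq1 _)).
have dm : d \is monic.
  rewrite monicE lead_coefDl ?sd2 ?(leq_ltn_trans (size_polyC_leq1 _))//.
  by rewrite -monicE; apply: monic_exp; exact: monicXsubC.
have [q [e [pde se]]] : exists q e : {poly R}, p = q * d + e /\ (size e <= 2)%N.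
  exists (p %/ d), (p %% d); split; first exact: divp_eq.
  by rewrite -ltnS -sd ltn_modp -size_poly_eq0 sd.
(* The remainder is affine with real coefficients and vanishes at the nonreal root, so both
   coefficients are 0. *)
have e0 : e = 0.
  have ee : e = (e`_1)%:P * 'X + (e`_0)%:P.
    apply/polyP => i; rewrite coefD coefMX !coefC.
    case: i => [|[|i]] /=; rewrite ?add0r ?addr0//.
    by rewrite nth_default// (leq_trans se).
  move: rt; rewrite /root pde ee.
  rewrite !rmorphD !rmorphM /= hornerD hornerM.
  rewrite /d rmorphD rmorphXn rmorphB /= !map_polyX !map_polyC /= hornerD horner_exp.
  rewrite hornerXsubC hornerD hornerM hornerX !hornerC.
  have -> : ((a +i* b)%C - (a%:C)%C) ^+ 2 + ((b ^+ 2)%:C)%C = 0.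
    have -> : (a +i* b)%C - (a%:C)%C = (0 +i* b)%C by apply/eqP; rewrite eq_complex /= subrr subr0 !eqxx.
    by rewrite expr2; apply/eqP; rewrite eq_complex /=; apply/andP; split; apply/eqP; ring.
  rewrite mulr0 add0r => /eqP; move: (e`_1) (e`_0) => u v [h1' h2'].
  have u0 : u = 0.
    have : u * b = 0 by move: h2'; rewrite mul0r !addr0.
    by move/eqP; rewrite mulf_eq0 (negbTE b0) orbF => /eqP.
  have v0 : v = 0 by move: h1'; rewrite u0 !mul0r subrr add0r.
  by rewrite u0 v0 mul0r add0r.
rewrite e0 addr0 in pde.
have dpos s : 0 < d.[s].
  rewrite /d hornerD hornerC horner_exp hornerXsubC.
  by rewrite ltr_wpDl ?sqr_ge0// lt_neqAle sqr_ge0 andbT eq_sym sqrf_eq0.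
have qn0 : q != 0 by apply: contra_neq pn0 => q0; rewrite pde q0 mul0r.
rewrite pde pevalM; apply: uposM.
  apply: IH => [|s s1].
    by move: sp; rewrite pde size_Mmonic// sd addn3 /=; lia.
  by have := p0 s s1; rewrite pde hornerM pmulr_lgt0.
rewrite /d pevalD pevalC; apply: uposD; last by apply: upos_rs; exact: sqr_ge0.
rewrite expr2 pevalM; apply: upos_sqr; [exact: peval_sa|exact: peval_bicomm].
Qed.

(** The polynomial (M + e)^2 - p^2 is positive on [-1, 1], so its value at [h] is a square w^2. Then
    p(h)^2 + w^2 = (M + e)^2 bounds |p(h)| by M + e. The slack e makes the positivity strict. *)
Lemma peval_bound h p (M : R) : star h = h -> N h <= 1 ->
  (forall s : R, -1 <= s <= 1 -> `|p.[s]| <= M) -> N (peval h p) <= M.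
Proof.
move=> sh h1 pM; apply/ler_addgt0Pr => e e0.
have M0 : 0 <= M by apply: le_trans (pM 0 _); rewrite ?normr_ge0// lerN10 ler01.
have [|w [sw bw we]] := @upos_sqrt h (peval h (((M + e) ^+ 2)%:P - p * p)).
  apply: peval_pos => // s /pM; rewrite hornerD hornerN hornerM hornerC ler_norml.
  by move=> /andP[? ?]; nra.
apply: (@norm_le_of_sum_sqr _ w) => //; first lra.
- exact: peval_sa.
- exact: bicommC (peval_bicomm p) bw.
by rewrite -we -pevalM -pevalD addrC subrK pevalC.
Qed.

End PolynomialCalculus.

(** * Real-valued norms, Cauchy limits and best constants *)

Section RealNorm.
Variables (R : realType).

Section Normed.
Variable W : normedModType R[i].
Implicit Types x y z : W.

Lemma rnormD x y : rnorm (x + y) <= rnorm x + rnorm y.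
Proof. by have := ler_normD x y; rewrite !rnormE -rmorphD lecR. Qed.

Lemma rnormZ (c : R[i]) x : rnorm (c *: x) = complex.Re `|c| * rnorm x.
Proof.
rewrite {1}/rnorm normrZ rnormE normc_def /=.
by rewrite mulr0 subr0.
Qed.

Lemma rnorm0 : rnorm (0 : W) = 0.
Proof. by rewrite /rnorm normr0. Qed.

Lemma rnorm_eq0 x : rnorm x = 0 -> x = 0.
Proof. by move=> e; apply/eqP; rewrite -normr_eq0 rnormE e. Qed.

Lemma rnormN x : rnorm (- x) = rnorm x.
Proof. by rewrite /rnorm normrN. Qed.

Lemma rnormB x y : rnorm (x - y) <= rnorm x + rnorm y.
Proof. by rewrite -(rnormN y) rnormD. Qed.

Lemma rnormBC x y : rnorm (x - y) = rnorm (y - x).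
Proof. by rewrite -rnormN opprB. Qed.

Lemma rnorm_tri y x z : rnorm (x - z) <= rnorm (x - y) + rnorm (y - z).
Proof. by have := rnormD (x - y) (y - z); rewrite addrA subrK. Qed.

Lemma rnorm_eps x : (forall eps, 0 < eps -> rnorm x <= eps) -> x = 0.
Proof.
move=> h; apply: rnorm_eq0; apply/eqP; rewrite eq_le rnorm_ge0 andbT.
by apply/ler_addgt0Pl => e /h; rewrite addr0.
Qed.

Lemma gt0_complex (e : R[i]) : 0 < e -> exists2 r : R, 0 < r & e = (r%:C)%C.
Proof. by case: e => a b; rewrite ltcE /= => /andP[/eqP -> a0]; exists a. Qed.

Lemma closed_approx (C : set W) x : closed C ->
  (forall eps, 0 < eps -> exists2 y, C y & rnorm (x - y) <= eps) -> C x.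
Proof.
move=> Cc h; apply: Cc => U /nbhs_ballP [e /= /gt0_complex [r r0 ->] eU].
have [|y Cy xy] := h (r / 2); first by rewrite divr_gt0.
exists y; split=> //; apply: eU; rewrite -ball_normE /= rnormE ltcR.
by apply: le_lt_trans xy _; lra.
Qed.

Lemma closure_approx (C : set W) x : closure C x ->
  forall eps, 0 < eps -> exists2 y, C y & rnorm (x - y) <= eps.
Proof.
move=> cx e e0; have [|y [Cy]] := cx (ball x (e%:C)%C).
  by apply: nbhsx_ballx; rewrite ltcR.
by rewrite -ball_normE /= rnormE ltcR => /ltW h; exists y.
Qed.

Lemma closedP (C : set W) :
  (forall x, (forall eps, 0 < eps -> exists2 y, C y & rnorm (x - y) <= eps) -> C x) ->
  closed C.
Proof. by move=> h x /closure_approx /h. Qed.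

End Normed.

Lemma cauchy_limit (W : completeNormedModType R[i]) (w : nat -> W) :
  (forall eps, 0 < eps -> exists n0, forall n m, (n0 <= n)%N -> (n0 <= m)%N ->
     rnorm (w n - w m) <= eps) ->
  exists l, forall eps, 0 < eps -> exists n0, forall n, (n0 <= n)%N ->
     rnorm (w n - l) <= eps.
Proof.
move=> h.
have : cauchy (w @ \oo).
  apply/cauchyP => e /gt0_complex [r r0 ->].
  have [|n0 hn] := h (r / 2); first by rewrite divr_gt0.
  exists (w n0); exists n0 => // n /= n0n.
  rewrite -ball_normE /= rnormE ltcR; apply: le_lt_trans (hn _ _ _ _) _ => //; lra.
move=> /cauchy_cvg /cvg_ex [l /cvgrPdist_lt wl]; exists l => e e0.
have [|n0 _ hn] := wl (e%:C)%C; first by rewrite ltcR.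
by exists n0 => n /hn; rewrite rnormE ltcR rnormBC => /ltW.
Qed.

Lemma cauchy_limit_real (w : nat -> R) :
  (forall eps, 0 < eps -> exists n0, forall n m, (n0 <= n)%N -> (n0 <= m)%N ->
     `|w n - w m| <= eps) ->
  exists l, forall eps, 0 < eps -> exists n0, forall n, (n0 <= n)%N ->
     `|w n - l| <= eps.
Proof.
move=> h.
have : cauchy (w @ \oo).
  apply/cauchyP => r r0.
  have [|n0 hn] := h (r / 2); first by rewrite divr_gt0.
  exists (w n0); exists n0 => // n /= n0n.
  rewrite /ball /=; apply: le_lt_trans (hn _ _ _ _) _ => //; lra.
move=> /cauchy_cvg /cvg_ex [l /cvgrPdist_lt wl]; exists l => e e0.
have [n0 _ hn] := wl e e0.
by exists n0 => n /hn; rewrite distrC => /ltW.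
Qed.

(** The distances telescope to differences of [e], which is nondecreasing and bounded, hence close
    to its supremum from some index on. *)
Lemma cauchy_of_variation (d : nat -> nat -> R) (e : nat -> R) (M : R) :
  (forall n, d n n = 0) -> (forall n m, d n m = d m n) ->
  (forall n m k, d n k <= d n m + d m k) ->
  (forall n, d n.+1 n <= e n.+1 - e n) -> (forall n, e n <= M) ->
  forall eps, 0 < eps -> exists n0, forall n m, (n0 <= n)%N -> (n0 <= m)%N ->
    d n m <= eps.
Proof.
move=> d0 dC dT de eM eps eps0.
have dmn n k : d (k + n)%N n <= e (k + n)%N - e n.
  elim: k => [|k IH]; first by rewrite add0n d0 subrr.
  by have := dT (k.+1 + n)%N (k + n)%N n; have := de (k + n)%N; rewrite addSn; lra.
have dpos n m : 0 <= d n m.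
  by have := dT n m n; rewrite d0 (dC m); lra.
have eS : has_sup (range e).
  by split; [exists (e 0%N), 0%N|exists M => _ [n _ <-]].
have [_ [n0 _ <-] h] := sup_adherent eps0 eS.
have eu n : e n <= sup (range e) by apply: ub_le_sup; [case: eS|exists n].
exists n0 => n m.
wlog nm : n m / (m <= n)%N.
  move=> hw; case/orP: (leq_total m n) => [|mn n1 n2]; first exact: hw.
  by rewrite dC; apply: hw.
move=> _ n0m; have := dmn m (n - m)%N; rewrite subnK// => h1.
have := dmn n0 (m - n0)%N; rewrite subnK//.
have := dpos m n0; have := eu n; lra.
Qed.

Lemma cauchy_limit_complex (w : nat -> R[i]) :
  (forall eps, 0 < eps -> exists n0, forall n m, (n0 <= n)%N -> (n0 <= m)%N ->
     complex.Re `|w n - w m| <= eps) ->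
  exists l, forall eps, 0 < eps -> exists n0, forall n, (n0 <= n)%N ->
     complex.Re `|w n - l| <= eps.
Proof.
move=> h.
have normRe (z : R[i]) : `|complex.Re z| <= complex.Re `|z|.
  rewrite normc_def /= -sqrtr_sqr ler_wsqrtr//.
  by rewrite lerDl sqr_ge0.
have normIm (z : R[i]) : `|complex.Im z| <= complex.Re `|z|.
  rewrite normc_def /= -sqrtr_sqr ler_wsqrtr//.
  by rewrite lerDr sqr_ge0.
have normle (z : R[i]) : complex.Re `|z| <= `|complex.Re z| + `|complex.Im z|.
  rewrite normc_def /= -[leRHS]ger0_norm ?addr_ge0// -sqrtr_sqr ler_wsqrtr//.
  rewrite sqrrD !real_normK ?num_real// addrAC lerDl.
  by rewrite mulrn_wge0 ?mulr_ge0.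
have reB (a b : R[i]) : complex.Re (a - b) = complex.Re a - complex.Re b by case: a; case: b.
have imB (a b : R[i]) : complex.Im (a - b) = complex.Im a - complex.Im b by case: a; case: b.
have [|a ha] := @cauchy_limit_real (fun n => complex.Re (w n)).
  move=> e /h [n0 hn]; exists n0 => n m n1 m1; rewrite -reB.
  exact: le_trans (normRe _) (hn _ _ n1 m1).
have [|b hb] := @cauchy_limit_real (fun n => complex.Im (w n)).
  move=> e /h [n0 hn]; exists n0 => n m n1 m1; rewrite -imB.
  exact: le_trans (normIm _) (hn _ _ n1 m1).
exists (a +i* b)%C => e e0.
have e2 : 0 < e / 2 by lra.
have [n1 h1] := ha _ e2; have [n2 h2] := hb _ e2.
exists (maxn n1 n2) => n; rewrite geq_max => /andP[/h1 l1 /h2 l2].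
apply: le_trans (normle _) _; rewrite reB imB /=; lra.
Qed.

(** An operator norm when F x = |A x| and G x = |x|. It serves both the left action of the
    unitization and the operators on the Fock module. *)
Definition bnd (X : Type) (F G : X -> R) : R :=
  inf [set M | 0 <= M /\ forall x, F x <= M * G x].

Section Bnd.
Variables (X : Type) (F G : X -> R).
Hypotheses (G0 : forall x, 0 <= G x).

Lemma bnd_lb : has_lbound [set M | 0 <= M /\ forall x, F x <= M * G x].
Proof. by exists 0 => M []. Qed.

Lemma bnd_le M : 0 <= M -> (forall x, F x <= M * G x) -> bnd F G <= M.
Proof. by move=> M0 h; apply: ge_inf; [exact: bnd_lb|]. Qed.

Lemma bndP x : (exists M, forall x, F x <= M * G x) -> F x <= bnd F G * G x.
Proof.
move=> [M hM].
have ne : [set M | 0 <= M /\ forall x, F x <= M * G x] !=set0.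
  exists (Num.max 0 M); split; first by rewrite le_max lexx.
  by move=> y; apply: le_trans (hM y) _; rewrite ler_wpM2r// le_max lexx orbT.
have [g0|g0] := eqVneq (G x) 0.
  by rewrite g0 mulr0; have := hM x; rewrite g0 mulr0.
have gp : 0 < G x by rewrite lt_neqAle eq_sym g0 G0.
rewrite -ler_pdivrMr//; apply: lb_le_inf => // K [K0 hK].
by rewrite ler_pdivrMr.
Qed.

Lemma bnd_ge0 : (exists M, forall x, F x <= M * G x) -> 0 <= bnd F G.
Proof.
move=> [M hM]; apply: lb_le_inf => [|K []//].
exists (Num.max 0 M); split; first by rewrite le_max lexx.
by move=> y; apply: le_trans (hM y) _; rewrite ler_wpM2r// le_max lexx orbT.
Qed.

End Bnd.

(** One inequality suffices for the C*-identity: N(x)^2 <= N(s x) N(x) gives N(x) <= N(s x), hence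
    equality by involutivity, and submultiplicativity gives the converse bound. *)
Lemma cstar_norm_of_ineq (X : Type) (m : X -> X -> X) (s : X -> X) (N : X -> R) :
  involutive s -> (forall x, 0 <= N x) ->
  (forall x y, N (m x y) <= N x * N y) -> (forall x, N x ^+ 2 <= N (m (s x) x)) ->
  forall x, N (m (s x) x) = N x ^+ 2.
Proof.
move=> sK N0 NM h.
have le x : N x <= N (s x).
  have [->|n0] := eqVneq (N x) 0; first exact: N0.
  have p : 0 < N x by rewrite lt_neqAle eq_sym n0 N0.
  by rewrite -(ler_pM2r p) -expr2 (le_trans (h x)).
move=> x; apply/eqP; rewrite eq_le h andbT.
apply: le_trans (NM _ _) _; rewrite expr2 ler_wpM2r//.
by rewrite -{2}(sK x).
Qed.

End RealNorm.

Section CstarBasics.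
Variables (R : realType) (A : cstarAlg R).
Implicit Types a b x y z : A.

Lemma cmulDDl a b x : cmul (a + b) x = cmul a x + cmul b x.
Proof. by have := cmulDl 1 a b x; rewrite !scale1r. Qed.

Lemma cmulDDr x a b : cmul x (a + b) = cmul x a + cmul x b.
Proof. by have := cmulDr 1 x a b; rewrite !scale1r. Qed.

Lemma cmulZl (c : R[i]) a b : cmul (c *: a) b = c *: cmul a b.
Proof. by have := cmulZ c 1 a b; rewrite scale1r mulr1. Qed.

Lemma cmulZr (c : R[i]) a b : cmul a (c *: b) = c *: cmul a b.
Proof. by have := cmulZ 1 c a b; rewrite scale1r mul1r. Qed.

Lemma cmulNl a b : cmul (- a) b = - cmul a b.
Proof. by rewrite -scaleN1r cmulZl scaleN1r. Qed.

Lemma cmulNr a b : cmul a (- b) = - cmul a b.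
Proof. by rewrite -scaleN1r cmulZr scaleN1r. Qed.

Lemma cmulBl a b x : cmul (a - b) x = cmul a x - cmul b x.
Proof. by rewrite cmulDDl cmulNl. Qed.

Lemma cmulBr x a b : cmul x (a - b) = cmul x a - cmul x b.
Proof. by rewrite cmulDDr cmulNr. Qed.

Lemma cstarDD a b : cstar (a + b) = cstar a + cstar b.
Proof. by have := cstarD 1 a b; rewrite rmorph1 !scale1r. Qed.

Lemma cstarN a : cstar (- a) = - cstar a.
Proof. by rewrite -scaleN1r cstarZ rmorphN rmorph1 scaleN1r. Qed.

Lemma cstarB a b : cstar (a - b) = cstar a - cstar b.
Proof. by rewrite cstarDD cstarN. Qed.

Lemma rnormM a b : rnorm (cmul a b) <= rnorm a * rnorm b.
Proof. by have := cnormM a b; rewrite !rnormE -rmorphM lecR. Qed.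

Lemma rnormC a : rnorm (cmul (cstar a) a) = rnorm a ^+ 2.
Proof. by have := cstar_norm a; rewrite !rnormE -rmorphXn => /complexI. Qed.

Lemma rnorm_star a : rnorm (cstar a) = rnorm a.
Proof.
have le y : rnorm y <= rnorm (cstar y).
  have [->|n0] := eqVneq (rnorm y) 0; first exact: rnorm_ge0.
  have p : 0 < rnorm y by rewrite lt_neqAle eq_sym n0 rnorm_ge0.
  by rewrite -(ler_pM2r p) -expr2 -rnormC rnormM.
by apply/eqP; rewrite eq_le -{2}(cstarK a) !le.
Qed.

End CstarBasics.

Definition uring (R : realType) (A : cstarAlg R) : Type := (R[i]^o * (A : lmodType R[i]))%type.

(** * Unitization *)

Section Unitization.
Variables (R : realType) (A : cstarAlg R).

HB.instance Definition _ := GRing.Lmodule.on (uring A).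

Implicit Types x y : uring A.

Definition ur1 : uring A := (1, 0).
Definition urmul x y : uring A := (x.1 * y.1, x.1 *: y.2 + y.1 *: x.2 + cmul x.2 y.2).

Lemma urD1 x y : (x + y).1 = x.1 + y.1. Proof. by []. Qed.
Lemma urD2 x y : (x + y).2 = x.2 + y.2. Proof. by []. Qed.
Lemma urZ1 (c : R[i]) x : (c *: x).1 = c * x.1. Proof. by []. Qed.
Lemma urZ2 (c : R[i]) x : (c *: x).2 = c *: x.2. Proof. by []. Qed.

Lemma urmulA : associative urmul.
Proof.
move=> [a x] [b y] [c z]; rewrite /urmul /=; congr pair; first exact: mulrA.
rewrite !(cmulDDl, cmulDDr, cmulZl, cmulZr, scalerDr, scalerA) cmulA.
rewrite (mulrC c a) (mulrC c b) -!addrA; congr (_ + _); congr (_ + _).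
by rewrite addrCA; congr (_ + _); rewrite [RHS]addrCA; congr (_ + _); rewrite addrCA.
Qed.

Lemma ur1l : left_id ur1 urmul.
Proof. by move=> [a x]; rewrite /urmul /= mul1r scale1r scaler0 cmul0l !addr0. Qed.

Lemma ur1r : right_id ur1 urmul.
Proof. by move=> [a x]; rewrite /urmul /= mulr1 scale1r scaler0 cmul0r addr0 add0r. Qed.

Lemma urmulDl : left_distributive urmul +%R.
Proof.
move=> [a x] [b y] [c z]; rewrite /urmul /=; congr pair; first exact: mulrDl.
by rewrite scalerDl scalerDr cmulDDl [X in X + _]addrACA [LHS]addrACA.
Qed.

Lemma urmulDr : right_distributive urmul +%R.
Proof.
move=> [c z] [a x] [b y]; rewrite /urmul /=; congr pair; first exact: mulrDr.
by rewrite scalerDl scalerDr cmulDDr [X in X + _]addrACA [LHS]addrACA.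
Qed.

Lemma ur1_neq0 : ur1 != 0.
Proof. by apply/eqP => -[] /eqP; rewrite oner_eq0. Qed.

HB.instance Definition _ := GRing.Zmodule_isNzRing.Build (uring A)
  urmulA ur1l ur1r urmulDl urmulDr ur1_neq0.

Lemma urscalerAl (c : R[i]) x y : c *: (x * y) = (c *: x) * y.
Proof.
case: x y => [a x] [b y]; congr pair => /=; first exact: mulrA.
by rewrite !(cmulZl, scalerDr, scalerA) (mulrC b).
Qed.

HB.instance Definition _ := GRing.Lmodule_isLalgebra.Build R[i] (uring A) urscalerAl.

Lemma urscalerAr (c : R[i]) x y : c *: (x * y) = x * (c *: y).
Proof.
case: x y => [a x] [b y]; congr pair => /=; first exact: mulrCA.
by rewrite !(cmulZr, scalerDr, scalerA) (mulrC a).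
Qed.

HB.instance Definition _ := GRing.Lalgebra_isAlgebra.Build R[i] (uring A) urscalerAr.

Definition uract x (z : A) : A := x.1 *: z + cmul x.2 z.

Lemma uractM x y (z : A) : uract (x * y) z = uract x (uract y z).
Proof.
case: x y => [a x] [b y]; rewrite /uract /=.
rewrite !(cmulDDl, cmulDDr, cmulZl, cmulZr, scalerDr, scalerA) cmulA -!addrA.
by congr (_ + _); congr (_ + _).
Qed.

Lemma uractD x y (z : A) : uract (x + y) z = uract x z + uract y z.
Proof. by rewrite /uract urD1 urD2 scalerDl cmulDDl addrACA. Qed.

Lemma uractZ (c : R[i]) x (z : A) : uract (c *: x) z = c *: uract x z.
Proof. by rewrite /uract urZ1 urZ2 scalerDr cmulZl scalerA. Qed.

Definition urstar x : uring A := (x.1^*, cstar x.2).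

Lemma uract_adj x (z w : A) :
  cmul (cstar (uract x z)) w = cmul (cstar z) (uract (urstar x) w).
Proof.
case: x => [a x]; rewrite /uract /= cstarDD cstarZ cstarM cmulDDl cmulDDr.
by rewrite cmulZl cmulZr cmulA.
Qed.

Definition uropn x : R := bnd (fun z : A => rnorm (uract x z)) (fun z : A => rnorm z).

Lemma uract_bd x : exists M, forall z : A, rnorm (uract x z) <= M * rnorm z.
Proof.
exists (complex.Re `|x.1| + rnorm x.2) => z.
apply: le_trans (rnormD _ _) _; rewrite mulrDl rnormZ lerD2l; exact: rnormM.
Qed.

Lemma uropnP x (z : A) : rnorm (uract x z) <= uropn x * rnorm z.
Proof.
apply: (@bndP _ _ (fun z => rnorm (uract x z)) (fun z => rnorm z)).
  by move=> ?; exact: rnorm_ge0.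
exact: uract_bd.
Qed.

Lemma uropn_ge0 x : 0 <= uropn x.
Proof. by apply: bnd_ge0 => //; [move=> ?; exact: rnorm_ge0|exact: uract_bd]. Qed.

Lemma uropn_le x M : 0 <= M -> (forall z : A, rnorm (uract x z) <= M * rnorm z) ->
  uropn x <= M.
Proof. exact: bnd_le. Qed.

Lemma uropnM x y : uropn (x * y) <= uropn x * uropn y.
Proof.
apply: uropn_le => [|z]; first by rewrite mulr_ge0 ?uropn_ge0.
rewrite uractM -mulrA; apply: le_trans (uropnP _ _) _.
by rewrite ler_wpM2l ?uropn_ge0// uropnP.
Qed.

Lemma uropn_sqr x : uropn x ^+ 2 <= uropn (urstar x * x).
Proof.
have h : uropn x <= Num.sqrt (uropn (urstar x * x)).
  apply: uropn_le => [|z]; first exact: sqrtr_ge0.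
  rewrite -ler_sqr ?nnegrE ?mulr_ge0 ?sqrtr_ge0 ?rnorm_ge0//.
  rewrite exprMn sqr_sqrtr ?uropn_ge0// -rnormC uract_adj -uractM.
  apply: le_trans (rnormM _ _) _; rewrite rnorm_star mulrC expr2 mulrA.
  by rewrite ler_wpM2r ?rnorm_ge0// uropnP.
rewrite -[leRHS]sqr_sqrtr ?uropn_ge0// ler_sqr ?nnegrE ?uropn_ge0 ?sqrtr_ge0//.
Qed.

Lemma uropn_elt (a : A) : uropn ((0, a) : uring A) = rnorm a.
Proof.
apply/eqP; rewrite eq_le; apply/andP; split.
  apply: uropn_le => [|z]; first exact: rnorm_ge0.
  by rewrite /uract /= scale0r add0r rnormM.
have [->|n0] := eqVneq (rnorm a) 0; first exact: uropn_ge0.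
have p : 0 < rnorm a by rewrite lt_neqAle eq_sym n0 rnorm_ge0.
have := uropnP ((0, a) : uring A) (cstar a).
have := rnormC (cstar a); rewrite cstarK /uract /= scale0r add0r => ->.
by rewrite rnorm_star expr2 ler_pM2r.
Qed.

(** If [A] already has a unit e, the left action of 1 - e is zero, so the operator norm is only a
    seminorm. The maximum with the modulus of the scalar part repairs this and keeps the
    C*-identity. *)
Definition urnorm x : R := Num.max (uropn x) (complex.Re `|x.1|).

Lemma Re_normM (a b : R[i]) : complex.Re `|a * b| = complex.Re `|a| * complex.Re `|b|.
Proof. by rewrite normrM; case: (`|a|) (`|b|) (normr_ge0 a) (normr_ge0 b) => [a1 a2] [b1 b2];
  rewrite !lecE /= => /andP[/eqP -> _] /andP[/eqP -> _]; rewrite mulr0 subr0. Qed.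

Lemma Re_normD (a b : R[i]) : complex.Re `|a + b| <= complex.Re `|a| + complex.Re `|b|.
Proof. by have := ler_normD a b; rewrite lecE => /andP[_]; case: `|a|; case: `|b|. Qed.

Lemma Re_norm_ge0 (a : R[i]) : 0 <= complex.Re `|a|.
Proof. by have := normr_ge0 a; rewrite lecE => /andP[_]. Qed.

Lemma Re_norm0 : complex.Re `|0 : R[i]| = 0.
Proof. by rewrite normc_def /= expr0n addr0 sqrtr0. Qed.

Lemma Re_norm_conj (a : R[i]) : complex.Re `|a^*| = complex.Re `|a|.
Proof. by rewrite norm_conjC. Qed.

Lemma Re_norm_eq0 (a : R[i]) : complex.Re `|a| = 0 -> a = 0.
Proof.
move=> h; apply/eqP; rewrite -normr_eq0; apply/eqP.
have := normr_ge0 a; rewrite lecE => /andP[/eqP i0 _].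
by apply/eqP; rewrite eq_complex h i0 !eqxx.
Qed.

Lemma urstarD x y : urstar (x + y) = urstar x + urstar y.
Proof. by congr pair; [rewrite rmorphD|rewrite cstarDD]. Qed.

Lemma urstarZ (c : R[i]) x : urstar (c *: x) = c^* *: urstar x.
Proof. by congr pair; [rewrite rmorphM|rewrite cstarZ]. Qed.

Lemma urstarM x y : urstar (x * y) = urstar y * urstar x.
Proof.
congr pair => /=; first by rewrite rmorphM mulrC.
by rewrite !cstarDD !cstarZ cstarM (addrC (_ *: _)).
Qed.

Lemma urstarK x : urstar (urstar x) = x.
Proof. by case: x => a x; rewrite /urstar /= conjCK cstarK. Qed.

Lemma urnorm_ge0 x : 0 <= urnorm x.
Proof. by rewrite le_max uropn_ge0. Qed.

Lemma ur_elt x : x = (x.1 *: 1) + ((0, x.2) : uring A).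
Proof.
case: x => a x; congr pair.
  by change (a = a * 1 + 0); rewrite mulr1 addr0.
by change (x = a *: (0 : A) + x); rewrite scaler0 add0r.
Qed.

Lemma uropn1 : uropn 1 <= 1.
Proof. by apply: uropn_le => // z; rewrite /uract /= scale1r cmul0l addr0 mul1r. Qed.

Lemma uropnD x y : uropn (x + y) <= uropn x + uropn y.
Proof.
apply: uropn_le => [|z]; first by rewrite addr_ge0 ?uropn_ge0.
by rewrite uractD mulrDl; apply: le_trans (rnormD _ _) (lerD _ _); exact: uropnP.
Qed.

Lemma uropnZ_le (c : R[i]) x : uropn (c *: x) <= complex.Re `|c| * uropn x.
Proof.
apply: uropn_le => [|z]; first by rewrite mulr_ge0 ?uropn_ge0 ?Re_norm_ge0.
by rewrite uractZ rnormZ -mulrA ler_wpM2l ?Re_norm_ge0// uropnP.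
Qed.

Lemma uropnZ (c : R[i]) x : uropn (c *: x) = complex.Re `|c| * uropn x.
Proof.
apply/eqP; rewrite eq_le uropnZ_le andTb.
have [->|c0] := eqVneq c 0; first by rewrite Re_norm0 mul0r uropn_ge0.
have := uropnZ_le c^-1 (c *: x); rewrite scalerA mulVf// scale1r => h.
apply: le_trans (ler_wpM2l (Re_norm_ge0 c) h) _.
by rewrite mulrA -Re_normM divff// normr1 mul1r.
Qed.

(** The second component is [x] minus its scalar part, and each of the two is bounded by the norm of
    [x]. Completeness of the unitization rests on this comparison. *)
Lemma rnorm_le_ur x : rnorm x.2 <= 2 * urnorm x.
Proof.
rewrite -uropn_elt.
have -> : (0, x.2) = x - x.1 *: (1 : uring A) :> uring A.
  by rewrite {2}(ur_elt x) addrAC subrr add0r.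
rewrite -scaleNr; apply: le_trans (uropnD _ _) _.
have := uropnZ_le (- x.1) 1; rewrite normrN => h.
have := ler_wpM2l (Re_norm_ge0 x.1) uropn1; rewrite mulr1.
have : uropn x <= urnorm x by rewrite le_max lexx.
have : complex.Re `|x.1| <= urnorm x by rewrite le_max lexx orbT.
lra.
Qed.

Lemma urnorm_eq0 x : urnorm x = 0 -> x = 0.
Proof.
move=> h; have := rnorm_le_ur x; rewrite h mulr0 => h2.
have e2 : x.2 = 0 by apply: rnorm_eq0; apply/eqP; rewrite eq_le h2 rnorm_ge0.
have : complex.Re `|x.1| <= 0 by rewrite -h le_max lexx orbT.
move=> h1; have e1 : x.1 = 0 by apply: Re_norm_eq0; apply/eqP; rewrite eq_le h1 Re_norm_ge0.
by case: x e1 e2 {h h1 h2} => a x /= -> ->.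
Qed.

Lemma urnormD x y : urnorm (x + y) <= urnorm x + urnorm y.
Proof.
rewrite ge_max; apply/andP; split.
  by apply: le_trans (uropnD _ _) _; rewrite lerD// le_max lexx.
by apply: le_trans (Re_normD _ _) _; rewrite lerD// le_max lexx orbT.
Qed.

Lemma urnormZ (c : R[i]) x : urnorm (c *: x) = complex.Re `|c| * urnorm x.
Proof. by rewrite /urnorm uropnZ urZ1 Re_normM maxr_pMr// Re_norm_ge0. Qed.

Lemma urnormM x y : urnorm (x * y) <= urnorm x * urnorm y.
Proof.
rewrite ge_max; apply/andP; split.
  apply: le_trans (uropnM _ _) _.
  by apply: ler_pM; rewrite ?uropn_ge0// le_max lexx.
by rewrite Re_normM; apply: ler_pM; rewrite ?Re_norm_ge0// le_max lexx orbT.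
Qed.

Lemma urnormC x : urnorm (urstar x * x) = urnorm x ^+ 2.
Proof.
apply: (cstar_norm_of_ineq urstarK urnorm_ge0 urnormM) => y.
have [h|h] := leP (uropn y) (complex.Re `|y.1|).
  rewrite /urnorm (max_r h) le_max; apply/orP; right.
  by rewrite Re_normM Re_norm_conj expr2.
rewrite /urnorm (max_l (ltW h)) le_max; apply/orP; left; exact: uropn_sqr.
Qed.

Lemma ur_complete (u : nat -> uring A) (e : nat -> R) (M : R) :
    (forall n, urnorm (u n.+1 - u n) <= e n.+1 - e n) -> (forall n, e n <= M) ->
    exists l, forall eps, 0 < eps -> exists n0, forall n, (n0 <= n)%N ->
      urnorm (u n - l) <= eps.
Proof.
move=> ue eM.
have h1 x : complex.Re `|x.1| <= urnorm x by rewrite le_max lexx orbT.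
have urnormN (x : uring A) : urnorm (- x) = urnorm x.
  by rewrite -scaleN1r urnormZ normrN1 mul1r.
have cu := @cauchy_of_variation R (fun n m => urnorm (u n - u m)) e M _ _ _ ue eM.
have {}cu : forall eps, 0 < eps -> exists n0, forall n m, (n0 <= n)%N -> (n0 <= m)%N ->
    urnorm (u n - u m) <= eps.
  apply: cu => [n|n m|n m k].
  - by rewrite subrr -(scale0r (0 : uring A)) urnormZ normr0 mul0r.
  - by rewrite -urnormN opprB.
  - by have := urnormD (u n - u m) (u m - u k); rewrite addrA subrK.
have [|a ha] := @cauchy_limit_complex R (fun n => (u n).1).
  move=> r /cu [n0 hn]; exists n0 => n m n1 m1.
  exact: le_trans (h1 (u n - u m)) (hn _ _ n1 m1).
have [|x hx] := @cauchy_limit R A (fun n => (u n).2).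
  move=> r r0; have [|n0 hn] := cu (r / 2); first lra.
  exists n0 => n m n1 m1; have := hn _ _ n1 m1; have := rnorm_le_ur (u n - u m).
  by move=> /=; lra.
exists ((a, x) : uring A) => r r0.
have r2 : 0 < r / 2 by lra.
have [n1 k1] := ha _ r2; have [n2 k2] := hx _ r2.
exists (maxn n1 n2) => n; rewrite geq_max => /andP[/k1 l1 /k2 l2].
have := urnormD (((u n).1 - a) *: (1 : uring A)) ((0, (u n).2 - x) : uring A).
rewrite -(ur_elt (u n - (a, x))) urnormZ [urnorm (0, _)]/urnorm uropn_elt.
rewrite Re_norm0 max_l ?rnorm_ge0//.
have u1 : urnorm 1 <= 1 by rewrite ge_max uropn1 normr1 lexx.
have := ler_wpM2l (Re_norm_ge0 ((u n).1 - a)) u1; rewrite mulr1.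
move: l1 l2 => /=; lra.
Qed.

Definition unitization : ucstar R :=
  Ucstar urstarD urstarZ urstarM urstarK urnorm_ge0 urnorm_eq0 urnormD urnormZ
    urnormM urnormC ur_complete.

End Unitization.

(** * Homomorphisms and approximation of their kernels *)

Section StarHoms.
Variable R : realType.
Implicit Types A B : cstarAlg R.
Local Notation "r *' x" := ((r%:C)%C *: x) (at level 40).

Definition ufst {A} (x : unitization A) : R[i] := (x : uring A).1.
Definition usnd {A} (x : unitization A) : A := (x : uring A).2.

Lemma ufstD {A} (x y : unitization A) : ufst (x + y) = ufst x + ufst y. Proof. by []. Qed.
Lemma ufstZ {A} c (x : unitization A) : ufst (c *: x) = c * ufst x. Proof. by []. Qed.
Lemma ufstM {A} (x y : unitization A) : ufst (x * y) = ufst x * ufst y. Proof. by []. Qed.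
Lemma usndD {A} (x y : unitization A) : usnd (x + y) = usnd x + usnd y. Proof. by []. Qed.
Lemma usndZ {A} c (x : unitization A) : usnd (c *: x) = c *: usnd x. Proof. by []. Qed.
Lemma usndM {A} (x y : unitization A) :
  usnd (x * y) = ufst x *: usnd y + ufst y *: usnd x + cmul (usnd x) (usnd y).
Proof. by []. Qed.

Definition uemb A (a : A) : unitization A := ((0, a) : uring A).

Lemma ufst_emb A (a : A) : ufst (uemb a) = 0. Proof. by []. Qed.
Lemma usnd_emb A (a : A) : usnd (uemb a) = a. Proof. by []. Qed.

Lemma uembD A (a b : A) : uemb (a + b) = uemb a + uemb b.
Proof. by congr pair; rewrite /= addr0. Qed.

Lemma uembZ A (c : R[i]) (a : A) : uemb (c *: a) = c *: uemb a.
Proof. by congr pair; exact: esym (mulr0 c). Qed.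

Lemma uembN A (a : A) : uemb (- a) = - uemb a.
Proof. by rewrite -scaleN1r uembZ scaleN1r. Qed.

Lemma uembB A (a b : A) : uemb (a - b) = uemb a - uemb b.
Proof. by rewrite uembD uembN. Qed.

Lemma uembM A (a b : A) : uemb (cmul a b) = uemb a * uemb b.
Proof.
congr pair; first exact: esym (mulr0 _).
by change (cmul a b = 0 *: b + 0 *: a + cmul a b); rewrite !scale0r !add0r.
Qed.

Lemma uemb_star A (a : A) : ustar (uemb a) = uemb (cstar a).
Proof. by congr pair; rewrite /= conjC0. Qed.

Lemma uemb_norm A (a : A) : unorm (uemb a) = rnorm a.
Proof.
by rewrite /unorm /= /urnorm uropn_elt Re_norm0 max_l// rnorm_ge0.
Qed.

Lemma uemb_inj A : injective (@uemb A).
Proof. by move=> a b []. Qed.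

Lemma uemb_snd {A} (x : unitization A) :
  ufst x = 0 -> x = uemb (usnd x).
Proof. by case: x => l a /= ->. Qed.

Lemma sqr_1B (V : pzRingType) (d : V) : (1 - d) * (1 - d) = 1 - (d + d - d * d).
Proof. by rewrite mulrBl mul1r mulrBr mulr1 opprB addrACA -opprD opprB addrA addrAC. Qed.

Lemma uclosed_fst {A} : @uclosed R (unitization A) (fun x => ufst x = 0).
Proof.
move=> x h; apply: Re_norm_eq0; apply/eqP; rewrite eq_le Re_norm_ge0 andbT.
apply/ler_addgt0Pl => e /h [z /= z0 ze]; rewrite addr0; apply: le_trans ze.
have -> : ufst x = ufst (x - z).
  by rewrite -scaleN1r ufstD ufstZ z0 mulr0 addr0.
by rewrite /unorm /= le_max lexx orbT.
Qed.

Lemma uclosed_snd {A} (S : set A) : closed S ->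
  @uclosed R (unitization A) (fun x => S (usnd x)).
Proof.
move=> cS x h; apply: closed_approx => // e e0.
have [|z Sz ze] := h (e / 2); first lra.
exists (usnd z) => //; have := rnorm_le_ur (x - z : uring A) => /=.
by move: ze; rewrite /unorm /=; lra.
Qed.

Lemma star_hom_on0 A B (S : set A) (f : A -> B) :
  is_cstar_subalg S -> star_hom_on S f -> f 0 = 0.
Proof.
move=> [_ S0 _ _ _] [fl _ _].
by have := fl (-1) 0 0 S0 S0; rewrite scaler0 addr0 scaleN1r addNr.
Qed.

Lemma csubB A (S : set A) : is_cstar_subalg S ->
  forall a b, S a -> S b -> S (a - b).
Proof. by move=> [_ _ SD _ _] a b Sa Sb; rewrite addrC -scaleN1r; exact: SD. Qed.

Lemma csubD A (S : set A) : is_cstar_subalg S ->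
  forall a b, S a -> S b -> S (a + b).
Proof. by move=> [_ _ SD _ _] a b Sa Sb; rewrite -[a]scale1r; exact: SD. Qed.

Lemma csubZ A (S : set A) : is_cstar_subalg S ->
  forall (c : R[i]) a, S a -> S (c *: a).
Proof. by move=> [_ S0 SD _ _] c a Sa; rewrite -[_ *: _]addr0; exact: SD. Qed.

Section Hom.
Variables (A B : cstarAlg R) (S : set A) (f : A -> B).
Hypotheses (hS : is_cstar_subalg S) (hf : star_hom_on S f).

Lemma homD a b : S a -> S b -> f (a + b) = f a + f b.
Proof. by case: hf => fl _ _ Sa Sb; have := fl 1 _ _ Sa Sb; rewrite !scale1r. Qed.

Lemma homZ (c : R[i]) a : S a -> f (c *: a) = c *: f a.
Proof.
move=> Sa; case: hf (hS) => fl _ _ [_ S0 _ _ _]; have := fl c _ _ Sa S0.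
by rewrite !addr0 (star_hom_on0 hS hf) addr0.
Qed.

Lemma homB a b : S a -> S b -> f (a - b) = f a - f b.
Proof.
move=> Sa Sb; rewrite -(scaleN1r b) -(scaleN1r (f b)) homD//; last exact: csubZ.
by rewrite homZ.
Qed.

(** Write 1 - y^2 = (1 - d)^2. Since the square root iteration has no constant term, d lies in [S]
    although [S] has no unit. Applying [f] gives f(y)^2 + (1 - f(d))^2 = 1 in the unitization of
    [B], which bounds |f(y)|. *)
Lemma hom_contract_sa y : S y -> cstar y = y -> rnorm y <= 1 -> rnorm (f y) <= 1.
Proof.
case: (hS) (hf) => Scl S0 SD SM Sstar [fl fM fs] Sy sy y1.
pose Y := uemb (cmul y y).
have NY : unorm Y <= 1.
  rewrite uemb_norm; apply: le_trans (rnormM _ _) _.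
  by rewrite mulr_ile1 ?rnorm_ge0.
have [c [ce cQ]] := sqrt1m NY.
have Sc : S (usnd c) /\ ufst c = 0.
  apply: (cQ (fun x => S (usnd x) /\ ufst x = 0)).
  - move=> x h; split; [apply: (uclosed_snd Scl)|apply: uclosed_fst] => e /h [z []];
      by exists z.
  - by [].
  - move=> x [Sx x0]; split; last by rewrite ufstZ ufstD ufst_emb ufstM x0 mulr0 addr0 mulr0.
    rewrite usndZ usndD usnd_emb usndM x0 !scale0r !add0r; apply: csubZ => //; apply: csubD => //; exact: SM.
have sc : ustar c = c.
  apply: (cQ (fun x => ustar x = x)); first exact: uclosed_sa.
    exact: ustar0.
  by move=> x sx; rewrite ustar_rs ustarD ustarM uemb_star cstarM sy sx.
have cc : c * uemb y = uemb y * c.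
  apply: (cQ (fun x => x * uemb y = uemb y * x)); first exact: uclosed_comm.
    by rewrite mul0r mulr0.
  move=> x xy; rewrite -scalerAl -scalerAr mulrDl mulrDr /Y uembM -!mulrA.
  by rewrite xy !mulrA xy.
have [Sd /uemb_snd cd] := Sc; move: (usnd c) Sd cd => d Sd cd; subst c.
have sd : cstar d = d by apply: uemb_inj; rewrite -uemb_star.
have dy : cmul d y = cmul y d by apply: uemb_inj; rewrite !uembM.
have de : d + d - cmul d d = cmul y y.
  apply: uemb_inj; rewrite uembB uembD !uembM.
  by move: ce; rewrite sqr_1B => /addrI /oppr_inj ->; rewrite /Y uembM.
rewrite -uemb_norm; apply: (@norm_le_of_sum_sqr _ _ _ (1 - uemb (f d))) => //.
- by rewrite uemb_star -fs// sy.
- by rewrite ustarB ustar1 uemb_star -fs// sd.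
- by rewrite mulrBl mulrBr mul1r mulr1 -!uembM -!fM// dy.
rewrite -uembM -fM// -de homB ?homD//; [|exact: csubD|exact: SM].
by rewrite fM// uembB uembD uembM sqr_1B addrC subrK expr1n rs1.
Qed.

End Hom.
End StarHoms.

(** * Scalar polynomials: absolute value, bump and cutoff *)

Section Scalars.
Variable R : realType.
Implicit Types (u : {poly R}) (s x : R).

(* Iterates converging to the absolute value on [-1, 1]. *)
Fixpoint pabs u k : {poly R} :=
  if k is k'.+1 then pabs u k' + 2^-1 *: (u ^+ 2 - pabs u k' ^+ 2) else 0.

(** With a = |u(s)| and the error d = a - p, one step replaces d by d (1 - a + d/2), which is at
    most d (1 - d/2) since d <= a. This recursion yields d <= 2/(k + 2). *)
Lemma pabs_bd u s : `|u.[s]| <= 1 -> forall k,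
  0 <= `|u.[s]| - (pabs u k).[s] <= `|u.[s]| /\
  k.+2%:R * (`|u.[s]| - (pabs u k).[s]) <= 2.
Proof.
move=> u1; elim=> [|k].
  by rewrite /= horner0 subr0 normr_ge0 lexx; split => //; lra.
rewrite [pabs u k.+1]/= hornerD hornerZ hornerD hornerN !horner_exp -(real_normK (num_real u.[s])).
have := normr_ge0 u.[s]; move: (`|u.[s]|) u1 (pabs u k).[s] => a a1 p a0 [/andP[h1 h2] h3].
set d := a - p in h1 h2 h3.
have -> : a - (p + 2^-1 * (a ^+ 2 - p ^+ 2)) = d * (1 - a + d / 2) by rewrite /d; field.
have d1 : d <= 1 by lra.
split; first by apply/andP; split; nra.
apply: (@le_trans _ _ (k.+3%:R * (d * (1 - d / 2)))).
  rewrite ler_wpM2l ?ler0n//; nra.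
have : 2 <= k.+2%:R :> R by rewrite ler_nat.
have -> : k.+3%:R = k.+2%:R + 1 :> R by rewrite -natr1.
move: (k.+2%:R) h3 => m h3 m2.
rewrite -subr_ge0 (_ : 2 - _ = (2 - m * d) * (1 - d / 2) + d ^+ 2 / 2); last by field.
by rewrite addr_ge0 ?mulr_ge0 ?sqr_ge0 ?invr_ge0//; lra.
Qed.

Definition rate k : R := k.+2%:R^-1.

Lemma rate_gt0 k : 0 < rate k.
Proof. by rewrite invr_gt0 ltr0n. Qed.

Lemma rate_le1 k : rate k <= 1.
Proof. by rewrite invf_le1 ?ltr0n// ler1n. Qed.

Lemma rate_small (eps : R) : 0 < eps -> exists n0, forall n, (n0 <= n)%N -> rate n <= eps.
Proof.
move=> e0; have := archi_boundP (ltW (_ : 0 < eps^-1)); rewrite invr_gt0 => /(_ e0).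
set n0 := Num.bound _ => h; exists n0 => n nn.
rewrite /rate -[eps]invrK lef_pV2 ?posrE ?invr_gt0 ?ltr0n//.
by apply: le_trans (ltW h) _; rewrite ler_nat; lia.
Qed.

(* A polynomial approximation of s^2 (s^2 - r^2)_+ / 2. *)
Definition bump (r : R) k : {poly R} :=
  4^-1 *: ('X^2 * ('X^2 - (r ^+ 2)%:P + pabs ('X^2 - (r ^+ 2)%:P) k + (2 * rate k)%:P)).

Section Bump.
Variables (r : R).
Hypothesis r01 : 0 <= r <= 1.

Let bumpE k s : -1 <= s <= 1 -> exists p, [/\ (bump r k).[s] =
    4^-1 * (s ^+ 2 * (s ^+ 2 - r ^+ 2 + p + 2 * rate k)),
   0 <= `|s ^+ 2 - r ^+ 2| - p <= `|s ^+ 2 - r ^+ 2|,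
   `|s ^+ 2 - r ^+ 2| - p <= 2 * rate k, `|s ^+ 2 - r ^+ 2| <= 1 & 0 <= s ^+ 2 <= 1].
Proof.
move=> /andP[s0 s1].
have e : ('X^2 - (r ^+ 2)%:P).[s] = s ^+ 2 - r ^+ 2 by rewrite !hornerE.
have s2 : 0 <= s ^+ 2 <= 1 by apply/andP; split; [exact: sqr_ge0|nra].
have r2 : 0 <= r ^+ 2 <= 1 by move: r01 => /andP[? ?]; apply/andP; split; [exact: sqr_ge0|nra].
have u1 : `|s ^+ 2 - r ^+ 2| <= 1 by rewrite ler_norml; lra.
have [|h1 h2] := @pabs_bd ('X^2 - (r ^+ 2)%:P) s _ k; first by rewrite e.
exists (pabs ('X^2 - (r ^+ 2)%:P) k).[s]; rewrite e in h1 h2; split=> //.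
  by rewrite /bump hornerZ hornerM !hornerD hornerN hornerC hornerXn hornerC.
by rewrite /rate ler_pdivlMr ?ltr0n// mulrC.
Qed.

(** The summand [2 * rate k] outweighs the error of [pabs] and gives nonnegativity; the bracket is
    at most 1 + 1 + 2, whence the factor 1/4. *)
Lemma bump_ge0 k s : -1 <= s <= 1 -> 0 <= (bump r k).[s] <= 1.
Proof.
move=> /(bumpE k) [p [-> h1 h2 h3 h4]].
have := rate_gt0 k; have := rate_le1 k; move: (rate k) h2 => e h2 e1 e0.
have : 0 <= s ^+ 2 - r ^+ 2 + p + 2 * e <= 4.
  move: (s ^+ 2 - r ^+ 2) h1 h2 h3 => x h1 h2 h3.
  by have := ler_norm x; have := ler_norm (- x); rewrite normrN; lra.
move: (s ^+ 2 - _ + _ + _) => a; move: (s ^+ 2) h4 => b h4 h5; nra.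
Qed.

Lemma bump_cauchy k l s : -1 <= s <= 1 ->
  `|(bump r k).[s] - (bump r l).[s]| <= rate k + rate l.
Proof.
move=> s1; have [p [-> h1 h2 h3 h4]] := bumpE k s1.
have [q [-> k1 k2 k3 _]] := bumpE l s1.
have := rate_gt0 k; have := rate_gt0 l; move: (rate k) (rate l) h2 k2 => e d h2 k2 d0 e0.
have : `|(p - q) + 2 * (e - d)| <= 4 * (e + d).
  by rewrite ler_norml; lra.
rewrite -!mulrBr.
have -> : s ^+ 2 - r ^+ 2 + p + 2 * e - (s ^+ 2 - r ^+ 2 + q + 2 * d) =
  (p - q) + 2 * (e - d) by ring.
move: ((p - q) + _) => a; move: (s ^+ 2) h4 => b h4; rewrite !normrM.
rewrite (ger0_norm (_ : 0 <= 4^-1)) ?invr_ge0// (ger0_norm (_ : 0 <= b)); last lra.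
have := normr_ge0 a; move: (`|a|) => c; nra.
Qed.

Lemma bump_small k s : - r <= s <= r -> (bump r k).[s] <= rate k.
Proof.
move=> sr; have s1 : -1 <= s <= 1 by move: r01 sr => /andP[? ?] /andP[? ?]; lra.
have [p [-> h1 h2 h3 h4]] := bumpE k s1.
have sr2 : s ^+ 2 <= r ^+ 2 by nra.
rewrite ler0_norm in h1 h2 h3; last lra.
have := rate_gt0 k; move: (rate k) h2 => e h2 e0.
have : s ^+ 2 - r ^+ 2 + p + 2 * e <= 4 * e by lra.
have : 0 <= s ^+ 2 - r ^+ 2 + p + 2 * e by lra.
move: (s ^+ 2 - _ + _ + _) => a; move: (s ^+ 2) h4 => b h4; nra.
Qed.

Lemma bump_large k s (d : R) : -1 <= s <= 1 -> 0 <= d -> r ^+ 2 + d <= s ^+ 2 ->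
  d ^+ 2 / 2 <= (bump r k).[s].
Proof.
move=> s1 d0 ds; have [p [-> h1 h2 h3 h4]] := bumpE k s1.
rewrite ger0_norm in h1 h2 h3; last lra.
have := rate_gt0 k; move: (rate k) h2 => e h2 e0.
have : 2 * d <= s ^+ 2 - r ^+ 2 + p + 2 * e by lra.
have : d <= s ^+ 2 by have := sqr_ge0 r; lra.
move: (s ^+ 2 - _ + _ + _) => a; move: (s ^+ 2) h4 => b h4; nra.
Qed.

(* A polynomial which is close to 1 on [-r, r] and to 0 away from it. *)
Definition cutoff N k : {poly R} := (1 - bump r k) ^+ N.

Lemma cutoffE N k s : (cutoff N k).[s] = (1 - (bump r k).[s]) ^+ N.
Proof. by rewrite /cutoff horner_exp hornerD hornerN hornerC. Qed.

Lemma cutoff0 N k : (cutoff N k).[0] = 1.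
Proof. by rewrite cutoffE /bump hornerZ hornerM hornerXn expr0n mul0r mulr0 subr0 expr1n. Qed.

Lemma cutoff_bd N k s : -1 <= s <= 1 -> 0 <= (cutoff N k).[s] <= 1.
Proof.
move=> /(bump_ge0 k) h; rewrite cutoffE exprn_ge0 ?exprn_ile1//; lra.
Qed.

Lemma expr_lip (a b : R) N : 0 <= a <= 1 -> 0 <= b <= 1 ->
  `|a ^+ N - b ^+ N| <= N%:R * `|a - b|.
Proof.
move=> /andP[a0 a1] /andP[b0 b1]; elim: N => [|N IH].
  by rewrite !expr0 subrr normr0 mul0r.
have -> : a ^+ N.+1 - b ^+ N.+1 = a * (a ^+ N - b ^+ N) + (a - b) * b ^+ N.
  by rewrite !exprS; ring.
apply: le_trans (ler_normD _ _) _; rewrite !normrM -natr1 mulrDl mul1r.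
apply: lerD.
  by apply: le_trans IH; rewrite ler_piMl// ger0_norm.
by rewrite ler_piMr// ger0_norm ?exprn_ge0// exprn_ile1.
Qed.

Lemma cutoff_cauchy N k l s : -1 <= s <= 1 ->
  `|(cutoff N k).[s] - (cutoff N l).[s]| <= N%:R * (rate k + rate l).
Proof.
move=> s1; rewrite !cutoffE; have := bump_ge0 k s1; have := bump_ge0 l s1 => h1 h2.
apply: le_trans (expr_lip _ _ _) _; try lra.
rewrite ler_wpM2l ?ler0n// (_ : 1 - _ - _ = (bump r l).[s] - (bump r k).[s]); last ring.
by rewrite [leRHS]addrC bump_cauchy.
Qed.

Lemma cutoff_near1 N k s : - r <= s <= r -> `|1 - (cutoff N k).[s]| <= N%:R * rate k.
Proof.
move=> sr; have s1 : -1 <= s <= 1 by move: r01 sr => /andP[? ?] /andP[? ?]; lra.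
rewrite cutoffE; have h := bump_ge0 k s1; have h2 := bump_small k sr.
rewrite -{1}(expr1n _ N); apply: le_trans (expr_lip _ _ _) _; try lra.
by rewrite ler_wpM2l ?ler0n// opprB addrC subrK ger0_norm//; lra.
Qed.

(** Where s^2 > r^2 + eps, the bump b is at least eps^2/2, and (1 - b)^N <= 1/(1 + N b) makes the
    cutoff at most eps once N eps^3/2 >= 1. [N] does not depend on [k], so the limit in [k] can be
    taken afterwards. The fourth power arises from squaring the compression q s q. *)
Lemma cutoff_decay (eps : R) : 0 < eps -> exists N, forall k s, -1 <= s <= 1 ->
  s ^+ 2 * (cutoff N k).[s] ^+ 4 <= r ^+ 2 + eps.
Proof.
move=> e0.
pose c := eps ^+ 2 / 2 * eps.
have c0 : 0 < c by rewrite /c !mulr_gt0 ?exprn_gt0// invr_gt0.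
have [N hN] : exists N : nat, c^-1 <= N%:R.
  by exists (Num.bound c^-1); apply/ltW/archi_boundP; rewrite invr_ge0 ltW.
exists N => k s s1.
have s2 : 0 <= s ^+ 2 <= 1 by move: s1 => /andP[? ?]; apply/andP; split; [exact: sqr_ge0|nra].
have q1 := cutoff_bd N k s1.
have q4 : 0 <= (cutoff N k).[s] ^+ 4 <= (cutoff N k).[s].
  move: q1 => /andP[q0 q1]; rewrite exprn_ge0//= exprS ler_piMr// exprn_ile1//.
have [h|h] := leP (s ^+ 2) (r ^+ 2 + eps).
  by move: ((cutoff N k).[s] ^+ 4) (s ^+ 2) q4 s2 h => a b; nra.
have b1 := bump_ge0 k s1.
have b2 := bump_large k s1 (ltW e0) (ltW h).
have bern (x : R) n : 0 <= x <= 1 -> (1 - x) ^+ n * (1 + n%:R * x) <= 1.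
  move=> /andP[x0 x1]; elim: n => [|n IH]; first by rewrite expr0 mul0r addr0 mulr1.
  apply: le_trans IH; rewrite exprSr -mulrA ler_wpM2l ?exprn_ge0 ?subr_ge0//.
  rewrite -subr_ge0 -natr1 (_ : _ - _ = (n%:R + 1) * x ^+ 2); last by ring.
  by rewrite mulr_ge0 ?sqr_ge0// addr_ge0.
have := bern _ N b1; rewrite -cutoffE; have := sqr_ge0 r.
have N1 : 1 <= N%:R * c by rewrite -ler_pdivrMr// div1r.
have Nb : N%:R * (eps ^+ 2 / 2) <= N%:R * (bump r k).[s] by rewrite ler_wpM2l ?ler0n.
have N2 : 1 <= N%:R * (bump r k).[s] * eps.
  by apply: le_trans N1 _; rewrite /c mulrA ler_wpM2r// ltW.
move: (N%:R * _) N2 (cutoff N k).[s] q1 q4 => x N2 q q1.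
move: (q ^+ 4) (s ^+ 2) s2 (r ^+ 2) => q4 b s2 t hq4 t0 hx.
have x0 : 0 < x by rewrite -(pmulr_lgt0 _ e0); lra.
have qe : q <= eps.
  by rewrite -(ler_pM2l x0); lra.
have : b * q4 <= q by nra.
lra.
Qed.

End Bump.
End Scalars.

Section PevalOn.
Variables (R : realType) (V : ucstar R).
Implicit Types (h : V) (r t : R).
Local Notation N := (@unorm R V).
Local Notation star := (@ustar R V).
Local Notation "r *' x" := ((r%:C)%C *: x) (at level 40).

Lemma peval_comp h p r : peval h (p \Po (r *: 'X)) = peval (r *' h) p.
Proof.
elim/poly_ind: p => [|p c IH]; first by rewrite comp_poly0 /peval !rmorph0.
rewrite comp_polyD comp_polyM comp_polyX comp_polyC !pevalD !pevalM !pevalC IH pevalX.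
by rewrite -mul_polyC pevalM pevalC pevalX -scalerAl mul1r.
Qed.

Lemma peval_bound_on h p r (M : R) : 0 <= r -> star h = h -> N h <= r ->
  (forall s : R, - r <= s <= r -> `|p.[s]| <= M) -> N (peval h p) <= M.
Proof.
rewrite le_eqVlt => /orP[/eqP <-|r0] sh hr pM.
  have h0 : h = 0.
    by apply: unorm_eq0; apply/eqP; rewrite eq_le hr unorm_ge0.
  have -> : peval h p = p.[0] *' 1.
    rewrite h0; elim/poly_ind: (p) => [|q c IH].
      by rewrite /peval !rmorph0 horner0 rmorph0 scale0r.
    by rewrite pevalD pevalM pevalX pevalC mulr0 add0r hornerMXaddC mulr0 add0r.
  rewrite unorm_rs; apply: le_trans (_ : `|p.[0]| * 1 <= _).
    by rewrite ler_wpM2l// unorm1_le1.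
  by rewrite mulr1; apply: pM; rewrite oppr0 lexx.
have -> : peval h p = peval (r^-1 *' h) (p \Po (r *: 'X)).
  by rewrite peval_comp rsA divff ?rs1// gt_eqF.
apply: peval_bound.
- by rewrite ustar_rs sh.
- by rewrite unorm_rs ger0_norm ?invr_ge0 ?(ltW r0)// ler_pdivrMl ?mulr1.
move=> s s1; rewrite horner_comp hornerZ hornerX; apply: pM.
by move: s1 => /andP[? ?]; apply/andP; split; nra.
Qed.

End PevalOn.

Section Cutoff.
Variables (R : realType) (A B : cstarAlg R) (S : set A) (f : A -> B).
Hypotheses (hS : is_cstar_subalg S) (hf : star_hom_on S f).
Local Notation "r *' x" := ((r%:C)%C *: x) (at level 40).

Lemma hom_contract a : S a -> rnorm (f a) <= rnorm a.
Proof.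
move=> Sa; case: (hS) (hf) => Scl S0 SD SM Sstar [fl fM fs].
have [a0|a0] := eqVneq (rnorm a) 0.
  by rewrite (rnorm_eq0 a0) (star_hom_on0 hS hf) !rnorm0.
have ap : 0 < rnorm a by rewrite lt_neqAle eq_sym a0 rnorm_ge0.
pose b := (rnorm a)^-1 *' a.
have Sb : S b by exact: csubZ.
have b1 : rnorm b = 1.
  by rewrite rnormZ Re_normC ger0_norm ?invr_ge0 ?(ltW ap)// mulVf.
have : rnorm (f (cmul (cstar b) b)) <= 1.
  apply: (hom_contract_sa hS hf).
  - by apply: SM => //; exact: Sstar.
  - by rewrite cstarM cstarK.
  - by rewrite rnormC b1 expr1n.
rewrite fM//; last exact: Sstar.
rewrite fs// rnormC /b (homZ hS hf)// rnormZ Re_normC ger0_norm ?invr_ge0 ?(ltW ap)//.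
rewrite -[leRHS](expr1n R 2) ler_sqr ?nnegrE ?mulr_ge0 ?rnorm_ge0 ?invr_ge0 ?(ltW ap)//.
by rewrite ler_pdivrMl// mulr1.
Qed.

Lemma peval_emb y p : S y -> exists s, [/\ S s,
  peval (uemb y) p = p.[0] *' 1 + uemb s &
  peval (uemb (f y)) p = p.[0] *' 1 + uemb (f s)].
Proof.
move=> Sy; case: (hS) (hf) => Scl S0 SD SM Sstar [fl fM fs].
elim/poly_ind: p => [|p c [s [Ss e1 e2]]].
  exists 0; rewrite (star_hom_on0 hS hf) /peval !rmorph0 horner0 rmorph0 !scale0r.
  by split => //; rewrite add0r.
exists (p.[0] *' y + cmul s y); split.
- by apply: csubD => //; [exact: csubZ|exact: SM].
- rewrite pevalD pevalM pevalX pevalC e1 hornerMXaddC mulr0 add0r addrC; congr (_ + _).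
  by rewrite mulrDl -scalerAl mul1r uembD uembZ uembM.
- rewrite pevalD pevalM pevalX pevalC e2 hornerMXaddC mulr0 add0r addrC; congr (_ + _).
  rewrite (homD hf); [|exact: csubZ|exact: SM].
  by rewrite (homZ hS hf)// fM// mulrDl -scalerAl mul1r uembD uembZ uembM.
Qed.

(* With [f = 0] this gives approximate units; in general it shows that the
   distance to the kernel of [f] is the norm of the image. *)
Lemma hom_cutoff_unit y (eps : R) : S y -> cstar y = y -> rnorm y <= 1 -> 0 < eps ->
  exists u, [/\ S u, cstar u = u, f u = 0,
    forall z, rnorm (z - cmul z u) <= rnorm z &
    rnorm (y - cmul u y - cmul y u + cmul u (cmul y u)) ^+ 2 <= rnorm (f y) ^+ 2 + eps].
Proof.
move=> Sy sy y1 e0; case: (hS) (hf) => Scl S0 SD SM Sstar [fl fM fs].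
set r := rnorm (f y).
have r01 : 0 <= r <= 1.
  by rewrite rnorm_ge0/=; apply: le_trans y1; exact: hom_contract.
have [N hN] := cutoff_decay r01 e0.
(* The cutoffs take the value 1 at 0, so applied to [y] they are 1 plus an element of [S], and [f]
   carries this decomposition along. *)
have /choice [s hs] : forall k, exists s, [/\ S s,
  peval (uemb y) (cutoff r N k) = 1 + uemb s &
  peval (uemb (f y)) (cutoff r N k) = 1 + uemb (f s)].
  by move=> k; have := peval_emb (cutoff r N k) Sy; rewrite cutoff0 !rs1.
have sY : ustar (uemb y) = uemb y by rewrite uemb_star sy.
have NY : unorm (uemb y) <= 1 by rewrite uemb_norm.
have sYf : ustar (uemb (f y)) = uemb (f y) by rewrite uemb_star -fs// sy.
have NYf : unorm (uemb (f y)) <= r by rewrite uemb_norm.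
have bd1 k : unorm (1 + uemb (s k)) <= 1.
  have [_ <- _] := hs k; apply: peval_bound => // x /(cutoff_bd r01 N k).
  by move=> /andP[a b]; rewrite ger0_norm.
have scauchy k l : rnorm (s k - s l) <= N%:R * (rate R k + rate R l).
  rewrite -uemb_norm uembB.
  have [_ ek _] := hs k; have [_ el _] := hs l.
  have -> : uemb (s k) - uemb (s l) =
      peval (uemb y) (cutoff r N k - cutoff r N l).
    by rewrite pevalB ek el opprD addrACA subrr add0r.
  apply: peval_bound => // x x1; rewrite hornerD hornerN; exact: cutoff_cauchy.
have Np : 0 < N%:R + 1 :> R by rewrite ltr_wpDl.
have small (eps' : R) : 0 < eps' -> exists k, forall l, (k <= l)%N -> N%:R * rate R l <= eps'.
  move=> e1; have [|k hk] := @rate_small R (eps' / (N%:R + 1)); first by rewrite divr_gt0.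
  exists k => l /hk h; apply: (@le_trans _ _ ((N%:R + 1) * rate R l)).
    by rewrite ler_wpM2r ?(ltW (rate_gt0 _ _))// lerDl.
  by rewrite mulrC -ler_pdivlMr.
have [|v hv] := @cauchy_limit R A s.
  move=> e e1; have [|k hk] := small (e / 2); first lra.
  exists k => n m /hk h1 /hk h2; apply: le_trans (scauchy _ _) _; rewrite mulrDr; lra.
(* 1 - u is the limit of the cutoffs of [y]. They tend to 1 on [-r, r], and |f y| = r, so f u = 0;
   they damp [y] beyond r, which bounds (1 - u) y (1 - u). *)
pose u := - v.
have hu e1 : 0 < e1 -> exists k, rnorm (s k + u) <= e1 /\ N%:R * rate R k <= e1.
  move=> e1p; have [k hk] := small _ e1p; have [l hl] := hv _ e1p.
  by exists (maxn k l); split; [apply: hl|apply: hk]; rewrite leq_max leqnn ?orbT.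
have Su : S u.
  rewrite /u -scaleN1r; apply: csubZ => //; apply: closed_approx => // e e1.
  have [k hk] := hv _ e1; exists (s k); first by have [] := hs k.
  by rewrite rnormBC hk.
have dE k : unorm ((1 - uemb u) - (1 + uemb (s k))) = rnorm (s k + u).
  by rewrite opprD addrACA subrr add0r -opprD unormN -uembD uemb_norm addrC.
have NE : unorm (1 - uemb u) <= 1.
  apply/ler_addgt0Pr => e e1; have [k [hk _]] := hu _ e1.
  have := unormD ((1 - uemb u) - (1 + uemb (s k))) (1 + uemb (s k)).
  by rewrite subrK dE; have := bd1 k; lra.
exists u; split => //.
- apply/eqP; rewrite -subr_eq0; apply/eqP; apply: rnorm_eps => e e1.
  have [|k [hk _]] := hu (e / 2); first lra.
  have ss : cstar (s k) = s k.
    apply: uemb_inj; rewrite -uemb_star.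
    have [_ ek _] := hs k; have := peval_sa (cutoff r N k) sY.
    by rewrite ek ustarD ustar1 => /addrI.
  have h1 : rnorm (cstar u + s k) <= e / 2 by rewrite -ss -cstarDD rnorm_star addrC.
  by have := rnormB (cstar u + s k) (s k + u); rewrite opprD addrA addrK; lra.
- apply: rnorm_eps => e e1; have [|k [hk1 hk2]] := hu (e / 2); first lra.
  have [Sk ek1 ek2] := hs k.
  have h1 : rnorm (f (s k)) <= N%:R * rate R k.
    rewrite -uemb_norm.
    have -> : uemb (f (s k)) = peval (uemb (f y)) (cutoff r N k - 1%:P).
      by rewrite pevalB ek2 pevalC rs1 addrAC subrr add0r.
    have r0 : 0 <= r by case/andP: r01.
    apply: (peval_bound_on r0) => // x xr; rewrite hornerD hornerN hornerC distrC.
    exact: cutoff_near1.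
  have := hom_contract (csubD hS Sk Su); rewrite (homD hf)//.
  by have := rnorm_tri (- f (s k)) (f u) 0; rewrite opprK !subr0 rnormN (addrC (f u)); lra.
- move=> z; rewrite -!uemb_norm uembB uembM -{1}[uemb z]mulr1 -mulrBr.
  apply: le_trans (unormM _ _) _; rewrite -[leRHS]mulr1.
  by rewrite ler_wpM2l ?unorm_ge0.
set w := _ - _ - _ + _.
have sq : 0 <= r ^+ 2 + eps by have := sqr_ge0 r; lra.
suff h : rnorm w <= Num.sqrt (r ^+ 2 + eps).
  by rewrite -[leRHS](sqr_sqrtr sq) ler_sqr ?nnegrE ?rnorm_ge0 ?sqrtr_ge0.
apply/ler_addgt0Pr => e e1.
have [|k [hk _]] := hu (e / 4); first lra.
pose E := 1 - uemb u; pose Ek := 1 + uemb (s k); pose Y := uemb y.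
have we : uemb w = E * Y * E.
  rewrite /w uembD !uembB !uembM /E -/Y mulrBr mulr1 mulrBl mul1r.
  by rewrite [(Y - _) * _]mulrBl opprB [RHS]addrA mulrA addrAC.
have [Sk ek _] := hs k.
have hE : unorm (Ek * Y * Ek) <= Num.sqrt (r ^+ 2 + eps).
  have -> : Ek * Y * Ek = peval Y (cutoff r N k * 'X * cutoff r N k).
    by rewrite !pevalM pevalX ek.
  apply: peval_bound => // x x1; rewrite hornerM hornerM hornerX.
  rewrite -sqrtr_sqr ler_wsqrtr//; apply: le_trans (hN k x x1).
  by rewrite le_eqVlt; apply/orP; left; apply/eqP; ring.
rewrite -uemb_norm we.
have -> : E * Y * E = (E - Ek) * (Y * E) + (Ek * Y) * (E - Ek) + Ek * Y * Ek.
  by rewrite !mulrBl !mulrBr !mulrA addrA subrK subrK.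
have h1 : unorm ((E - Ek) * (Y * E)) <= rnorm (s k + u).
  apply: le_trans (unormM _ _) _; rewrite dE ler_piMr ?rnorm_ge0//.
  by apply: le_trans (unormM _ _) _; rewrite mulr_ile1 ?unorm_ge0.
have h2 : unorm (Ek * Y * (E - Ek)) <= rnorm (s k + u).
  apply: le_trans (unormM _ _) _; rewrite dE ler_piMl ?rnorm_ge0//.
  by apply: le_trans (unormM _ _) _; rewrite mulr_ile1 ?unorm_ge0// bd1.
apply: le_trans (unormD _ _) _; rewrite addrC; apply: lerD => //.
by apply: le_trans (unormD _ _) _; lra.
Qed.

End Cutoff.

Section HomCorollaries.
Variables (R : realType) (A B : cstarAlg R) (S : set A) (f : A -> B).
Hypotheses (hS : is_cstar_subalg S) (hf : star_hom_on S f).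
Local Notation "r *' x" := ((r%:C)%C *: x) (at level 40).

(** Scaling by |y| + 1, which is positive also for y = 0. The error passed on is a square, so that
    a^2 + b^2 <= (a + b)^2 removes the squares. *)
Lemma hom_cutoff y (eps : R) : S y -> cstar y = y -> 0 < eps ->
  exists u, [/\ S u, cstar u = u, f u = 0,
    forall z, rnorm (z - cmul z u) <= rnorm z &
    rnorm (y - cmul u y - cmul y u + cmul u (cmul y u)) <= rnorm (f y) + eps].
Proof.
move=> Sy sy e0; pose m := rnorm y + 1.
have m0 : 0 < m by rewrite ltr_wpDl ?rnorm_ge0.
have mi : 0 <= m^-1 by rewrite invr_ge0 ltW.
have [||||u [Su su fu uc ue]] := @hom_cutoff_unit R A B S f hS hf (m^-1 *' y) ((m^-1 * eps) ^+ 2).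
- exact: csubZ.
- by rewrite cstarZ conjC_real sy.
- by rewrite rnormZ Re_normC ger0_norm// ler_pdivrMl// mulr1 lerDl.
- by rewrite exprn_gt0// mulr_gt0// invr_gt0.
exists u; split => //; set w := _ - _ - _ + _.
have : rnorm (m^-1 *' w) <= m^-1 * (rnorm (f y) + eps).
  rewrite -ler_sqr ?nnegrE ?rnorm_ge0 ?mulr_ge0 ?addr_ge0 ?rnorm_ge0 ?(ltW e0)//.
  have -> : m^-1 *' w = m^-1 *' y - cmul u (m^-1 *' y) - cmul (m^-1 *' y) u +
      cmul u (cmul (m^-1 *' y) u).
    by rewrite /w !cmulZl !cmulZr scalerDr !scalerBr.
  apply: le_trans ue _; rewrite (homZ hS hf)// rnormZ Re_normC ger0_norm//.
  rewrite mulrDr; have : 0 <= m^-1 * rnorm (f y) by rewrite mulr_ge0 ?rnorm_ge0.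
  have : 0 <= m^-1 * eps by rewrite mulr_ge0 ?(ltW e0).
  by move: (m^-1 * eps) (m^-1 * _) => p q; nra.
by rewrite rnormZ Re_normC ger0_norm// ler_pM2l ?invr_gt0.
Qed.

(** The cutoff is taken for a* a, since |a - a u|^2 is the norm of (1 - u) a* a (1 - u). *)
Lemma hom_dist_kernel a (eps : R) : S a -> 0 < eps ->
  exists u, [/\ S u, f u = 0 & rnorm (a - cmul a u) ^+ 2 <= rnorm (f a) ^+ 2 + eps].
Proof.
move=> Sa e0; case: (hS) (hf) => Scl S0 SD SM Sstar [fl fM fs].
have Sy : S (cmul (cstar a) a) by apply: SM => //; exact: Sstar.
have sy : cstar (cmul (cstar a) a) = cmul (cstar a) a by rewrite cstarM cstarK.
have [u [Su su fu _ ue]] := hom_cutoff Sy sy e0.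
exists u; split=> //; rewrite -rnormC.
rewrite -(rnormC (f a)) -fs// -fM//; last exact: Sstar.
apply: le_trans ue; rewrite cstarB cstarM su cmulBl !cmulBr !cmulA opprB.
by rewrite addrA addrAC (addrAC (cmul (cstar a) a)).
Qed.

Lemma hom_inj_isometric : (forall a, S a -> f a = 0 -> a = 0) ->
  forall a, S a -> rnorm (f a) = rnorm a.
Proof.
move=> fi a Sa; apply/eqP; rewrite eq_le (hom_contract hS hf)//=.
rewrite -ler_sqr ?nnegrE ?rnorm_ge0//; apply/ler_addgt0Pr => e e0.
have [u [Su /(fi _ Su) u0 h]] := hom_dist_kernel Sa e0.
by move: h; rewrite u0 cmul0r subr0.
Qed.

End HomCorollaries.

(** * Positive elements and the comparison of their norms *)

Section Positive.
Variables (R : realType) (A : cstarAlg R).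
Implicit Types (a b x y z : A).
Local Notation "r *' x" := ((r%:C)%C *: x) (at level 40).

(** This is (1 - c)^2 = 1 - y written without a unit. *)
Lemma sqrt_nonunital y : cstar y = y -> rnorm y <= 1 ->
  exists2 c, cstar c = c & c + c - cmul c c = y.
Proof.
move=> sy y1.
have [|c [ce cQ]] := @sqrt1m _ _ (uemb y); first by rewrite uemb_norm.
have c1 : ufst c = 0.
  apply: (cQ (fun x : unitization A => ufst x = 0) (@uclosed_fst _ _)) => // x x0.
  by rewrite ufstZ ufstD ufst_emb ufstM x0 mulr0 addr0 mulr0.
have sc : ustar c = c.
  apply: (cQ (fun x : unitization A => ustar x = x) (@uclosed_sa _ _)) => [|x sx].
    exact: ustar0.
  by rewrite ustar_rs ustarD ustarM uemb_star sy sx.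
move: (@uemb_snd _ _ _ c1) => cd; rewrite cd in ce sc.
exists (usnd c); first by apply: uemb_inj; rewrite -uemb_star.
by apply: uemb_inj; rewrite uembB uembD uembM; move: ce; rewrite sqr_1B => /addrI /oppr_inj.
Qed.

Definition npos a := cstar a = a /\ exists2 t : R, 0 <= t & unorm (t *' 1 - uemb a) <= t.

Lemma npos_upos a : npos a -> upos (uemb a) (uemb a).
Proof. by move=> [sa h]; split => //; rewrite uemb_star sa. Qed.

Lemma nposD a b : npos a -> npos b -> npos (a + b).
Proof.
move=> [sa [t t0 ta]] [sb [s s0 sb']]; split; first by rewrite cstarDD sa sb.
exists (t + s); first exact: addr_ge0.
rewrite rsDl uembD opprD addrACA; apply: le_trans (unormD _ _) _; exact: lerD.
Qed.

Lemma npos0 : npos 0.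
Proof.
split; first exact: cstar0.
exists 0 => //; have -> : uemb (0 : A) = 0 by [].
by rewrite rmorph0 scale0r subr0 unorm0.
Qed.

(** With M = |a + b|, both a and M - a are positive in the bicommutant of a: if t is the bound for
    b, then (M + t) - (M - a) = (a + b) + (t - b) has norm at most M + t. Their roots v, w commute
    and v^2 + w^2 = M, so |a| = |v|^2 <= M. *)
Lemma npos_norm_le a b : npos a -> npos b -> rnorm a <= rnorm (a + b).
Proof.
move=> pa pb; set X := uemb a; set M := rnorm (a + b).
have M0 : 0 <= M by exact: rnorm_ge0.
have bX : bicomm X X by exact: bicomm_id.
have sX : ustar X = X by case: pa => sa _; rewrite uemb_star sa.
have pX : upos X X := npos_upos pa.
have pMX : upos X (M *' 1 - X).
  split.
  - by rewrite ustarB ustar_rs ustar1 sX.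
  - by apply: bicommD; [apply: bicommZ; exact: bicomm1|exact: bicommN].
  case: pb => sb [t t0 tb]; exists (M + t); first exact: addr_ge0.
  have -> : (M + t) *' 1 - (M *' 1 - X) = uemb (a + b) + (t *' 1 - uemb b).
    rewrite rsDl opprB uembD -/X [RHS]addrACA subrr addr0 (addrC X (- _)) addrA.
    by rewrite (addrAC (M *' 1)) subrr add0r addrC.
  by apply: le_trans (unormD _ _) _; rewrite uemb_norm; apply: lerD.
have [v [sv bv Xv]] := upos_sqrt pX.
have [w [sw bw Xw]] := upos_sqrt pMX.
have : unorm v <= Num.sqrt M.
  apply: (@norm_le_of_sum_sqr _ _ _ w) => //; first exact: bicommC bv bw.
  by rewrite -Xv -Xw addrC subrK sqr_sqrtr.
move=> h; rewrite -uemb_norm -/X Xv unorm_sa_sqr// -(sqr_sqrtr M0).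
by rewrite ler_sqr ?nnegrE ?unorm_ge0 ?sqrtr_ge0.
Qed.

(** Suppose b = m - a has norm beta > m, where m = |a| + 1. The negative number m - beta is not in
    the spectrum of [a], so beta - b is invertible. But w^2 = b/beta satisfies |w^(2k)| = 1 for k a
    power of 2, while (1 - w^2) w^(2k) has norm at most 1/(k + 1): a contradiction after dividing by
    1 - w^2. No spectral radius formula is used. *)
Lemma cs_positive_npos a : cs_positive (@cmul R A) (@cstar R A) a -> npos a.
Proof.
move=> [sa hpos]; split=> //.
pose m := rnorm a + 1; have m0 : 0 < m by rewrite ltr_wpDl ?rnorm_ge0.
exists m; first exact: ltW.
rewrite leNgt; apply/negP => lt.
set b := m *' 1 - uemb a in lt; set beta := unorm b in lt.
have beta0 : 0 < beta by exact: lt_trans lt.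
pose l : R := m - beta.
have ln0 : (l%:C)%C != 0 :> R[i] by rewrite eq_complex /= eqxx andbT subr_eq0 lt_eqF.
have [y [y1 y2]] : quasi_invertible (@cmul R A) ((l%:C)%C^-1 *: a).
  apply: contrapT => nq; have := hpos _ ln0 nq.
  by rewrite ler0c subr_ge0 leNgt lt.
have sb : ustar b = b by rewrite ustarB ustar_rs ustar1 uemb_star sa.
have pb : upos b b.
  split=> //; exists m; first exact: ltW.
  by rewrite /b opprB addrC subrK uemb_norm lerDl.
have [v [sv bv bE]] := upos_sqrt pb.
pose w := (Num.sqrt beta)^-1 *' v.
have sw : ustar w = w by rewrite ustar_rs sv.
have sq0 : 0 < Num.sqrt beta by rewrite sqrtr_gt0.
have ww : w * w = beta^-1 *' b.
  by rewrite rsM bE -invfM -expr2 sqr_sqrtr ?(ltW beta0).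
have Nw : unorm w <= 1.
  rewrite -ler_sqr ?nnegrE ?unorm_ge0// -unorm_sa_sqr// ww unorm_rs.
  by rewrite ger0_norm ?invr_ge0 ?(ltW beta0)// -/beta mulVf ?gt_eqF// expr1n.
pose G := 1 - uemb y.
have GE : G * (1 - uemb ((l%:C)%C^-1 *: a)) = 1.
  rewrite /G mulrBl mul1r mulrBr mulr1 -uembM -y2 uembD opprB.
  by rewrite addrK subrK.
have GE' : G * (beta *' 1 - b) = (beta - m) *' 1.
  have -> : beta *' 1 - b = (- l) *' (1 - uemb ((l%:C)%C^-1 *: a)).
    have e : (- l) *' uemb ((l%:C)%C^-1 *: a) = - uemb a.
      by rewrite uembZ scalerA rmorphN mulNr mulfV// scaleN1r.
    rewrite scalerBr e opprK /b opprB addrA addrAC /l opprB; congr (_ + _).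
    by rewrite rmorphB scalerBl.
  by rewrite -scalerAr GE opprB.
pose C := beta * unorm G / (beta - m).
have bm0 : 0 < beta - m by rewrite subr_gt0.
have C0 : 0 <= C by rewrite !mulr_ge0 ?unorm_ge0 ?invr_ge0 ?(ltW bm0) ?(ltW beta0).
have pw n : unorm ((w * w) ^+ (2 ^ n)) = 1.
  have sww k : ustar ((w * w) ^+ k) = (w * w) ^+ k.
    elim: k => [|k IH]; first by rewrite !expr0 ustar1.
    by rewrite exprSr ustarM IH ustarM sw -exprS -exprSr.
  elim: n => [|n IH].
    by rewrite expr1 ww unorm_rs ger0_norm ?invr_ge0 ?(ltW beta0)// mulVf ?gt_eqF.
  by rewrite expnSr exprM expr2 unorm_sa_sqr// IH expr1n.
have bdn n : n.+1%:R * unorm ((w * w) ^+ n) <= C.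
  (* The scalar bound is (1 - t) t^n <= 1/(n + 1) on [0, 1], applied with t = s^2. *)
  have h : unorm ((1 - w * w) * (w * w) ^+ n) <= n.+1%:R^-1.
    have -> : (1 - w * w) * (w * w) ^+ n = peval w ((1%:P - 'X * 'X) * ('X * 'X) ^+ n).
      rewrite pevalM pevalB pevalM pevalX pevalC rs1; congr (_ * _).
      elim: n => [|n IH]; first by rewrite !expr0 /peval !rmorph1.
      by rewrite !exprS IH !pevalM pevalX.
    apply: peval_bound => // s s1.
    rewrite hornerM horner_exp hornerD hornerN hornerC hornerM hornerX.
    have : 0 <= s * s <= 1 by move: s1 => /andP[? ?]; nra.
    move: (s * s) => t /andP[t0 t1].
    rewrite ger0_norm ?mulr_ge0 ?exprn_ge0 ?subr_ge0//.
    rewrite -(ler_pM2l (_ : 0 < n.+1%:R)) ?ltr0n// divff ?pnatr_eq0//.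
    have : n.+1%:R * ((1 - t) * t ^+ n) <= 1 - t ^+ n.+1.
      elim: (n) => [|k IH]; first by rewrite expr0 expr1 mulr1 mul1r.
      rewrite -natr1 mulrDl mul1r; have := ler_wpM2l t0 IH.
      have : 0 <= (1 - t) * (1 - t ^+ k.+1).
        by rewrite mulr_ge0 ?subr_ge0// exprn_ile1.
      by rewrite !exprS; move: (k.+1%:R) (t ^+ k) => c q; lra.
    have := exprn_ge0 n.+1 t0; lra.
  have -> : (w * w) ^+ n = (beta / (beta - m)) *' (G * ((1 - w * w) * (w * w) ^+ n)).
    have e : 1 - w * w = beta^-1 *' (beta *' 1 - b).
      by rewrite ww [RHS]scalerBr (rsA beta^-1 beta) mulVf ?rs1 ?gt_eqF.
    rewrite e -[in RHS]scalerAl -[in RHS]scalerAr (mulrA G) GE' -[in RHS]scalerAl mul1r !rsA.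
    by rewrite (_ : _ * _ = 1 :> R) ?rs1//; field; rewrite !gt_eqF.
  rewrite unorm_rs ger0_norm ?divr_ge0 ?(ltW bm0) ?(ltW beta0)//.
  have h2 := le_trans (unormM G _) (ler_wpM2l (unorm_ge0 G) h).
  have n0 : 0 < n.+1%:R :> R by rewrite ltr0n.
  apply: (@le_trans _ _ (n.+1%:R * (beta / (beta - m) * (unorm G / n.+1%:R)))).
    by rewrite ler_pM2l// ler_wpM2l// divr_ge0 ?(ltW bm0) ?(ltW beta0).
  by rewrite /C le_eqVlt; apply/orP; left; apply/eqP; field; rewrite !gt_eqF.
have := archi_boundP C0; have := bdn (2 ^ (Num.bound C))%N; rewrite pw mulr1 => h1 h2.
have h3 : C < (2 ^ Num.bound C).+1%:R.
  by apply: lt_le_trans h2 _; rewrite ler_nat ltnW// ltnS ltnW// ltn_expl.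
by move: h3; rewrite ltNge h1.
Qed.

End Positive.

(** * Completion of C*-seminormed algebras *)

(** Only a seminorm and no completeness: the instances are operators on the Fock module, their
    quotient seminorm, and bounded sequences. *)
Record csemi (R : realType) := Csemi {
  cs_sort :> lmodType R[i];
  smul : cs_sort -> cs_sort -> cs_sort;
  sstar : cs_sort -> cs_sort;
  snorm : cs_sort -> R;
  smulDl : forall (c : R[i]) a b x, smul (c *: a + b) x = c *: smul a x + smul b x;
  smulDr : forall (c : R[i]) x a b, smul x (c *: a + b) = c *: smul x a + smul x b;
  smulA : forall a b c, smul a (smul b c) = smul (smul a b) c;
  sstarD : forall (c : R[i]) a b, sstar (c *: a + b) = c^* *: sstar a + sstar b;
  sstarK : forall a, sstar (sstar a) = a;
  sstarM : forall a b, sstar (smul a b) = smul (sstar b) (sstar a);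
  snorm_ge0 : forall a, 0 <= snorm a;
  snormD : forall a b, snorm (a + b) <= snorm a + snorm b;
  snormZ : forall (c : R[i]) a, snorm (c *: a) = complex.Re `|c| * snorm a;
  snormM : forall a b, snorm (smul a b) <= snorm a * snorm b;
  snormC : forall a, snorm (smul (sstar a) a) = snorm a ^+ 2
}.

Section CsemiBasics.
Variables (R : realType) (X : csemi R).
Implicit Types a b x : X.

Lemma snorm0 : snorm (0 : X) = 0.
Proof. by rewrite -(scale0r (0 : X)) snormZ Re_norm0 mul0r. Qed.

Lemma snormN a : snorm (- a) = snorm a.
Proof.
by rewrite -scaleN1r snormZ normrN normr1 mul1r.
Qed.

Lemma snormB a b : snorm (a - b) <= snorm a + snorm b.
Proof. by rewrite -(snormN b) snormD. Qed.

Lemma snormBC a b : snorm (a - b) = snorm (b - a).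
Proof. by rewrite -snormN opprB. Qed.

Lemma snorm_tri b a c : snorm (a - c) <= snorm (a - b) + snorm (b - c).
Proof. by have := snormD (a - b) (b - c); rewrite addrA subrK. Qed.

Lemma snorm_dist a b : snorm (a - b) = 0 -> snorm a = snorm b.
Proof.
move=> h; apply/eqP; rewrite eq_le; apply/andP; split.
  by have := snormD (a - b) b; rewrite subrK h add0r.
by have := snormD (b - a) a; rewrite subrK snormBC h add0r.
Qed.

Lemma smulDDl a b x : smul (a + b) x = smul a x + smul b x.
Proof. by have := smulDl 1 a b x; rewrite !scale1r. Qed.

Lemma smulDDr x a b : smul x (a + b) = smul x a + smul x b.
Proof. by have := smulDr 1 x a b; rewrite !scale1r. Qed.

Lemma smul0l x : smul 0 x = 0.
Proof. by apply: (@addrI _ (smul 0 x)); rewrite -smulDDl !addr0. Qed.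

Lemma smul0r x : smul x 0 = 0.
Proof. by apply: (@addrI _ (smul x 0)); rewrite -smulDDr !addr0. Qed.

Lemma smulZl (c : R[i]) a x : smul (c *: a) x = c *: smul a x.
Proof. by rewrite -[c *: a]addr0 smulDl smul0l addr0. Qed.

Lemma smulZr (c : R[i]) a x : smul x (c *: a) = c *: smul x a.
Proof. by rewrite -[c *: a]addr0 smulDr smul0r addr0. Qed.

Lemma smulNl a x : smul (- a) x = - smul a x.
Proof. by rewrite -scaleN1r smulZl scaleN1r. Qed.

Lemma smulNr a x : smul x (- a) = - smul x a.
Proof. by rewrite -scaleN1r smulZr scaleN1r. Qed.

Lemma smulBl a b x : smul (a - b) x = smul a x - smul b x.
Proof. by rewrite smulDDl smulNl. Qed.

Lemma smulBr x a b : smul x (a - b) = smul x a - smul x b.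
Proof. by rewrite smulDDr smulNr. Qed.

Lemma sstarDD a b : sstar (a + b) = sstar a + sstar b.
Proof. by have := sstarD 1 a b; rewrite rmorph1 !scale1r. Qed.

Lemma sstar0 : sstar (0 : X) = 0.
Proof. by apply: (@addrI _ (sstar 0)); rewrite -sstarDD !addr0. Qed.

Lemma sstarZ (c : R[i]) a : sstar (c *: a) = c^* *: sstar a.
Proof. by rewrite -[c *: a]addr0 sstarD sstar0 addr0. Qed.

Lemma sstarN a : sstar (- a) = - sstar a.
Proof. by rewrite -scaleN1r sstarZ rmorphN rmorph1 scaleN1r. Qed.

Lemma sstarB a b : sstar (a - b) = sstar a - sstar b.
Proof. by rewrite sstarDD sstarN. Qed.

Lemma snorm_star a : snorm (sstar a) = snorm a.
Proof.
have le y : snorm y <= snorm (sstar y).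
  have [->|n0] := eqVneq (snorm y) 0; first exact: snorm_ge0.
  have p : 0 < snorm y by rewrite lt_neqAle eq_sym n0 snorm_ge0.
  by rewrite -(ler_pM2r p) -expr2 -snormC snormM.
by apply/eqP; rewrite eq_le -{2}(sstarK a) !le.
Qed.

End CsemiBasics.

Section Separation.
Variables (R : realType) (X : csemi R).

Definition snull : {pred X} := fun x => snorm x == 0.

Lemma snull_zmod : zmod_closed snull.
Proof.
split; first by rewrite /in_mem /= /snull snorm0.
move=> x y; rewrite /in_mem /= /snull => /eqP hx /eqP hy.
by rewrite eq_le snorm_ge0 andbT -(addr0 0) -{1}hx -hy snormB.
Qed.

HB.instance Definition _ := GRing.isZmodClosed.Build X snull snull_zmod.

Definition squot : Type := Quotient.quot snull.
HB.instance Definition _ := GRing.Zmodule.on squot.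

Definition spi (x : X) : squot := \pi_(Quotient.quot snull)%qT x.
Definition srepr (q : squot) : X := repr (q : Quotient.quot snull).

Lemma sreprK q : spi (srepr q) = q. Proof. exact: reprK. Qed.

Lemma spi_eq x y : spi x = spi y <-> snorm (x - y) = 0.
Proof.
have := Quotient.idealrBE snull x y; rewrite /in_mem /= /snull => h.
by split => [e|e]; apply/eqP; [rewrite h; apply/eqP|rewrite -h; apply/eqP].
Qed.

Lemma srepr_pi x : snorm (srepr (spi x) - x) = 0.
Proof. by apply/spi_eq; rewrite sreprK. Qed.

Lemma spiD x y : spi (x + y) = spi x + spi y.
Proof. exact: raddfD. Qed.

Lemma spiN x : spi (- x) = - spi x.
Proof. exact: raddfN. Qed.

Definition sqscale (c : R[i]) (q : squot) : squot := spi (c *: srepr q).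

Lemma sqscale_pi c x : sqscale c (spi x) = spi (c *: x).
Proof.
by apply/spi_eq; rewrite -scalerBr snormZ srepr_pi mulr0.
Qed.

Lemma squotP (P : squot -> Prop) : (forall x, P (spi x)) -> forall q, P q.
Proof. by move=> h q; rewrite -(sreprK q). Qed.

Lemma sqscaleA a b v : sqscale a (sqscale b v) = sqscale (a * b) v.
Proof. by elim/squotP: v => x; rewrite !sqscale_pi scalerA. Qed.

Lemma sqscale1 : left_id 1 sqscale.
Proof. by elim/squotP => x; rewrite sqscale_pi scale1r. Qed.

Lemma sqscaleDr : right_distributive sqscale +%R.
Proof.
by move=> a; elim/squotP => x; elim/squotP => y; rewrite -spiD !sqscale_pi -spiD scalerDr.
Qed.

Lemma sqscaleDl v : {morph sqscale^~ v : a b / a + b}.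
Proof. by elim/squotP: v => x a b; rewrite !sqscale_pi -spiD scalerDl. Qed.

HB.instance Definition _ := GRing.Zmodule_isLmodule.Build R[i] squot
  sqscaleA sqscale1 sqscaleDr sqscaleDl.

Lemma spiZ c x : spi (c *: x) = c *: spi x.
Proof. by rewrite -sqscale_pi. Qed.

Definition sqnorm (q : squot) : R[i] := ((snorm (srepr q))%:C)%C.

Lemma sqnorm_pi x : sqnorm (spi x) = ((snorm x)%:C)%C.
Proof. by rewrite /sqnorm (snorm_dist (srepr_pi x)). Qed.

Lemma sqnormD (x y : squot) : sqnorm (x + y) <= sqnorm x + sqnorm y.
Proof.
elim/squotP: x => x; elim/squotP: y => y.
by rewrite -spiD !sqnorm_pi -rmorphD lecR snormD.
Qed.

Lemma sqnormZ (c : R[i]) (x : squot) : sqnorm (c *: x) = `|c| * sqnorm x.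
Proof.
elim/squotP: x => x; by rewrite -spiZ !sqnorm_pi snormZ rmorphM; congr (_ * _).
Qed.

Lemma sqnorm_eq0 (x : squot) : sqnorm x = 0 -> x = 0.
Proof.
elim/squotP: x => x; rewrite sqnorm_pi => -[h].
have -> : 0 = spi 0 by rewrite -(subrr (0 : X)) spiD spiN subrr.
by apply/spi_eq; rewrite subr0.
Qed.

HB.instance Definition _ := Lmodule_isNormed.Build R[i] squot sqnormD sqnormZ sqnorm_eq0.

Lemma rnorm_pi x : rnorm (spi x) = snorm x.
Proof. by rewrite /rnorm -[`|_|]/(sqnorm _) sqnorm_pi. Qed.

End Separation.

Definition scomplete (R : realType) (X : csemi R) := forall w : nat -> X,
  (forall eps : R, 0 < eps -> exists n0, forall n m, (n0 <= n)%N -> (n0 <= m)%N ->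
     snorm (w n - w m) <= eps) ->
  exists l, forall eps : R, 0 < eps -> exists n0, forall n, (n0 <= n)%N ->
     snorm (w n - l) <= eps.

Section SeparatedAlgebra.
Variables (R : realType) (X : csemi R) (Xc : scomplete X).

Lemma squot_cauchy_cvg (F : set_system (squot X)) :
  ProperFilter F -> cauchy F -> cvg F.
Proof.
move=> FF /cauchyP Fc; apply/cvg_ex.
have /choice [x hx] : forall n, exists x : squot X, F (ball x ((rate R n)%:C)%C).
  by move=> n; apply: Fc; rewrite ltcR rate_gt0.
have xd n m : rnorm (x n - x m) <= rate R n + rate R m.
  have [z [/= h1 h2]] := filter_ex (filterI (hx n) (hx m)).
  move: h1 h2; rewrite -!ball_normE /= !rnormE !ltcR => h1 h2.
  by have := rnorm_tri z (x n) (x m); rewrite (rnormBC z); lra.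
have [|l hl] := Xc (w := fun n => srepr (x n)).
  move=> e e0; have [|n0 hn] := @rate_small R (e / 2); first lra.
  exists n0 => n m /hn h1 /hn h2; rewrite -rnorm_pi spiD spiN !sreprK.
  by apply: le_trans (xd n m) _; lra.
exists (spi l); move=> U /nbhs_ballP [e0 /= /gt0_complex [e ep ->] eU].
have [|n0 h0] := @rate_small R (e / 4); first lra.
have [|n1 h1] := hl (e / 4); first lra.
have {}h0 := h0 (maxn n0 n1) (leq_maxl _ _).
have {}h1 := h1 (maxn n0 n1) (leq_maxr _ _).
apply: filterS (hx (maxn n0 n1)) => z; rewrite -ball_normE /= rnormE ltcR => h2.
apply: eU; rewrite -ball_normE /= rnormE ltcR.
have := rnorm_tri (x (maxn n0 n1)) (spi l) z.
move: h1; rewrite -rnorm_pi spiD spiN sreprK (rnormBC (x (maxn n0 n1)) (spi l)); lra.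
Qed.

HB.instance Definition _ := Uniform_isComplete.Build (squot X) squot_cauchy_cvg.

Definition sqmul (p q : squot X) : squot X := spi (smul (srepr p) (srepr q)).
Definition sqstar (p : squot X) : squot X := spi (sstar (srepr p)).

Lemma sqmul_pi x y : sqmul (spi x) (spi y) = spi (smul x y).
Proof.
apply/spi_eq; apply/eqP; rewrite eq_le snorm_ge0 andbT.
set x' := srepr (spi x); set y' := srepr (spi y).
have -> : smul x' y' - smul x y = smul (x' - x) y' + smul x (y' - y).
  by rewrite smulBl smulBr addrA subrK.
apply: le_trans (snormD _ _) _; rewrite -(addr0 0); apply: lerD.
  by apply: le_trans (snormM _ _) _; rewrite srepr_pi mul0r.
by apply: le_trans (snormM _ _) _; rewrite srepr_pi mulr0.
Qed.

Lemma sqstar_pi x : sqstar (spi x) = spi (sstar x).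
Proof. by apply/spi_eq; rewrite -sstarB snorm_star srepr_pi. Qed.

Lemma sqmulDl (c : R[i]) a b x : sqmul (c *: a + b) x = c *: sqmul a x + sqmul b x.
Proof.
elim/squotP: a => a; elim/squotP: b => b; elim/squotP: x => x.
by rewrite -spiZ -spiD !sqmul_pi smulDl spiD spiZ.
Qed.

Lemma sqmulDr (c : R[i]) x a b : sqmul x (c *: a + b) = c *: sqmul x a + sqmul x b.
Proof.
elim/squotP: a => a; elim/squotP: b => b; elim/squotP: x => x.
by rewrite -spiZ -spiD !sqmul_pi smulDr spiD spiZ.
Qed.

Lemma sqmulA a b c : sqmul a (sqmul b c) = sqmul (sqmul a b) c.
Proof.
elim/squotP: a => a; elim/squotP: b => b; elim/squotP: c => c.
by rewrite !sqmul_pi smulA.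
Qed.

Lemma sqnormM (a b : squot X) : `|sqmul a b| <= `|a| * `|b|.
Proof.
elim/squotP: a => a; elim/squotP: b => b.
by rewrite sqmul_pi !rnormE !rnorm_pi -rmorphM lecR snormM.
Qed.

Lemma sqstarD (c : R[i]) a b : sqstar (c *: a + b) = c^* *: sqstar a + sqstar b.
Proof.
elim/squotP: a => a; elim/squotP: b => b.
by rewrite -spiZ -spiD !sqstar_pi sstarD spiD spiZ.
Qed.

Lemma sqstarK a : sqstar (sqstar a) = a.
Proof. by elim/squotP: a => a; rewrite !sqstar_pi sstarK. Qed.

Lemma sqstarM a b : sqstar (sqmul a b) = sqmul (sqstar b) (sqstar a).
Proof.
elim/squotP: a => a; elim/squotP: b => b.
by rewrite sqmul_pi !sqstar_pi sqmul_pi sstarM.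
Qed.

Lemma sqnormC (a : squot X) : `|sqmul (sqstar a) a| = `|a| ^+ 2.
Proof.
elim/squotP: a => a.
by rewrite sqstar_pi sqmul_pi !rnormE !rnorm_pi snormC rmorphXn.
Qed.

Definition separated : cstarAlg R := CstarAlg sqmulDl sqmulDr sqmulA sqnormM sqstarD
  sqstarK sqstarM sqnormC.

End SeparatedAlgebra.

Section Sequences.
Variables (R : realType) (X : csemi R).

Definition bddseq : {pred nat -> X} :=
  fun x => `[< exists M, forall n, snorm (x n) <= M >].

Lemma bddseqP (x : nat -> X) : reflect (exists M, forall n, snorm (x n) <= M) (x \in bddseq).
Proof. exact: asboolP. Qed.

Lemma bddseq_submod : submod_closed bddseq.
Proof.
split; first by apply/bddseqP; exists 0 => n; rewrite snorm0.
move=> c x y /bddseqP [M hM] /bddseqP [L hL]; apply/bddseqP.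
exists (complex.Re `|c| * M + L) => n; apply: le_trans (snormD _ _) _; apply: lerD => //.
by rewrite snormZ ler_wpM2l ?Re_norm_ge0.
Qed.

HB.instance Definition _ := GRing.isSubmodClosed.Build R[i] (nat -> X) bddseq bddseq_submod.

Definition bseq := {x : nat -> X | x \in bddseq}.
HB.instance Definition _ := SubChoice.on bseq.
HB.instance Definition _ := [SubChoice_isSubLmodule of bseq by <:].

End Sequences.

Section SequenceAlgebra.
Variables (R : realType) (X : csemi R).
Local Notation W := (bseq X).
Implicit Types x y z : W.

Definition bnth x : nat -> X := sval x.

Lemma bnth_bd x : exists M, forall n, snorm (bnth x n) <= M.
Proof. by case: x => x /= /bddseqP. Qed.

Definition bmk (u : nat -> X) (h : exists M, forall n, snorm (u n) <= M) : W :=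
  exist _ u (introT (bddseqP u) h).

Lemma bseq_ext x y : (forall n, bnth x n = bnth y n) -> x = y.
Proof. by move=> h; apply: val_inj; apply/funext => n; exact: h. Qed.

Lemma bnthD x y n : bnth (x + y) n = bnth x n + bnth y n. Proof. by []. Qed.
Lemma bnthN x n : bnth (- x) n = - bnth x n. Proof. by []. Qed.
Lemma bnthZ c x n : bnth (c *: x) n = c *: bnth x n. Proof. by []. Qed.

Lemma bmul_subproof x y : exists M, forall n, snorm (smul (bnth x n) (bnth y n)) <= M.
Proof.
have [M hM] := bnth_bd x; have [L hL] := bnth_bd y; exists (M * L) => n.
by apply: le_trans (snormM _ _) _; apply: ler_pM; rewrite ?snorm_ge0.
Qed.

Definition bmul x y : W := bmk (bmul_subproof x y).

Lemma bnthM x y n : bnth (bmul x y) n = smul (bnth x n) (bnth y n). Proof. by []. Qed.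

Lemma bstar_subproof x : exists M, forall n, snorm (sstar (bnth x n)) <= M.
Proof. by have [M hM] := bnth_bd x; exists M => n; rewrite snorm_star. Qed.

Definition bstar x : W := bmk (bstar_subproof x).

Lemma bnth_star x n : bnth (bstar x) n = sstar (bnth x n). Proof. by []. Qed.

Lemma bmulDl (c : R[i]) a b x : bmul (c *: a + b) x = c *: bmul a x + bmul b x.
Proof. by apply: bseq_ext => n; rewrite !(bnthM, bnthD, bnthZ) smulDl. Qed.

Lemma bmulDr (c : R[i]) x a b : bmul x (c *: a + b) = c *: bmul x a + bmul x b.
Proof. by apply: bseq_ext => n; rewrite !(bnthM, bnthD, bnthZ) smulDr. Qed.

Lemma bmulA a b c : bmul a (bmul b c) = bmul (bmul a b) c.
Proof. by apply: bseq_ext => n; exact: smulA. Qed.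

Lemma bstarD (c : R[i]) a b : bstar (c *: a + b) = c^* *: bstar a + bstar b.
Proof. by apply: bseq_ext => n; rewrite !(bnth_star, bnthD, bnthZ) sstarD. Qed.

Lemma bstarK a : bstar (bstar a) = a.
Proof. by apply: bseq_ext => n; exact: sstarK. Qed.

Lemma bstarM a b : bstar (bmul a b) = bmul (bstar b) (bstar a).
Proof. by apply: bseq_ext => n; exact: sstarM. Qed.

(** The limit superior of the norms, so that null sequences have seminorm 0. *)
Definition bnorm x : R :=
  inf [set M | 0 <= M /\ exists n0, forall n, (n0 <= n)%N -> snorm (bnth x n) <= M].

Lemma bnorm_le x M n0 : 0 <= M -> (forall n, (n0 <= n)%N -> snorm (bnth x n) <= M) ->
  bnorm x <= M.
Proof. by move=> M0 h; apply: ge_inf; [exists 0 => ? []|split=> //; exists n0]. Qed.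

Lemma bnorm_nonempty x :
  [set M | 0 <= M /\ exists n0, forall n, (n0 <= n)%N -> snorm (bnth x n) <= M] !=set0.
Proof.
have [M hM] := bnth_bd x; exists M; split; last by exists 0%N.
exact: le_trans (snorm_ge0 _) (hM 0%N).
Qed.

Lemma bnorm_ge0 x : 0 <= bnorm x.
Proof. by apply: lb_le_inf; [exact: bnorm_nonempty|move=> ? []]. Qed.

Lemma bnorm_ev x (e : R) : 0 < e ->
  exists n0, forall n, (n0 <= n)%N -> snorm (bnth x n) <= bnorm x + e.
Proof.
move=> e0; have [|M [M0 [n0 hM]] Me] := @inf_adherent R _ e e0 (conj (bnorm_nonempty x) _).
  by exists 0 => ? [].
by exists n0 => n /hM h; apply: le_trans h (ltW Me).
Qed.

Lemma bnormD x y : bnorm (x + y) <= bnorm x + bnorm y.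
Proof.
apply/ler_addgt0Pr => e e0; have e2 : 0 < e / 2 by lra.
have [n1 h1] := bnorm_ev x e2; have [n2 h2] := bnorm_ev y e2.
apply: (@bnorm_le _ _ (maxn n1 n2)) => [|n].
  by have := bnorm_ge0 x; have := bnorm_ge0 y; lra.
rewrite geq_max => /andP[/h1 l1 /h2 l2].
by apply: le_trans (snormD _ _) _; lra.
Qed.

Lemma bnormZ_le (c : R[i]) x : bnorm (c *: x) <= complex.Re `|c| * bnorm x.
Proof.
apply/ler_addgt0Pr => e e0; have c0 := Re_norm_ge0 c.
set k := complex.Re _ in c0 *; have k1 : 0 < k + 1 by lra.
have [|n1 h1] := @bnorm_ev x (e / (k + 1)); first by rewrite divr_gt0.
apply: (@bnorm_le _ _ n1) => [|n /h1 h].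
  by rewrite addr_ge0 ?mulr_ge0 ?bnorm_ge0// ltW.
rewrite bnthZ snormZ -/k; apply: le_trans (ler_wpM2l c0 h) _.
rewrite mulrDr lerD2l mulrA ler_pdivrMr// mulrC ler_pM2l//; lra.
Qed.

Lemma bnormZ (c : R[i]) x : bnorm (c *: x) = complex.Re `|c| * bnorm x.
Proof.
apply/eqP; rewrite eq_le bnormZ_le andTb.
have [->|c0] := eqVneq c 0; first by rewrite Re_norm0 mul0r bnorm_ge0.
have := bnormZ_le c^-1 (c *: x); rewrite scalerA mulVf// scale1r => h.
apply: le_trans (ler_wpM2l (Re_norm_ge0 c) h) _.
by rewrite mulrA -Re_normM divff// normr1 mul1r.
Qed.

Lemma bnormM x y : bnorm (bmul x y) <= bnorm x * bnorm y.
Proof.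
apply/ler_addgt0Pr => e e0; have x0 := bnorm_ge0 x; have y0 := bnorm_ge0 y.
pose d := Num.min 1 (e / (bnorm x + bnorm y + 1)).
have s0 : 0 < bnorm x + bnorm y + 1 by lra.
have d0 : 0 < d by rewrite lt_min ltr01 divr_gt0.
have d1 : d <= 1 by rewrite ge_min lexx.
have de : d * (bnorm x + bnorm y + 1) <= e.
  by rewrite -ler_pdivlMr// ge_min lexx orbT.
have [n1 h1] := bnorm_ev x d0; have [n2 h2] := bnorm_ev y d0.
apply: (@bnorm_le _ _ (maxn n1 n2)) => [|n]; first by rewrite addr_ge0 ?mulr_ge0// ltW.
rewrite geq_max => /andP[/h1 l1 /h2 l2].
apply: le_trans (snormM _ _) _.
apply: le_trans (ler_pM (snorm_ge0 _) (snorm_ge0 _) l1 l2) _; nra.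
Qed.

Lemma bnormC x : bnorm (bmul (bstar x) x) = bnorm x ^+ 2.
Proof.
apply: (cstar_norm_of_ineq bstarK bnorm_ge0 bnormM) => y.
apply/ler_addgt0Pr => e e0; have [n0 h] := bnorm_ev (bmul (bstar y) y) e0.
set L := bnorm (bmul _ _) in h *; have L0 : 0 <= L + e.
  by rewrite addr_ge0 ?bnorm_ge0// ltW.
have : bnorm y <= Num.sqrt (L + e).
  apply: (@bnorm_le _ _ n0) => [|n /h]; first exact: sqrtr_ge0.
  rewrite bnthM bnth_star snormC -{1}(sqr_sqrtr L0).
  by rewrite ler_sqr ?nnegrE ?snorm_ge0 ?sqrtr_ge0.
by rewrite -{2}(sqr_sqrtr L0) ler_sqr ?nnegrE ?bnorm_ge0 ?sqrtr_ge0.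
Qed.

Definition bcsemi : csemi R := Csemi bmulDl bmulDr bmulA bstarD bstarK bstarM
  bnorm_ge0 bnormD bnormZ bnormM bnormC.

(** A diagonal argument. A subsequence v has |v_i - v_j| <= [rate R i] for i <= j, and from the
    index p j on this holds termwise up to an extra [rate R j]. The limit takes its n-th term from
    v_j with j growing slowly enough that p j <= n. *)
Lemma bcsemi_complete : scomplete bcsemi.
Proof.
move=> w wc.
have /choice [K0 hK0] : forall i, exists k, forall n m, (k <= n)%N -> (k <= m)%N ->
    bnorm (w n - w m) <= rate R i by move=> i; apply: wc; exact: rate_gt0.
pose K i := (\max_(j < i.+1) K0 j)%N.
have K0K i j : (i <= j)%N -> (K0 i <= K j)%N.
  by move=> ij; apply: (@leq_bigmax _ (fun k : 'I_j.+1 => K0 k) (Ordinal (ij : (i < j.+1)%N))).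
pose v i := w (K i).
have vd i j : (i <= j)%N -> bnorm (v i - v j) <= rate R i.
  by move=> ij; apply: hK0; exact: K0K.
have /choice [p hp] : forall j, exists p, forall n, (p <= n)%N -> forall i, (i <= j)%N ->
    snorm (bnth (v i) n - bnth (v j) n) <= rate R i + rate R j.
  move=> j.
  suff : forall m, (m <= j.+1)%N -> exists p, forall n, (p <= n)%N -> forall i, (i < m)%N ->
      snorm (bnth (v i) n - bnth (v j) n) <= rate R i + rate R j.
    by move=> /(_ _ (leqnn _)).
  elim=> [|m IH] mj; first by exists 0%N.
  have [p1 h1] := IH (ltnW mj).
  have [p2 h2] := bnorm_ev (v m - v j) (rate_gt0 R j).
  exists (maxn p1 p2) => n; rewrite geq_max => /andP[n1 n2] i.
  rewrite ltnS leq_eqVlt => /orP[/eqP ->|]; last exact: h1.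
  by apply: le_trans (h2 n n2) _; rewrite lerD2r vd.
(* J n is the last j <= n with p j <= n, with default 0 if there is none. *)
have /choice [J hJ] : forall n, exists j, (forall i, (i <= n)%N -> (p i <= n)%N -> (i <= j)%N) /\
    ((p j <= n)%N \/ j = 0%N).
  move=> n; suff : forall m, exists j, (forall i, (i < m)%N -> (p i <= n)%N -> (i <= j)%N) /\
      ((p j <= n)%N \/ j = 0%N) by move=> /(_ n.+1).
  elim=> [|m [j [h1 h2]]]; first by exists 0%N; split=> //; right.
  have [pm|pm] := boolP (p m <= n)%N; first by exists m; split=> //; left.
  exists j; split=> // i; rewrite ltnS leq_eqVlt => /orP[/eqP -> h|]; last exact: h1.
  by rewrite h in pm.
have rate_anti i j : (i <= j)%N -> rate R j <= rate R i.
  by move=> ij; rewrite /rate lef_pV2 ?posrE ?ltr0n// ler_nat.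
have ybd : exists M, forall n, snorm (bnth (v (J n)) n) <= M.
  have [M hM] := bnth_bd (v 0%N); exists (M + 2) => n.
  have [_ [h|->]] := hJ n; last by apply: le_trans (hM n) _; lra.
  have := snorm_tri (bnth (v 0%N) n) (bnth (v (J n)) n) 0; rewrite !subr0 snormBC.
  have := hp _ _ h 0%N isT; have := rate_le1 R 0; have := rate_le1 R (J n).
  have := hM n; lra.
exists (bmk ybd) => e e0.
have [|i hi] := @rate_small R (e / 3); first lra.
have {}hi := hi i (leqnn _).
have vy : bnorm (v i - bmk ybd) <= 2 * rate R i.
  apply: (@bnorm_le _ _ (maxn i (p i))) => [|n]; first by have := rate_gt0 R i; lra.
  rewrite geq_max => /andP[n1 n2]; have [h1 h2] := hJ n.
  have iJ := h1 _ n1 n2.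
  have pJ : (p (J n) <= n)%N.
    by case: h2 => // J0; rewrite J0 in iJ *; move: iJ; rewrite leqn0 => /eqP <-.
  have := hp _ _ pJ i iJ; have := rate_anti _ _ iJ.
  rewrite bnthD bnthN [bnth (bmk _) n]/=; lra.
exists (K i) => n Kn.
have h1 : bnorm (w n - v i) <= rate R i.
  by apply: hK0 => //; [apply: leq_trans Kn|]; exact: K0K.
have := bnormD (w n - v i) (v i - bmk ybd); rewrite addrA subrK.
by rewrite /snorm /=; lra.
Qed.

End SequenceAlgebra.

(* The completion is realized inside bounded sequences modulo null sequences;
   density of the image is not needed. *)
Lemma csemi_completion (R : realType) (X : csemi R) :
  exists (C : cstarAlg R) (phi : X -> C),
    [/\ forall (c : R[i]) a b, phi (c *: a + b) = c *: phi a + phi b,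
        forall a b, phi (smul a b) = cmul (phi a) (phi b),
        forall a, phi (sstar a) = cstar (phi a) &
        forall a, rnorm (phi a) = snorm a].
Proof.
pose C := separated (@bcsemi_complete R X).
have cb (a : X) : exists M, forall n : nat, snorm a <= M by exists (snorm a).
pose k (a : X) : bcsemi X := bmk (cb a).
exists C, (fun a => spi (k a)); split.
- move=> c a b; rewrite -[_ *: _ as X in _ = X + _]/(c *: (spi (k a) : squot (bcsemi X))).
  rewrite -spiZ -[RHS]spiD; congr spi; exact: bseq_ext.
- move=> a b; rewrite -[RHS]/(sqmul _ _) sqmul_pi; congr spi; exact: bseq_ext.
- move=> a; rewrite -[RHS]/(sqstar _) sqstar_pi; congr spi; exact: bseq_ext.
- move=> a; rewrite -[LHS]/(rnorm (spi (k a))) rnorm_pi.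
  apply/eqP; rewrite eq_le; apply/andP; split.
    by apply: (@bnorm_le _ _ _ _ 0%N) => //; exact: snorm_ge0.
  apply/ler_addgt0Pr => e e0; have [n0 h] := @bnorm_ev _ _ (k a) _ e0.
  exact: h n0 (leqnn _).
Qed.

(** * Composition, adjoints and positivity in a C*-precategory *)

Section Precategory.
Variables (R : realType) (T : cprecat R).

Definition endo (n : nat) : cstarAlg R :=
  @CstarAlg R (T n n) (@ccomp R T n n n) (@cadj R T n n) (@ccompDl R T n n n)
    (@ccompDr R T n n n) (@ccompA R T n n n n) (@ccomp_norm R T n n n)
    (@cadjD R T n n) (@cadjK R T n n) (@cadjM R T n n n) (@cadj_norm R T n n).

Lemma ccompDDl n m l (a b : T n m) (x : T m l) : ccomp (a + b) x = ccomp a x + ccomp b x.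
Proof. by have := ccompDl 1 a b x; rewrite !scale1r. Qed.

Lemma ccompDDr n m l (x : T n m) (a b : T m l) : ccomp x (a + b) = ccomp x a + ccomp x b.
Proof. by have := ccompDr 1 x a b; rewrite !scale1r. Qed.

Lemma ccomp0l n m l (x : T m l) : ccomp (0 : T n m) x = 0.
Proof. by apply: (@addrI _ (ccomp (0 : T n m) x)); rewrite -ccompDDl !addr0. Qed.

Lemma ccomp0r n m l (x : T n m) : ccomp x (0 : T m l) = 0.
Proof. by apply: (@addrI _ (ccomp x (0 : T m l))); rewrite -ccompDDr !addr0. Qed.

Lemma ccompZl n m l (c : R[i]) (a : T n m) (x : T m l) : ccomp (c *: a) x = c *: ccomp a x.
Proof. by rewrite -[c *: a]addr0 ccompDl ccomp0l addr0. Qed.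

Lemma ccompZr n m l (c : R[i]) (x : T n m) (a : T m l) : ccomp x (c *: a) = c *: ccomp x a.
Proof. by rewrite -[c *: a]addr0 ccompDr ccomp0r addr0. Qed.

Lemma ccompNl n m l (a : T n m) (x : T m l) : ccomp (- a) x = - ccomp a x.
Proof. by rewrite -scaleN1r ccompZl scaleN1r. Qed.

Lemma ccompNr n m l (x : T n m) (a : T m l) : ccomp x (- a) = - ccomp x a.
Proof. by rewrite -scaleN1r ccompZr scaleN1r. Qed.

Lemma ccompBl n m l (a b : T n m) (x : T m l) : ccomp (a - b) x = ccomp a x - ccomp b x.
Proof. by rewrite ccompDDl ccompNl. Qed.

Lemma ccompBr n m l (x : T n m) (a b : T m l) : ccomp x (a - b) = ccomp x a - ccomp x b.
Proof. by rewrite ccompDDr ccompNr. Qed.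

Lemma ccomp_suml n m l I (r : seq I) (F : I -> T n m) (x : T m l) :
  ccomp (\sum_(i <- r) F i) x = \sum_(i <- r) ccomp (F i) x.
Proof.
by elim/big_rec2: _ => [|i y z _ <-]; [exact: ccomp0l|exact: ccompDDl].
Qed.

Lemma ccomp_sumr n m l I (r : seq I) (x : T n m) (F : I -> T m l) :
  ccomp x (\sum_(i <- r) F i) = \sum_(i <- r) ccomp x (F i).
Proof.
by elim/big_rec2: _ => [|i y z _ <-]; [exact: ccomp0r|exact: ccompDDr].
Qed.

Lemma cadjDD n m (a b : T n m) : cadj (a + b) = cadj a + cadj b.
Proof. by have := cadjD 1 a b; rewrite rmorph1 !scale1r. Qed.

Lemma cadj0 n m : cadj (0 : T n m) = 0.
Proof. by apply: (@addrI _ (cadj (0 : T n m))); rewrite -cadjDD !addr0. Qed.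

Lemma cadjZ n m (c : R[i]) (a : T n m) : cadj (c *: a) = c^* *: cadj a.
Proof. by rewrite -[c *: a]addr0 cadjD cadj0 addr0. Qed.

Lemma cadjN n m (a : T n m) : cadj (- a) = - cadj a.
Proof. by rewrite -scaleN1r cadjZ rmorphN rmorph1 scaleN1r. Qed.

Lemma cadjB n m (a b : T n m) : cadj (a - b) = cadj a - cadj b.
Proof. by rewrite cadjDD cadjN. Qed.

Lemma cadj_sum n m I (r : seq I) (F : I -> T n m) :
  cadj (\sum_(i <- r) F i) = \sum_(i <- r) cadj (F i).
Proof. by elim/big_rec2: _ => [|i y z _ <-]; [exact: cadj0|exact: cadjDD]. Qed.

Lemma rnorm_comp n m l (a : T n m) (b : T m l) : rnorm (ccomp a b) <= rnorm a * rnorm b.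
Proof. by have := ccomp_norm a b; rewrite !rnormE -rmorphM lecR. Qed.

Lemma rnorm_adj_sqr n m (a : T n m) : rnorm (ccomp (cadj a) a) = rnorm a ^+ 2.
Proof. by have := cadj_norm a; rewrite !rnormE -rmorphXn => /complexI. Qed.

Lemma rnorm_adj n m (a : T n m) : rnorm (cadj a) = rnorm a.
Proof.
have le k l (y : T k l) : rnorm y <= rnorm (cadj y).
  have [->|n0] := eqVneq (rnorm y) 0; first exact: rnorm_ge0.
  have p : 0 < rnorm y by rewrite lt_neqAle eq_sym n0 rnorm_ge0.
  by rewrite -(ler_pM2r p) -expr2 -rnorm_adj_sqr rnorm_comp.
by apply/eqP; rewrite eq_le -{2}(cadjK a) !le.
Qed.

Lemma npos_adj_sqr n m (a : T n m) : npos (ccomp (cadj a) a : endo m).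
Proof. by apply: cs_positive_npos; exact: cadj_pos. Qed.

Lemma npos_sum m I (r : seq I) (F : I -> endo m) :
  (forall i, npos (F i)) -> npos (\sum_(i <- r) F i).
Proof. by move=> h; elim/big_rec: _ => [|i x _ hx]; [exact: npos0|exact: nposD]. Qed.

(* |x|^2 v*v - v*x*xv is positive, through the square root of |x|^2 - x*x. *)
Lemma comp_sqr_defect s r l (x : T s r) (v : T r l) (M : R) : 0 < M -> rnorm x <= M ->
  exists d : T r l, ((M ^+ 2)%:C)%C *: ccomp (cadj v) v =
    ccomp (cadj (ccomp x v)) (ccomp x v) + ccomp (cadj d) d.
Proof.
move=> M0 xM; pose z := (M^-1%:C)%C *: x; pose y : endo r := ccomp (cadj z) z.
have ye : y = ((M ^- 2)%:C)%C *: ccomp (cadj x) x.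
  by rewrite /y /z cadjZ ccompZl ccompZr scalerA conjC_real -rmorphM -expr2 exprVn.
have sy : cstar y = y by rewrite /y /cstar /= cadjM cadjK.
have y1 : rnorm y <= 1.
  rewrite ye rnormZ Re_normC rnorm_adj_sqr ger0_norm ?invr_ge0 ?sqr_ge0//.
  rewrite ler_pdivrMl ?exprn_gt0// mulr1 ler_sqr ?nnegrE ?rnorm_ge0 ?(ltW M0)//.
have [c sc ce] := sqrt_nonunital sy y1.
have {}sc : cadj c = c := sc.
exists ((M%:C)%C *: (v - ccomp c v)).
rewrite cadjZ conjC_real ccompZl ccompZr scalerA -rmorphM -expr2.
have -> : ccomp (cadj (ccomp x v)) (ccomp x v) =
    ((M ^+ 2)%:C)%C *: ccomp (ccomp (cadj v) y) v.
  rewrite ye ccompZr ccompZl scalerA -rmorphM divff ?expf_neq0 ?gt_eqF// rmorph1 scale1r.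
  by rewrite cadjM !ccompA.
rewrite -scalerDr; congr (_ *: _); rewrite -ce.
rewrite cadjB cadjM sc ccompBl !ccompBr !ccompDDr !ccompBl !ccompDDl.
have -> : @cmul R (endo r) c c = ccomp c c by [].
rewrite !ccompA.
set a1 := ccomp (cadj v) v; set a2 := ccomp (ccomp (cadj v) c) v.
set a3 := ccomp (ccomp (ccomp (cadj v) c) c) v.
have e : - a2 + (a3 - a2) = - (a2 + a2 - a3) by rewrite opprB opprD [RHS]addrA addrC.
by rewrite opprB -(addrA a1) e addrCA subrr addr0.
Qed.

End Precategory.

(** Finitely supported columns with entries in T(r,l): for each l a pre-Hilbert module over T(l,l).
    All l are needed, since the entry of an operator at (r,s) is tested on columns in T(s,r). *)
Record fvec (R : realType) (T : cprecat R) (l : nat) := Fvec {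
  vcoef :> forall r, T r l;
  vfin : exists N, forall r, (N <= r)%N -> vcoef r = 0
}.

(** * The Fock representation modulo J *)

Section FockModule.
Variables (R : realType) (T : cprecat R).

Section Vectors.
Variable l : nat.
Local Notation vec := (fvec T l).
Implicit Types u v w : vec.

HB.instance Definition _ := gen_eqMixin vec.
HB.instance Definition _ := gen_choiceMixin vec.

Lemma fvec_ext u v : (forall r, u r = v r) -> u = v.
Proof.
case: u v => [u hu] [v hv] /= h.
have e : u = v by apply: functional_extensionality_dep.
by subst v; congr Fvec; exact: Prop_irrelevance.
Qed.

Lemma vadd_fin u v : exists N, forall r, (N <= r)%N -> u r + v r = 0.
Proof.
have [[N hN] [M hM]] := (vfin u, vfin v); exists (maxn N M) => r.
by rewrite geq_max => /andP[/hN -> /hM ->]; rewrite addr0.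
Qed.
Definition vadd u v : vec := Fvec (vadd_fin u v).

Lemma vopp_fin u : exists N, forall r, (N <= r)%N -> - u r = 0.
Proof. by have [N hN] := vfin u; exists N => r /hN ->; rewrite oppr0. Qed.
Definition vopp u : vec := Fvec (vopp_fin u).

Lemma vzero_fin : exists N, forall r, (N <= r)%N -> (0 : T r l) = 0.
Proof. by exists 0%N. Qed.
Definition vzero : vec := Fvec vzero_fin.

Lemma vscale_fin (c : R[i]) u : exists N, forall r, (N <= r)%N -> c *: u r = 0.
Proof. by have [N hN] := vfin u; exists N => r /hN ->; rewrite scaler0. Qed.
Definition vscale c u : vec := Fvec (vscale_fin c u).

Lemma vaddA : associative vadd.
Proof. by move=> u v w; apply: fvec_ext => r /=; rewrite addrA. Qed.
Lemma vaddC : commutative vadd.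
Proof. by move=> u v; apply: fvec_ext => r /=; rewrite addrC. Qed.
Lemma vadd0 : left_id vzero vadd.
Proof. by move=> u; apply: fvec_ext => r /=; rewrite add0r. Qed.
Lemma vaddN : left_inverse vzero vopp vadd.
Proof. by move=> u; apply: fvec_ext => r /=; rewrite addNr. Qed.

HB.instance Definition _ := GRing.isZmodule.Build vec vaddA vaddC vadd0 vaddN.

Lemma vscaleA a b v : vscale a (vscale b v) = vscale (a * b) v.
Proof. by apply: fvec_ext => r /=; rewrite scalerA. Qed.
Lemma vscale1 : left_id 1 vscale.
Proof. by move=> u; apply: fvec_ext => r /=; rewrite scale1r. Qed.
Lemma vscaleDr : right_distributive vscale +%R.
Proof. by move=> a u v; apply: fvec_ext => r /=; rewrite scalerDr. Qed.
Lemma vscaleDl v : {morph vscale^~ v : a b / a + b}.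
Proof. by move=> a b; apply: fvec_ext => r /=; rewrite scalerDl. Qed.

HB.instance Definition _ := GRing.Zmodule_isLmodule.Build R[i] vec
  vscaleA vscale1 vscaleDr vscaleDl.

Lemma fvecD u v r : (u + v) r = u r + v r. Proof. by []. Qed.
Lemma fvecZ c u r : (c *: u) r = c *: u r. Proof. by []. Qed.
Lemma fvecN u r : (- u) r = - u r. Proof. by []. Qed.
Lemma fvec0 r : (0 : vec) r = 0. Proof. by []. Qed.

Definition vform u v : endo T l :=
  \sum_(0 <= r < projT1 (cid (vfin u))) ccomp (cadj (u r)) (v r).

Lemma vform_supp N u v : (forall r, (N <= r)%N -> u r = 0 \/ v r = 0) ->
  vform u v = \sum_(0 <= r < N) (ccomp (cadj (u r)) (v r) : endo T l).
Proof.
rewrite /vform; case: cid => M /= hM hN.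
have aux (K L : nat) (F : nat -> endo T l) : (forall r, (K <= r)%N -> F r = 0) ->
    (K <= L)%N -> \sum_(0 <= r < K) F r = \sum_(0 <= r < L) F r.
  move=> F0 KL; rewrite (big_cat_nat _ KL)//= [X in _ = _ + X]big_nat_cond.
  by rewrite [X in _ = _ + X]big1 ?addr0// => i /andP[/andP[/F0]].
pose F r := ccomp (cadj (u r)) (v r) : endo T l.
rewrite (aux M (maxn M N) F) ?(aux N (maxn M N) F) ?leq_maxl ?leq_maxr//.
- by move=> r /hN [] h; rewrite /F h ?cadj0 ?ccomp0l ?ccomp0r.
- by move=> r /hM h; rewrite /F h cadj0 ccomp0l.
Qed.

Lemma vform_common u v : exists N, (forall r, (N <= r)%N -> u r = 0) /\
  (forall r, (N <= r)%N -> v r = 0).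
Proof.
have [[N hN] [M hM]] := (vfin u, vfin v); exists (maxn N M).
by split=> r; rewrite geq_max => /andP[? ?]; [apply: hN|apply: hM].
Qed.

Lemma vformDr u v w : vform u (v + w) = vform u v + vform u w.
Proof.
have [N hN] := vfin u.
have s z := @vform_supp N u z (fun r Nr => or_introl (hN r Nr)).
by rewrite !s -big_split /=; apply: eq_bigr => r _; rewrite ccompDDr.
Qed.

Lemma vformZr (c : R[i]) u v : vform u (c *: v) = c *: vform u v.
Proof.
have [N hN] := vfin u.
have s z := @vform_supp N u z (fun r Nr => or_introl (hN r Nr)).
by rewrite !s scaler_sumr; apply: eq_bigr => r _; rewrite ccompZr.
Qed.

Lemma vform_adj u v : cstar (vform u v) = vform v u.
Proof.
have [N [hu hv]] := vform_common u v.
rewrite (@vform_supp N) => [|r /hu]; last by left.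
rewrite (@vform_supp N) => [|r /hv]; last by left.
rewrite /cstar /= cadj_sum; apply: eq_bigr => r _.
by rewrite cadjM cadjK.
Qed.

Lemma vformDl u v w : vform (u + v) w = vform u w + vform v w.
Proof. by rewrite -vform_adj vformDr cstarDD !vform_adj. Qed.

Lemma vformZl (c : R[i]) u v : vform (c *: u) v = c^* *: vform u v.
Proof. by rewrite -vform_adj vformZr cstarZ vform_adj. Qed.

Lemma vformNr u v : vform u (- v) = - vform u v.
Proof. by rewrite -scaleN1r vformZr scaleN1r. Qed.

Lemma vformNl u v : vform (- u) v = - vform u v.
Proof. by rewrite -scaleN1r vformZl rmorphN rmorph1 scaleN1r. Qed.

Lemma vform_pos u : npos (vform u u).
Proof. by apply: npos_sum => r; exact: npos_adj_sqr. Qed.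

Lemma vactr_fin u (b : T l l) : exists N, forall r, (N <= r)%N -> ccomp (u r) b = 0.
Proof. by have [N hN] := vfin u; exists N => r /hN ->; rewrite ccomp0l. Qed.
Definition vactr u b : vec := Fvec (vactr_fin u b).

Lemma vform_actr u v b : vform u (vactr v b) = cmul (vform u v) (b : endo T l).
Proof.
have [N hN] := vfin u.
have s z := @vform_supp N u z (fun r Nr => or_introl (hN r Nr)).
rewrite !s /cmul /= ccomp_suml; apply: eq_bigr => r _; exact: ccompA.
Qed.

Lemma vform_actl u v b : vform (vactr u b) v = cmul (cstar (b : endo T l)) (vform u v).
Proof. by rewrite -vform_adj vform_actr cstarM vform_adj. Qed.

Definition vnorm u : R := Num.sqrt (rnorm (vform u u)).

Lemma vnorm_ge0 u : 0 <= vnorm u. Proof. exact: sqrtr_ge0. Qed.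

Lemma vnorm_sqr u : vnorm u ^+ 2 = rnorm (vform u u).
Proof. by rewrite sqr_sqrtr// rnorm_ge0. Qed.

Lemma vnormZ (c : R[i]) u : vnorm (c *: u) = complex.Re `|c| * vnorm u.
Proof.
have h : vnorm (c *: u) ^+ 2 = (complex.Re `|c| * vnorm u) ^+ 2.
  rewrite vnorm_sqr vformZr vformZl scalerA rnormZ Re_normM Re_norm_conj.
  by rewrite exprMn vnorm_sqr expr2.
by apply/eqP; rewrite -(@eqrXn2 _ 2) ?h// ?vnorm_ge0 ?mulr_ge0 ?Re_norm_ge0 ?vnorm_ge0.
Qed.

(** With b = <u,v>, w = v - u b and (1 - c)^2 = 1 - <u,u>, the element <v,v> is b* b plus <w,w> plus
    the square of (1 - c) b, all positive. *)
Lemma cauchy_schwarz_unit u v : rnorm (vform u u) <= 1 ->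
  rnorm (vform u v) ^+ 2 <= rnorm (vform v v).
Proof.
move=> u1; set b := vform u v; set y := vform u u.
have [sy _] := vform_pos u.
have [c sc ce] := sqrt_nonunital (sy : cstar y = y) u1.
pose w := v - vactr u b; pose d : endo T l := b - cmul c b.
have h : vform v v = cmul (cstar b) b + (vform w w + cmul (cstar d) d).
  have -> : vform w w = vform v v - cmul (cstar b) b - cmul (cstar b) b +
      cmul (cstar b) (cmul y b).
    rewrite /w vformDl !vformDr vformNl !vformNr vformNl opprK !vform_actl !vform_actr.
    by rewrite -/b -/y -(vform_adj u v) -/b addrA.
  have -> : cmul (cstar d) d = cmul (cstar b) b - cmul (cstar b) (cmul y b).
    rewrite /d cstarB cstarM sc -ce !cmulBl !cmulBr !cmulDDl !cmulDDr !cmulA.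
    by rewrite -addrA; congr (_ + _); rewrite -opprD addrA.
  by rewrite [X in _ = _ + X]addrACA subrr addr0 subrK addrC subrK.
rewrite -rnormC h; apply: npos_norm_le; first exact: (@npos_adj_sqr R T).
by apply: nposD; [exact: vform_pos|exact: (@npos_adj_sqr R T)].
Qed.

Lemma cauchy_schwarz u v : rnorm (vform u v) <= vnorm u * vnorm v.
Proof.
apply/ler_addgt0Pr => e e0; have v0 := vnorm_ge0 v; have u0 := vnorm_ge0 u.
(* The slack keeps m positive when u = 0 and costs at most e after multiplication by |v|. *)
pose m := vnorm u + e / (vnorm v + 1).
have v1 : 0 < vnorm v + 1 by lra.
have m0 : 0 < m by rewrite ltr_wpDl// divr_gt0.
have mi : 0 <= m^-1 by rewrite invr_ge0 ltW.
have un : rnorm (vform ((m^-1%:C)%C *: u) ((m^-1%:C)%C *: u)) <= 1.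
  rewrite -vnorm_sqr vnormZ Re_normC ger0_norm// expr_le1//; last exact: mulr_ge0.
  by rewrite ler_pdivrMl// mulr1 lerDl ltW// divr_gt0.
have := cauchy_schwarz_unit v un.
rewrite vformZl conjC_real rnormZ Re_normC ger0_norm// -vnorm_sqr.
rewrite ler_sqr ?nnegrE ?mulr_ge0 ?rnorm_ge0// ler_pdivrMl// => h.
apply: le_trans h _; rewrite /m mulrDl lerD2l mulrAC ler_pdivrMr//; nra.
Qed.

Lemma vnormD u v : vnorm (u + v) <= vnorm u + vnorm v.
Proof.
rewrite -ler_sqr ?nnegrE ?addr_ge0 ?vnorm_ge0// vnorm_sqr vformDl !vformDr.
apply: le_trans (rnormD _ _) _; apply: le_trans (lerD (rnormD _ _) (rnormD _ _)) _.
rewrite -!vnorm_sqr; have := cauchy_schwarz u v; have := cauchy_schwarz v u.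
by move: (rnorm _) (rnorm _) (vnorm u) (vnorm v) => a b c d; nra.
Qed.

Lemma vform_nondeg v : (forall u, vform u v = 0) -> v = 0.
Proof.
move=> h; apply: fvec_ext => r; rewrite fvec0; apply: rnorm_eq0.
apply/eqP; rewrite -(@eqrXn2 _ 2) ?rnorm_ge0// expr0n /=.
have fin : exists N, forall s, (N <= s)%N ->
    (if s == r then v s else 0) = 0 :> T s l.
  by exists r.+1 => s rs; rewrite gtn_eqF.
have := h (Fvec fin); rewrite (@vform_supp r.+1) => [|s rs]; last first.
  by left => /=; rewrite gtn_eqF.
rewrite big_nat_recr//= eqxx big_nat big1 => [|s /andP[_ sr]]; last first.
  by rewrite ltn_eqF// cadj0 ccomp0l.
by rewrite add0r -rnorm_adj_sqr => ->; rewrite rnorm0.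
Qed.

Lemma coef_le_vnorm v r : rnorm (v r) <= vnorm v.
Proof.
rewrite -ler_sqr ?nnegrE ?rnorm_ge0 ?vnorm_ge0// vnorm_sqr -rnorm_adj_sqr.
have [N hN] := vfin v.
rewrite (@vform_supp (maxn N r.+1)); last first.
  by move=> s; rewrite geq_max => /andP[/hN ->]; left.
rewrite (bigD1_seq r) ?iota_uniq//=; last by rewrite mem_index_iota leq_max leqnn orbT.
apply: (@npos_norm_le R (endo T l)); first exact: npos_adj_sqr.
by rewrite big_mkcond; apply: npos_sum => i; case: ifP => _; [exact: npos_adj_sqr|exact: npos0].
Qed.

End Vectors.
End FockModule.

(** * Adjointable operators on the Fock module *)

Section Operators.
Variables (R : realType) (T : rtcat R) (J : morset T).
Arguments J : clear implicits.

Definition fop := forall l, fvec T l -> fvec T l.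

Definition fop_lin (f : fop) := forall l (c : R[i]) (v w : fvec T l),
  f l (c *: v + w) = c *: f l v + f l w.

Definition fop_bd (f : fop) := exists M : R, forall l (v : fvec T l),
  vnorm (f l v) <= M * vnorm v.

(** The J-compact operators before closure: left composition with a finite matrix over [J]. No
    closure is taken, as the quotient seminorm is an infimum of distances. *)
Definition is_Jop (f : fop) := exists (j : forall r s, T r s) (N : nat),
  [/\ forall r s, J r s (j r s),
      forall r s, (N <= r)%N \/ (N <= s)%N -> j r s = 0 &
      forall l (v : fvec T l) r, f l v r = \sum_(0 <= s < N) ccomp (j r s) (v s)].

(** Imposed as a condition, so that finite J-matrices form a two-sided ideal. An operator is a
    family indexed by l with no compatibility between different l, so this does not follow from
    boundedness. *)
Definition idealizes (f : fop) := forall h, is_Jop h ->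
  is_Jop (fun l v => f l (h l v)) /\ is_Jop (fun l v => h l (f l v)).

Record aop := Aop {
  af : fop;
  ag : fop;
  af_lin : fop_lin af;
  ag_lin : fop_lin ag;
  a_adj : forall l (v w : fvec T l), vform (af v) w = vform v (ag w);
  af_bd : fop_bd af;
  ag_bd : fop_bd ag;
  af_id : idealizes af;
  ag_id : idealizes ag
}.

Lemma aop_ext x y : (forall l v, af x v = af y v :> fvec T l) ->
  (forall l v, ag x v = ag y v :> fvec T l) -> x = y.
Proof.
case: x y => f g p1 p2 p3 p4 p5 p6 p7 [f' g' q1 q2 q3 q4 q5 q6 q7] /= hf hg.
have e : f = f' by apply: functional_extensionality_dep => l; apply/funext => v.
have e' : g = g' by apply: functional_extensionality_dep => l; apply/funext => v.
subst f' g'; congr Aop; exact: Prop_irrelevance.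
Qed.

HB.instance Definition _ := gen_eqMixin aop.
HB.instance Definition _ := gen_choiceMixin aop.

Hypothesis hJ : is_ideal J.

Lemma big_nat_widen0 (V : zmodType) (F : nat -> V) N M : (N <= M)%N ->
  (forall s, (N <= s)%N -> F s = 0) -> \sum_(0 <= s < M) F s = \sum_(0 <= s < N) F s.
Proof.
move=> NM F0; rewrite (big_cat_nat _ NM)//= [X in _ + X]big_nat_cond.
by rewrite [X in _ + X]big1 ?addr0// => i /andP[/andP[/F0]].
Qed.

Lemma Jop_lin h : is_Jop h -> fop_lin h.
Proof.
move=> [j [N [_ _ hj]]] l c v w; apply: fvec_ext => r.
rewrite fvecD fvecZ !hj scaler_sumr -big_split; apply: eq_bigr => s _ /=.
by rewrite ccompDDr ccompZr.
Qed.

Lemma Jop_ext f h : is_Jop h -> (forall l v, f l v = h l v :> fvec T l) -> is_Jop f.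
Proof.
by move=> [j [N [j1 j2 hj]]] e; exists j, N; split=> // l v r; rewrite e hj.
Qed.

Lemma Jop_comb f h (c : R[i]) : is_Jop f -> is_Jop h ->
  is_Jop (fun l v => c *: f l v + h l v).
Proof.
case: hJ => _ J0 JD _ _ [j [N [j1 j2 hj]]] [k [M [k1 k2 hk]]].
exists (fun r s => c *: j r s + k r s), (maxn N M); split.
- by move=> r s; exact: JD.
- move=> r s; rewrite !geq_max => h0.
  rewrite j2 ?k2 ?scaler0 ?addr0//; by case: h0 => /andP[? ?]; [left|right].
move=> l v r; rewrite fvecD fvecZ hj hk.
rewrite -(@big_nat_widen0 _ _ N (maxn N M)) ?leq_maxl//; last first.
  by move=> s Ns; rewrite j2 ?ccomp0l//; right.
rewrite -(@big_nat_widen0 _ _ M (maxn N M)) ?leq_maxr//; last first.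
  by move=> s Ns; rewrite k2 ?ccomp0l//; right.
rewrite scaler_sumr -big_split; apply: eq_bigr => s _ /=.
by rewrite ccompDDl ccompZl.
Qed.

Lemma Jop0 : is_Jop (fun l _ => 0).
Proof.
case: hJ => _ J0 _ _ _; exists (fun _ _ => 0), 0%N; split=> //.
by move=> l v r; rewrite big_nil.
Qed.

Lemma fop_lin0 f l : fop_lin f -> f l 0 = 0.
Proof.
move=> h; have := h l (-1) 0 0; rewrite scaler0 addr0 scaleN1r addNr.
by [].
Qed.

Definition fcomb (c : R[i]) (f h : fop) : fop := fun l v => c *: f l v + h l v.

Lemma fcomb_lin (c : R[i]) f h : fop_lin f -> fop_lin h -> fop_lin (fcomb c f h).
Proof.
move=> hf hh l d v w; rewrite /fcomb hf hh !scalerDr !scalerA (mulrC c).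
by rewrite addrACA.
Qed.

Lemma fcomb_bd c f h : fop_bd f -> fop_bd h -> fop_bd (fcomb c f h).
Proof.
move=> [M hM] [L hL]; exists (complex.Re `|c| * M + L) => l v.
apply: le_trans (vnormD _ _) _; rewrite mulrDl; apply: lerD => //.
by rewrite vnormZ -mulrA ler_wpM2l ?Re_norm_ge0.
Qed.

Lemma fcomb_id c f h : idealizes f -> idealizes h -> idealizes (fcomb c f h).
Proof.
move=> hf hh k hk; have [f1 f2] := hf k hk; have [h1 h2] := hh k hk.
split; first exact: Jop_comb.
apply: (Jop_ext (Jop_comb c f2 h2)) => l v.
by rewrite /fcomb (Jop_lin hk).
Qed.

Lemma acomb_adj (c : R[i]) x y l (v w : fvec T l) :
  vform (fcomb c (af x) (af y) v) w = vform v (fcomb c^* (ag x) (ag y) w).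
Proof. by rewrite /fcomb vformDl vformZl vformDr vformZr !a_adj. Qed.

Definition acomb c x y : aop := Aop
  (fcomb_lin c (@af_lin x) (@af_lin y)) (fcomb_lin c^* (@ag_lin x) (@ag_lin y))
  (@acomb_adj c x y)
  (fcomb_bd c (af_bd x) (af_bd y)) (fcomb_bd c^* (ag_bd x) (ag_bd y))
  (fcomb_id c (@af_id x) (@af_id y)) (fcomb_id c^* (@ag_id x) (@ag_id y)).

Lemma fzero_id : idealizes (fun l _ => 0).
Proof.
move=> h hh; split; first exact: Jop0.
by apply: (Jop_ext Jop0) => l v; rewrite (fop_lin0 _ (Jop_lin hh)).
Qed.

Lemma fzero_lin : fop_lin (fun l _ => 0).
Proof. by move=> l c v w; rewrite scaler0 addr0. Qed.

Lemma vform0l l (w : fvec T l) : vform 0 w = 0.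
Proof. by rewrite -(scale0r 0) vformZl conjC0 scale0r. Qed.

Lemma vform0r l (w : fvec T l) : vform w 0 = 0.
Proof. by rewrite -(scale0r 0) vformZr scale0r. Qed.

Lemma fzero_adj l (v w : fvec T l) : vform 0 w = vform v 0.
Proof. by rewrite vform0l vform0r. Qed.

Lemma vnorm0 l : vnorm (0 : fvec T l) = 0.
Proof. by rewrite /vnorm vform0l rnorm0 sqrtr0. Qed.

Lemma fzero_bd : fop_bd (fun l _ => 0).
Proof. by exists 0 => l v; rewrite mul0r vnorm0. Qed.

Definition azero : aop := Aop fzero_lin fzero_lin fzero_adj fzero_bd fzero_bd fzero_id fzero_id.

Definition aadd x y := acomb 1 x y.
Definition ascale c x := acomb c x azero.
Definition aneg x := ascale (-1) x.

Lemma aaddA : associative aadd.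
Proof.
by move=> x y z; apply: aop_ext => l v /=; rewrite /fcomb /= /fcomb ?rmorph1 !scale1r addrA.
Qed.

Lemma aaddC : commutative aadd.
Proof.
by move=> x y; apply: aop_ext => l v /=; rewrite /fcomb /= ?rmorph1 !scale1r addrC.
Qed.

Lemma aadd0 : left_id azero aadd.
Proof.
by move=> x; apply: aop_ext => l v /=; rewrite /fcomb /= ?rmorph1 !scale1r add0r.
Qed.

Lemma aaddN : left_inverse azero aneg aadd.
Proof.
move=> x; apply: aop_ext => l v /=; rewrite /fcomb /= /fcomb ?rmorphN ?rmorph1 scale1r.
  by rewrite scaleN1r addr0 addNr.
by rewrite scaleN1r addr0 addNr.
Qed.

End Operators.

(** The type carries the ideal hypothesis, because adding two operators needs finite J-matrices to
    be closed under linear combinations. *)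
Definition aopv (R : realType) (T : rtcat R) (J : morset T) (hJ : is_ideal J) : Type :=
  aop J.

Section OperatorAlgebra.
Variables (R : realType) (T : rtcat R) (J : morset T).
Arguments J : clear implicits.
Variable hJ : is_ideal J.
Local Notation V := (aopv hJ).

HB.instance Definition _ := Choice.on V.
HB.instance Definition _ := GRing.isZmodule.Build V
  (@aaddA R T J hJ) (@aaddC R T J hJ) (@aadd0 R T J hJ) (@aaddN R T J hJ).

Definition vscalea (c : R[i]) (x : V) : V := ascale hJ c x.

Lemma ascaleA a b (v : V) : vscalea a (vscalea b v) = vscalea (a * b) v.
Proof.
by apply: aop_ext => l w /=; rewrite /fcomb /= /fcomb !addr0 scalerA ?rmorphM.
Qed.

Lemma ascale1 : left_id 1 vscalea.
Proof. by move=> x; apply: aop_ext => l w /=; rewrite /fcomb /= ?rmorph1 addr0 scale1r. Qed.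

Lemma ascaleDr : right_distributive vscalea +%R.
Proof.
by move=> a x y; apply: aop_ext => l w /=; rewrite /fcomb /= /fcomb ?rmorph1 !addr0 !scale1r scalerDr.
Qed.

Lemma ascaleDl v : {morph vscalea^~ v : a b / a + b}.
Proof.
by move=> a b; apply: aop_ext => l w /=; rewrite /fcomb /= /fcomb ?rmorphD ?rmorph1 !addr0 !scale1r scalerDl.
Qed.

HB.instance Definition _ := GRing.Zmodule_isLmodule.Build R[i] V
  ascaleA ascale1 ascaleDr ascaleDl.

Lemma afD (x y : V) l (v : fvec T l) : af (x + y) v = af x v + af y v.
Proof. by rewrite /= /fcomb scale1r. Qed.
Lemma afZ (c : R[i]) (x : V) l (v : fvec T l) : af (c *: x) v = c *: af x v.
Proof. by rewrite /= /fcomb addr0. Qed.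
Lemma agD (x y : V) l (v : fvec T l) : ag (x + y) v = ag x v + ag y v.
Proof. by rewrite /= /fcomb rmorph1 scale1r. Qed.
Lemma agZ (c : R[i]) (x : V) l (v : fvec T l) : ag (c *: x) v = c^* *: ag x v.
Proof. by rewrite /= /fcomb addr0. Qed.

Definition fcompo (f h : fop T) : fop T := fun l v => f l (h l v).

Lemma fcompo_lin f h : fop_lin f -> fop_lin h -> fop_lin (fcompo f h).
Proof. by move=> hf hh l c v w; rewrite /fcompo hh hf. Qed.

Lemma fcompo_bd f h : fop_bd f -> fop_bd h -> fop_bd (fcompo f h).
Proof.
move=> [M hM] [L hL]; exists (Num.max 0 M * L) => l v.
apply: le_trans (hM _ _) _; rewrite -mulrA.
apply: (@le_trans _ _ (Num.max 0 M * vnorm (h l v))).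
  by rewrite ler_wpM2r ?vnorm_ge0// le_max lexx orbT.
by rewrite ler_wpM2l// le_max lexx.
Qed.

Lemma fcompo_id f h : idealizes J f -> idealizes J h -> idealizes J (fcompo f h).
Proof.
move=> hf hh k hk; split.
  by have [h1 _] := hh k hk; have [h2 _] := hf _ h1.
by have [_ h1] := hf k hk; have [_ h2] := hh _ h1.
Qed.

Lemma amul_adj (x y : V) l (v w : fvec T l) :
  vform (fcompo (af x) (af y) v) w = vform v (fcompo (ag y) (ag x) w).
Proof. by rewrite /fcompo !a_adj. Qed.

Definition amul (x y : V) : V := Aop
  (fcompo_lin (@af_lin _ _ _ x) (@af_lin _ _ _ y))
  (fcompo_lin (@ag_lin _ _ _ y) (@ag_lin _ _ _ x))
  (@amul_adj x y)
  (fcompo_bd (af_bd x) (af_bd y)) (fcompo_bd (ag_bd y) (ag_bd x))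
  (fcompo_id (@af_id _ _ _ x) (@af_id _ _ _ y)) (fcompo_id (@ag_id _ _ _ y) (@ag_id _ _ _ x)).

Lemma astar_adj (x : V) l (v w : fvec T l) : vform (ag x v) w = vform v (af x w).
Proof. by rewrite -vform_adj -a_adj vform_adj. Qed.

Definition astar (x : V) : V := Aop (@ag_lin _ _ _ x) (@af_lin _ _ _ x) (@astar_adj x)
  (ag_bd x) (af_bd x) (@ag_id _ _ _ x) (@af_id _ _ _ x).

Lemma af_mul (x y : V) l (v : fvec T l) : af (amul x y) v = af x (af y v).
Proof. by []. Qed.
Lemma ag_mul (x y : V) l (v : fvec T l) : ag (amul x y) v = ag y (ag x v).
Proof. by []. Qed.

Lemma amulDl (c : R[i]) (a b x : V) : amul (c *: a + b) x = c *: amul a x + amul b x.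
Proof.
apply: aop_ext => l v.
  by rewrite !(af_mul, afD, afZ).
by rewrite !(ag_mul, agD, agZ) ag_lin.
Qed.

Definition anorm (x : V) : R :=
  bnd (fun v : {l & fvec T l} => vnorm (af x (projT2 v)))
      (fun v : {l & fvec T l} => vnorm (projT2 v)).

Lemma anormP (x : V) l (v : fvec T l) : vnorm (af x v) <= anorm x * vnorm v.
Proof.
apply: (@bndP _ _ (fun v : {l & fvec T l} => vnorm (af x (projT2 v)))
  (fun v : {l & fvec T l} => vnorm (projT2 v)) _ (existT _ l v)).
  by move=> ?; exact: vnorm_ge0.
by have [M hM] := af_bd x; exists M => -[k w]; exact: hM.
Qed.

Lemma anorm_ge0 (x : V) : 0 <= anorm x.
Proof.
apply: bnd_ge0; first by move=> ?; exact: vnorm_ge0.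
by have [M hM] := af_bd x; exists M => -[k w]; exact: hM.
Qed.

Lemma anorm_le (x : V) M : 0 <= M ->
  (forall l (v : fvec T l), vnorm (af x v) <= M * vnorm v) -> anorm x <= M.
Proof. by move=> M0 h; apply: bnd_le => // -[l v]; exact: h. Qed.

Lemma anormD (x y : V) : anorm (x + y) <= anorm x + anorm y.
Proof.
apply: anorm_le => [|l v]; first by rewrite addr_ge0 ?anorm_ge0.
by rewrite afD mulrDl; apply: le_trans (vnormD _ _) (lerD _ _); exact: anormP.
Qed.

Lemma anormZ_le (c : R[i]) (x : V) : anorm (c *: x) <= complex.Re `|c| * anorm x.
Proof.
apply: anorm_le => [|l v]; first by rewrite mulr_ge0 ?anorm_ge0 ?Re_norm_ge0.
by rewrite afZ vnormZ -mulrA ler_wpM2l ?Re_norm_ge0// anormP.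
Qed.

Lemma anormZ (c : R[i]) (x : V) : anorm (c *: x) = complex.Re `|c| * anorm x.
Proof.
apply/eqP; rewrite eq_le anormZ_le andTb.
have [->|c0] := eqVneq c 0; first by rewrite Re_norm0 mul0r anorm_ge0.
have := anormZ_le c^-1 (c *: x); rewrite scalerA mulVf// scale1r => h.
apply: le_trans (ler_wpM2l (Re_norm_ge0 c) h) _.
by rewrite mulrA -Re_normM divff// normr1 mul1r.
Qed.

Lemma anormM (x y : V) : anorm (amul x y) <= anorm x * anorm y.
Proof.
apply: anorm_le => [|l v]; first by rewrite mulr_ge0 ?anorm_ge0.
rewrite af_mul; apply: le_trans (anormP _ _) _.
by rewrite -mulrA ler_wpM2l ?anorm_ge0// anormP.
Qed.

Lemma anorm_sqr (x : V) : anorm x ^+ 2 <= anorm (amul (astar x) x).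
Proof.
have h : anorm x <= Num.sqrt (anorm (amul (astar x) x)).
  apply: anorm_le => [|l v]; first exact: sqrtr_ge0.
  rewrite -ler_sqr ?nnegrE ?mulr_ge0 ?sqrtr_ge0 ?vnorm_ge0//.
  rewrite exprMn [in leRHS]sqr_sqrtr ?anorm_ge0// vnorm_sqr a_adj.
  apply: le_trans (cauchy_schwarz _ _) _; rewrite mulrC expr2 mulrA.
  by rewrite ler_wpM2r ?vnorm_ge0// (anormP (amul (astar x) x)).
rewrite -[leRHS]sqr_sqrtr ?anorm_ge0// ler_sqr ?nnegrE ?anorm_ge0 ?sqrtr_ge0//.
Qed.

Lemma astarK (x : V) : astar (astar x) = x.
Proof. exact: aop_ext. Qed.

Lemma amulDr (c : R[i]) (x a b : V) : amul x (c *: a + b) = c *: amul x a + amul x b.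
Proof.
apply: aop_ext => l v; last by rewrite !(ag_mul, agD, agZ).
by rewrite !(af_mul, afD, afZ) af_lin.
Qed.

Lemma amulA (a b c : V) : amul a (amul b c) = amul (amul a b) c.
Proof. exact: aop_ext. Qed.

Lemma astarM (a b : V) : astar (amul a b) = amul (astar b) (astar a).
Proof. exact: aop_ext. Qed.

Lemma astarD (c : R[i]) (a b : V) : astar (c *: a + b) = c^* *: astar a + astar b.
Proof.
apply: aop_ext => l v; first by rewrite afD afZ -agZ -agD.
by rewrite agD agZ conjCK -afZ -afD.
Qed.

Lemma anormC (x : V) : anorm (amul (astar x) x) = anorm x ^+ 2.
Proof. exact: (cstar_norm_of_ineq astarK anorm_ge0 anormM anorm_sqr). Qed.

Definition opalg : csemi R := Csemi amulDl amulDr amulA astarD astarK astarM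
  anorm_ge0 anormD anormZ anormM anormC.

End OperatorAlgebra.

(** * Iterated tensoring and self-adjointness of ideals *)

Section Tensoring.
Variables (R : realType) (T : rtcat R).

Lemma tensk_comb k n m (c : R[i]) (a b : T n m) :
  tensk k (c *: a + b) = c *: tensk k a + tensk k b.
Proof. by elim: k => [//|k IH] /=; rewrite IH tensD. Qed.

Lemma tenskM k n m l (a : T n m) (b : T m l) :
  tensk k (ccomp a b) = ccomp (tensk k a) (tensk k b).
Proof. by elim: k => [//|k IH] /=; rewrite IH tensM. Qed.

Lemma tensk_adj k n m (a : T n m) : tensk k (cadj a) = cadj (tensk k a).
Proof. by elim: k => [//|k IH] /=; rewrite IH tens_adj. Qed.

Lemma tensk0 k n m : tensk k (0 : T n m) = 0.
Proof. by elim: k => [//|k IH] /=; rewrite IH tens0. Qed.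

Lemma tenskB k n m (a b : T n m) : tensk k (a - b) = tensk k a - tensk k b.
Proof. by rewrite addrC -(scaleN1r b) tensk_comb scaleN1r addrC. Qed.

Lemma setT_cstar_subalg (A : cstarAlg R) : is_cstar_subalg (@setT A).
Proof. by split => //; exact: closedT. Qed.

Lemma tensk_star_hom k n : star_hom (fun a : endo T n => tensk k a : endo T (k + n)).
Proof.
split=> [c a b _ _|a b _ _|a _]; first exact: tensk_comb.
  exact: tenskM.
exact: tensk_adj.
Qed.

Lemma tensk_norm k n m (a : T n m) : rnorm (tensk k a) <= rnorm a.
Proof.
rewrite -ler_sqr ?nnegrE ?rnorm_ge0// -!rnorm_adj_sqr -tensk_adj -tenskM.
by have := hom_contract (setT_cstar_subalg _) (tensk_star_hom k m) (a := ccomp (cadj a) a) I.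
Qed.

Lemma hcast_comp n n' m m' l l' (en : n = n') (em : m = m') (el : l = l')
    (a : T n m) (b : T m l) :
  ccomp (hcast en em a) (hcast em el b) = hcast en el (ccomp a b).
Proof. by case: _ / en; case: _ / em; case: _ / el. Qed.

Lemma tensk_add k j n m (a : T n m) (e1 : (k + (j + n))%N = (k + j + n)%N)
    (e2 : (k + (j + m))%N = (k + j + m)%N) :
  tensk (k + j) a = hcast e1 e2 (tensk k (tensk j a)).
Proof.
elim: k e1 e2 => [|k IH] e1 e2; first by rewrite hcast_id.
rewrite [LHS]/= (IH (addnA k j n) (addnA k j m)).
exact: tens_hcast.
Qed.

Lemma tensk_tens k n m (a : T n m) (e1 : (k + n.+1)%N = (k.+1 + n)%N)
    (e2 : (k + m.+1)%N = (k.+1 + m)%N) :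
  tensk k.+1 a = hcast e1 e2 (tensk k (tens a)).
Proof.
elim: k e1 e2 => [|k IH] e1 e2; first by rewrite hcast_id.
rewrite [LHS]/= [tens (tensk k a)](IH (addnS k n) (addnS k m)).
exact: tens_hcast.
Qed.

End Tensoring.

Section Ideals.
Variables (R : realType) (T : rtcat R) (N : morset T).
Arguments N : clear implicits.
Hypothesis hN : is_ideal N.

Lemma idealD n m (a b : T n m) : N n m a -> N n m b -> N n m (a + b).
Proof. by case: hN => _ _ ND _ _ Na Nb; rewrite -[a]scale1r; exact: ND. Qed.

Lemma idealB n m (a b : T n m) : N n m a -> N n m b -> N n m (a - b).
Proof. by case: hN => _ _ ND _ _ Na Nb; rewrite addrC -scaleN1r; exact: ND. Qed.

(** Ideals are not assumed self-adjoint. This part is a C*-algebra in any case, so it has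
    approximate units, and these give [ideal_adj]. *)
Definition symm_part m : set (endo T m) := [set x | N m m x /\ N m m (cadj x)].
Arguments symm_part : clear implicits.

Lemma ideal_symm_subalg m : is_cstar_subalg (symm_part m).
Proof.
case: hN => Nc N0 ND Nl Nr; split.
- apply: closedP => x h; split; apply: (closed_approx (Nc _ _)) => e /h [y [y1 y2] xy].
    by exists y.
  by exists (cadj y) => //; rewrite -cadjB rnorm_adj.
- by split => //; rewrite cadj0.
- by move=> c a b [a1 a2] [b1 b2]; split; [exact: ND|rewrite cadjD; exact: ND].
- by move=> a b [a1 a2] [b1 b2]; split; [exact: Nl|rewrite cadjM; exact: Nl].
- by move=> a [a1 a2]; split => //; rewrite cadjK.
Qed.

(** Let u be an approximate unit for a* a in [symm_part m], obtained from the cutoff for the zero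
    homomorphism. Then |a - a u|^2 is the norm of (1 - u) a* a (1 - u), hence small, so [a] and its
    adjoint are limits of a u and u a*, which lie in the closed ideal. *)
Lemma ideal_adj_sqr n m (a : T n m) : N m m (ccomp (cadj a) a) ->
  N n m a /\ N m n (cadj a).
Proof.
move=> Ny; case: (hN) => Nc N0 ND Nl Nr.
have hz : star_hom_on (symm_part m) (fun _ : endo T m => 0 : endo T m).
  by split=> [c x y _ _|x y _ _|x _]; rewrite ?scaler0 ?addr0 ?cmul0l ?cstar0.
have key e : 0 < e -> exists u : T m m, N m m u /\ cadj u = u /\ rnorm (a - ccomp a u) <= e.
  move=> e0; pose y : endo T m := ccomp (cadj a) a.
  have sy : cstar y = y by rewrite /cstar /= cadjM cadjK.
  have Sy : symm_part m y by split => //; rewrite cadjM cadjK.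
  have [u [[Nu _] su _ _ ue]] := hom_cutoff (ideal_symm_subalg m) hz Sy sy (exprn_gt0 2 e0).
  exists u; split=> //; split=> //.
  rewrite -ler_sqr ?nnegrE ?rnorm_ge0 ?(ltW e0)// -rnorm_adj_sqr.
  rewrite rnorm0 add0r in ue; apply: le_trans ue.
  have su' : cadj u = u := su.
  rewrite cadjB cadjM su' ccompBl !ccompBr !ccompA opprB addrA addrAC.
  by rewrite (addrAC (ccomp (cadj a) a)) /cmul /= !ccompA.
split; apply: (closed_approx (Nc _ _)) => e /key [u [Nu [su ue]]].
  by exists (ccomp a u) => //; exact: Nr.
exists (ccomp u (cadj a)); first exact: Nl.
by rewrite -{1}su -cadjM -cadjB rnorm_adj.
Qed.

Lemma ideal_adj n m (a : T n m) : N n m a -> N m n (cadj a).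
Proof.
by move=> Na; case: (hN) => _ _ _ _ Nr; have [|//] := @ideal_adj_sqr n m a; exact: Nr.
Qed.

End Ideals.

(** * Toeplitz operators of morphisms *)

Section Shift.
Variables (R : realType) (T : rtcat R).

Section ShiftVec.
Variables (n m : nat) (a : T n m) (l : nat).
Implicit Types v w : fvec T l.

(** The Toeplitz operator of [a]: row k + n is (a (x) 1^k) v_{k+m}, and the rows above n are 0. The
    cast only identifies r with (r - n) + n. *)
Definition pcoef v r : T r l :=
  match pselect (n <= r)%N with
  | left h => hcast (subnK h) erefl (ccomp (tensk (r - n) a) (v (r - n + m)%N))
  | right _ => 0
  end.

Lemma pcoef_lt v r : (r < n)%N -> pcoef v r = 0.
Proof. by rewrite /pcoef; case: pselect => // h; rewrite ltnNge h. Qed.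

Lemma pcoef_cast v k r (e : (k + n)%N = r) :
  pcoef v r = hcast e erefl (ccomp (tensk k a) (v (k + m)%N)).
Proof.
rewrite /pcoef; case: pselect => [h|h]; last by case: h; rewrite -e leq_addl.
have ek : k = (r - n)%N by rewrite -e addnK.
by subst k; congr hcast; exact: eq_irrelevance.
Qed.

Lemma pcoef_add v k : pcoef v (k + n)%N = ccomp (tensk k a) (v (k + m)%N).
Proof. by rewrite (pcoef_cast v (erefl (k + n)%N)). Qed.

Lemma leq_ind (P : nat -> Prop) : (forall r, (r < n)%N -> P r) ->
  (forall k, P (k + n)%N) -> forall r, P r.
Proof.
by move=> h1 h2 r; have [/h1//|h] := ltnP r n; rewrite -(subnK h); exact: h2.
Qed.

Lemma pcoef_fin v : exists N, forall r, (N <= r)%N -> pcoef v r = 0.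
Proof.
have [N hN] := vfin v; exists (N + n)%N; elim/leq_ind => [r rn _|k].
  exact: pcoef_lt.
by rewrite leq_add2r => Nk; rewrite pcoef_add hN ?ccomp0r// (leq_trans Nk)// leq_addr.
Qed.

Definition pvec v : fvec T l := Fvec (pcoef_fin v).

End ShiftVec.
End Shift.

Section FockRepresentation.
Variables (R : realType) (T : rtcat R).

Lemma sum_shift (V : zmodType) (F : nat -> V) n N : (forall r, (r < n)%N -> F r = 0) ->
  \sum_(0 <= r < N + n) F r = \sum_(0 <= k < N) F (k + n)%N.
Proof.
move=> F0; rewrite (@big_cat_nat _ _ _ n)//= ?leq_addl//.
rewrite [X in X + _]big_nat_cond [X in X + _]big1 ?add0r; last first.
  by move=> i /andP[/andP[_ /F0]].
by rewrite -{1}(add0n n) big_addn addnK.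
Qed.

Section Pvec.
Variables (n m : nat) (a : T n m) (l : nat).

Lemma pvec_add (v : fvec T l) k : pvec a v (k + n)%N = ccomp (tensk k a) (v (k + m)%N).
Proof. exact: pcoef_add. Qed.

Lemma pvec_lt (v : fvec T l) r : (r < n)%N -> pvec a v r = 0.
Proof. exact: pcoef_lt. Qed.

Lemma pvec_lin : forall (c : R[i]) (v w : fvec T l),
  pvec a (c *: v + w) = c *: pvec a v + pvec a w.
Proof.
move=> c v w; apply: fvec_ext; elim/(@leq_ind n) => [r rn|k].
  by rewrite fvecD fvecZ !pvec_lt// scaler0 addr0.
by rewrite fvecD fvecZ !pvec_add ccompDDr ccompZr.
Qed.

Lemma pvec_adj (v w : fvec T l) : vform (pvec a v) w = vform v (pvec (cadj a) w).
Proof.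
have [N [hv hw]] := vform_common v w.
rewrite (@vform_supp _ _ _ (N + n)); last first.
  by move=> r Nr; right; apply: hw; apply: leq_trans Nr; rewrite leq_addr.
rewrite (@vform_supp _ _ _ (N + m)); last first.
  by move=> r Nr; left; apply: hv; apply: leq_trans Nr; rewrite leq_addr.
rewrite (@sum_shift (endo T l)) => [|r rn]; last by rewrite pvec_lt// cadj0 ccomp0l.
rewrite (@sum_shift (endo T l)) => [|r rn]; last by rewrite /= pcoef_lt// ccomp0r.
apply: eq_bigr => k _; rewrite pvec_add /= pcoef_add.
by rewrite cadjM tensk_adj -ccompA.
Qed.

(** M^2 <v,v> exceeds the form of the image by a sum of squares: the first m coefficients of v and
    the defects of [comp_sqr_defect]. Any finite bound is enough; the summand 1 keeps M positive, as
    that lemma requires. *)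
Lemma pvec_bd (v : fvec T l) : vnorm (pvec a v) <= (rnorm a + 1) * vnorm v.
Proof.
set M := rnorm a + 1; have M0 : 0 < M by rewrite ltr_wpDl ?rnorm_ge0.
have [N hv] := vfin v.
have ex : forall k, exists d : T (k + m)%N l,
    ((M ^+ 2)%:C)%C *: ccomp (cadj (v (k + m)%N)) (v (k + m)%N) =
    ccomp (cadj (ccomp (tensk k a) (v (k + m)%N))) (ccomp (tensk k a) (v (k + m)%N)) +
    ccomp (cadj d) d.
  move=> k; apply: comp_sqr_defect => //.
  by apply: le_trans (tensk_norm k a) _; rewrite lerDl.
pose d k := projT1 (cid (ex k)); have hd k := projT2 (cid (ex k)).
have e : ((M ^+ 2)%:C)%C *: vform v v = vform (pvec a v) (pvec a v) +
    (\sum_(0 <= r < m) (ccomp (cadj ((M%:C)%C *: v r)) ((M%:C)%C *: v r) : endo T l) +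
     \sum_(0 <= k < N) (ccomp (cadj (d k)) (d k) : endo T l)).
  rewrite (@vform_supp _ _ _ (N + m)); last first.
    by move=> r Nr; left; apply: hv; apply: leq_trans Nr; rewrite leq_addr.
  rewrite (@vform_supp _ _ _ (N + n)); last first.
    elim/(@leq_ind n) => [r rn _|k]; first by left; exact: pvec_lt.
    rewrite leq_add2r => Nk; left; rewrite pvec_add hv ?ccomp0r//.
    by apply: leq_trans Nk _; rewrite leq_addr.
  rewrite (@sum_shift (endo T l) _ n) => [|r rn]; last by rewrite pvec_lt// cadj0 ccomp0l.
  rewrite (@big_cat_nat _ _ _ m 0 (N + m))//= ?leq_addl//.
  rewrite -{2}(add0n m) big_addn addnK scalerDr.
  rewrite addrCA; congr (_ + _).
    rewrite scaler_sumr; apply: eq_bigr => r _.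
    by rewrite cadjZ ccompZl ccompZr scalerA conjC_real -rmorphM expr2.
  rewrite scaler_sumr -big_split; apply: eq_bigr => k _ /=.
  by rewrite hd pcoef_add.
rewrite -ler_sqr ?nnegrE ?vnorm_ge0 ?mulr_ge0 ?vnorm_ge0 ?(ltW M0)//.
rewrite exprMn !vnorm_sqr -[X in _ <= X * _](ger0_norm (sqr_ge0 M)) -Re_normC -rnormZ e.
apply: npos_norm_le; first exact: vform_pos.
by apply: nposD; apply: npos_sum => i; exact: npos_adj_sqr.
Qed.

End Pvec.

Section Pia.
Variables (J : morset T).
Arguments J : clear implicits.
Hypothesis hJ : is_ideal J.

(** Composed on the left, the operator acts on the columns of the matrix; composed on the right, its
    adjoint acts on the adjoints of the rows. *)
Lemma pvec_idealizes n m (a : T n m) : idealizes J (fun l v => pvec a v).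
Proof.
case: (hJ) => _ J0 _ Jl Jr h [j [N [j1 j2 hj]]]; split.
  have colfin s : exists M, forall r, (M <= r)%N -> j r s = 0.
    by exists N => r Nr; apply: j2; left.
  pose col s : fvec T s := Fvec (colfin s).
  exists (fun r s => pvec a (col s) r), (N + n)%N; split.
  - move=> r s; elim/(@leq_ind n): r => [r rn|k]; first by rewrite pvec_lt.
    by rewrite pvec_add; apply: Jr; exact: j1.
  - elim/(@leq_ind n) => [r rn|k] s; first by rewrite pvec_lt.
    rewrite leq_add2r pvec_add /= => Ns; rewrite j2 ?ccomp0r//.
    case: Ns => [Nk|Ns]; [left|right].
      by apply: leq_trans Nk _; rewrite leq_addr.
    by apply: leq_trans Ns; rewrite leq_addr.
  move=> l v; elim/(@leq_ind n) => [r rn|k].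
    by rewrite pvec_lt// big1// => s _; rewrite pvec_lt// ccomp0l.
  rewrite pvec_add hj ccomp_sumr.
  rewrite (@big_nat_widen0 (T (k + n)%N l) _ N (N + n)) ?leq_addr//; last first.
    by move=> s Ns; rewrite pvec_add /= j2 ?ccomp0r ?ccomp0l//; right.
  by apply: eq_bigr => s _; rewrite pvec_add ccompA.
have rowfin r : exists M, forall s, (M <= s)%N -> cadj (j r s) = 0.
  by exists N => s Ns; rewrite j2 ?cadj0//; right.
pose row r : fvec T r := Fvec (rowfin r).
have rowE r k : cadj (pvec (cadj a) (row r) (k + m)%N) = ccomp (j r (k + n)%N) (tensk k a).
  by rewrite pvec_add cadjM /= cadjK tensk_adj cadjK.
exists (fun r s => cadj (pvec (cadj a) (row r) s)), (N + m)%N; split.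
- move=> r s; elim/(@leq_ind m): s => [s sm|k]; first by rewrite pvec_lt// cadj0.
  by rewrite rowE; apply: Jl; exact: j1.
- move=> r; elim/(@leq_ind m) => [s sm|k]; first by rewrite pvec_lt// cadj0.
  rewrite leq_add2r rowE => Nr; rewrite j2 ?ccomp0l//.
  case: Nr => [Nr|Nk]; [left|right].
    by apply: leq_trans Nr; rewrite leq_addr.
  by apply: leq_trans Nk _; rewrite leq_addr.
move=> l v r; rewrite hj.
rewrite -(@big_nat_widen0 (T r l) _ N (N + n)) ?leq_addr//; last first.
  by move=> s Ns; rewrite j2 ?ccomp0l//; right.
rewrite sum_shift => [|s sn]; last by rewrite pvec_lt// ccomp0r.
rewrite sum_shift => [|s sn]; last by rewrite pvec_lt// cadj0 ccomp0l.
by apply: eq_bigr => k _; rewrite rowE pvec_add ccompA.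
Qed.

Lemma pvec_fop_lin n m (a : T n m) : fop_lin (fun l v => pvec a v).
Proof. by move=> l c v w; exact: pvec_lin. Qed.

Lemma pvec_fop_bd n m (a : T n m) : fop_bd (fun l v => pvec a v).
Proof. by exists (rnorm a + 1) => l v; exact: pvec_bd. Qed.

Definition pia n m (a : T n m) : aopv hJ := Aop
  (@pvec_fop_lin n m a) (@pvec_fop_lin m n (cadj a)) (@pvec_adj n m a)
  (@pvec_fop_bd n m a) (@pvec_fop_bd m n (cadj a))
  (@pvec_idealizes n m a) (@pvec_idealizes m n (cadj a)).

Lemma aop_af_inj (x y : aopv hJ) :
  (forall l (v : fvec T l), af x v = af y v) -> x = y.
Proof.
move=> h; apply: aop_ext => // l v; apply/eqP; rewrite -subr_eq0; apply/eqP.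
apply: vform_nondeg => u; rewrite vformDr vformNr -!a_adj h subrr //.
Qed.

Lemma af_pia n m (a : T n m) l (v : fvec T l) : af (pia a) v = pvec a v.
Proof. by []. Qed.

Lemma pia_comb n m (c : R[i]) (a b : T n m) : pia (c *: a + b) = c *: pia a + pia b.
Proof.
apply: aop_af_inj => l v; rewrite afD afZ !af_pia; apply: fvec_ext.
elim/(@leq_ind n) => [r rn|k].
  by rewrite fvecD fvecZ !pvec_lt// scaler0 addr0.
by rewrite fvecD fvecZ !pvec_add tensk_comb ccompDDl ccompZl.
Qed.

Lemma pia_star n m (a : T n m) : astar (pia a) = pia (cadj a).
Proof. by apply: aop_af_inj. Qed.

Lemma fvec_cast l (v : fvec T l) r r' (e : r = r') : v r' = hcast e erefl (v r).
Proof. by case: _ / e. Qed.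

Lemma pia_mul n m k l (a : T n m) (b : T (k + m)%N l) :
  amul (pia a) (pia b) = pia (ccomp (tensk k a) b).
Proof.
apply: aop_af_inj => q w; rewrite af_mul !af_pia; apply: fvec_ext.
elim/(@leq_ind n) => [r rn|i].
  by rewrite !pvec_lt// (leq_trans rn)// leq_addl.
rewrite pvec_add; have [ik|] := ltnP i k.
  by rewrite !pvec_lt ?ltn_add2r// ccomp0r.
move=> ki; have [j ej] : exists j, (j + k)%N = i by exists (i - k)%N; exact: subnK.
subst i.
have e1 : (j + (k + n))%N = (j + k + n)%N by rewrite addnA.
have e2 : (j + (k + m))%N = (j + k + m)%N by rewrite addnA.
rewrite [RHS](fvec_cast _ e1) pvec_add.
rewrite (fvec_cast (pvec b w) e2) pvec_add (tensk_add a e1 e2).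
by rewrite hcast_comp tenskM ccompA.
Qed.

End Pia.
End FockRepresentation.

(** * The C*-seminorm of a quotient by an ideal that need not be closed *)

Section ApproxClosure.
Variables (R : realType) (C : cstarAlg R) (D : set C).
Hypotheses (D0 : D 0) (DD : forall (c : R[i]) a b, D a -> D b -> D (c *: a + b))
  (DM : forall a b, D a -> D b -> D (cmul a b)) (Ds : forall a, D a -> D (cstar a)).

Definition approx_closure : set C :=
  [set x | forall eps : R, 0 < eps -> exists2 y, D y & rnorm (x - y) <= eps].

Lemma sub_approx_closure a : D a -> approx_closure a.
Proof. by move=> Da e e0; exists a => //; rewrite subrr rnorm0 ltW. Qed.

Lemma approx_closure_subalg : is_cstar_subalg approx_closure.
Proof.
split.
- apply: closedP => x h e e0; have e2 : 0 < e / 2 by lra.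
  have [y hy xy] := h _ e2; have [z Dz yz] := hy _ e2.
  by exists z => //; have := rnorm_tri x y z; have := rnorm_tri y x z; lra.
- exact: sub_approx_closure.
- move=> c a b ha hb e e0; have c0 := Re_norm_ge0 c.
  have k1 : 0 < complex.Re `|c| + 1 by lra.
  have [|a' Da aa] := ha (e / 2 / (complex.Re `|c| + 1)); first by rewrite divr_gt0//; lra.
  have [|b' Db bb] := hb (e / 2); first lra.
  exists (c *: a' + b'); first exact: DD.
  rewrite opprD addrACA -scalerBr; apply: le_trans (rnormD _ _) _; rewrite rnormZ.
  move: aa; rewrite ler_pdivlMr//; have := rnorm_ge0 _ (a - a'); lra.
- move=> a b ha hb e e0.
  pose d := Num.min 1 (e / (rnorm a + rnorm b + 1)).
  have a0 := rnorm_ge0 _ a; have b0 := rnorm_ge0 _ b.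
  have s0 : 0 < rnorm a + rnorm b + 1 by lra.
  have d0 : 0 < d by rewrite lt_min ltr01 divr_gt0.
  have d1 : d <= 1 by rewrite ge_min lexx.
  have de : d * (rnorm a + rnorm b + 1) <= e by rewrite -ler_pdivlMr// ge_min lexx orbT.
  have [a' Da aa] := ha _ d0; have [b' Db bb] := hb _ d0.
  exists (cmul a' b'); first exact: DM.
  have -> : cmul a b - cmul a' b' = cmul a (b - b') + cmul (a - a') b'.
    by rewrite cmulBr cmulBl addrA subrK.
  apply: le_trans (rnormD _ _) _.
  apply: le_trans (lerD (rnormM _ _) (rnormM _ _)) _.
  have := rnormB b (b - b'); rewrite opprB addrC subrK => h.
  have := rnorm_ge0 _ (a - a'); have := rnorm_ge0 _ (b - b'); have := rnorm_ge0 _ b'.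
  move: (rnorm (a - a')) (rnorm (b - b')) (rnorm b') (rnorm a) (rnorm b) h aa bb a0 b0 de d0 d1 {s0}.
  by move=> p q r s t *; nra.
- move=> a ha e /ha [b Db ab]; exists (cstar b); first exact: Ds.
  by rewrite -cstarB rnorm_star.
Qed.

End ApproxClosure.

Section QuotientNorm.
Variables (R : realType) (X : csemi R) (I : set X).
Hypotheses (I0 : I 0) (ID : forall (c : R[i]) a b, I a -> I b -> I (c *: a + b))
  (Il : forall a b, I b -> I (smul a b)) (Ir : forall a b, I a -> I (smul a b))
  (Is : forall a, I a -> I (sstar a)).

Definition qnorm (x : X) : R := inf [set snorm (x - y) | y in I].

Lemma qnorm_le x y : I y -> qnorm x <= snorm (x - y).
Proof.
by move=> Iy; apply: ge_inf; [exists 0 => _ [z _ <-]; exact: snorm_ge0|exists y].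
Qed.

Lemma qnorm_ge0 x : 0 <= qnorm x.
Proof.
apply: lb_le_inf; first by exists (snorm (x - 0)), 0.
by move=> _ [z _ <-]; exact: snorm_ge0.
Qed.

Lemma qnorm_adh x (e : R) : 0 < e -> exists2 y, I y & snorm (x - y) <= qnorm x + e.
Proof.
move=> e0; have hi : has_inf [set snorm (x - y) | y in I].
  split; first by exists (snorm (x - 0)), 0.
  by exists 0 => _ [z _ <-]; exact: snorm_ge0.
by have [_ [y Iy <-] /ltW h] := inf_adherent e0 hi; exists y.
Qed.

Lemma qnormD x y : qnorm (x + y) <= qnorm x + qnorm y.
Proof.
apply/ler_addgt0Pr => e e0; have e2 : 0 < e / 2 by lra.
have [a Ia xa] := qnorm_adh x e2; have [b Ib yb] := qnorm_adh y e2.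
apply: le_trans (qnorm_le (x + y) (_ : I (1 *: a + b))) _; first exact: ID.
rewrite scale1r opprD addrACA; apply: le_trans (snormD _ _) _; lra.
Qed.

Lemma qnormZ_le (c : R[i]) x : qnorm (c *: x) <= complex.Re `|c| * qnorm x.
Proof.
apply/ler_addgt0Pr => e e0; have c0 := Re_norm_ge0 c.
have k1 : 0 < complex.Re `|c| + 1 by lra.
have [|a Ia xa] := @qnorm_adh x (e / (complex.Re `|c| + 1)); first by rewrite divr_gt0.
apply: le_trans (qnorm_le (c *: x) (_ : I (c *: a + 0))) _; first exact: ID.
rewrite addr0 -scalerBr snormZ; apply: le_trans (ler_wpM2l c0 xa) _.
by rewrite mulrDr lerD2l mulrA ler_pdivrMr// mulrC ler_pM2l//; lra.
Qed.

Lemma qnormZ (c : R[i]) x : qnorm (c *: x) = complex.Re `|c| * qnorm x.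
Proof.
apply/eqP; rewrite eq_le qnormZ_le andTb.
have [->|c0] := eqVneq c 0; first by rewrite Re_norm0 mul0r qnorm_ge0.
have := qnormZ_le c^-1 (c *: x); rewrite scalerA mulVf// scale1r => h.
apply: le_trans (ler_wpM2l (Re_norm_ge0 c) h) _.
by rewrite mulrA -Re_normM divff// normr1 mul1r.
Qed.

Lemma qnormM x y : qnorm (smul x y) <= qnorm x * qnorm y.
Proof.
apply/ler_addgt0Pr => e e0; have x0 := qnorm_ge0 x; have y0 := qnorm_ge0 y.
pose d := Num.min 1 (e / (qnorm x + qnorm y + 1)).
have s0 : 0 < qnorm x + qnorm y + 1 by lra.
have d0 : 0 < d by rewrite lt_min ltr01 divr_gt0.
have d1 : d <= 1 by rewrite ge_min lexx.
have de : d * (qnorm x + qnorm y + 1) <= e by rewrite -ler_pdivlMr// ge_min lexx orbT.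
have [a Ia xa] := qnorm_adh x d0; have [b Ib yb] := qnorm_adh y d0.
have Ic : I (1 *: smul a (y - b) + smul x b) by apply: ID; [exact: Ir|exact: Il].
apply: le_trans (qnorm_le _ Ic) _.
have -> : smul x y - (1 *: smul a (y - b) + smul x b) = smul (x - a) (y - b).
  by rewrite scale1r smulBl (smulBr x) opprD addrA addrAC.
apply: le_trans (snormM _ _) _.
apply: le_trans (ler_pM (snorm_ge0 _) (snorm_ge0 _) xa yb) _; nra.
Qed.

(** Work in the completion with the closure of the image of [I]. Choose j in [I] nearly closest to
    x* x, and an approximate unit u for j* j. Then |x - x u|^2 is the norm of (1 - u) x* x (1 - u),
    at most |x* x - j| + |j - j u|. Finally u is replaced by an element of [I] close to it. *)
Lemma qnorm_sqr x : qnorm x ^+ 2 <= qnorm (smul (sstar x) x).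
Proof.
have [C [phi [phiL phiM phis phiN]]] := csemi_completion X.
have phi0 : phi 0 = 0.
  by have := phiL (-1) 0 0; rewrite scaler0 addr0 scaleN1r addNr.
have phiB a b : phi (a - b) = phi a - phi b.
  by have := phiL (-1) b a; rewrite !scaleN1r addrC => ->; rewrite addrC.
pose D : set C := phi @` I; pose S := approx_closure D.
have hS : is_cstar_subalg S.
  apply: approx_closure_subalg.
  - by exists 0.
  - by move=> c _ _ [a Ia <-] [b Ib <-]; exists (c *: a + b); [exact: ID|rewrite phiL].
  - by move=> _ _ [a Ia <-] [b Ib <-]; exists (smul a b); [exact: Il|rewrite phiM].
  - by move=> _ [a Ia <-]; exists (sstar a); [exact: Is|rewrite phis].
have hz : star_hom_on S (fun _ : C => 0 : C).
  by split=> [c a b _ _|a b _ _|a _]; rewrite ?scaler0 ?addr0 ?cmul0l ?cstar0.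
have [_ _ _ SM Sst] := hS.
apply/ler_addgt0Pr => e e0; have e2 : 0 < e / 2 by lra.
have [j Ij hj] := qnorm_adh (smul (sstar x) x) e2.
have Sj : S (phi j) by apply: sub_approx_closure; exists j.
have sy : cstar (cmul (cstar (phi j)) (phi j)) = cmul (cstar (phi j)) (phi j).
  by rewrite cstarM cstarK.
have [u [Su su _ uc ue]] := hom_cutoff hS hz (SM _ _ (Sst _ Sj) Sj) sy (exprn_gt0 2 e2).
have ju : rnorm (phi j - cmul (phi j) u) <= e / 2.
  rewrite -ler_sqr ?nnegrE ?rnorm_ge0 ?(ltW e2)// -rnormC.
  rewrite rnorm0 add0r in ue; apply: le_trans ue.
  rewrite cstarB cstarM su cmulBl !cmulBr !cmulA opprB addrA addrAC.
  by rewrite (addrAC (cmul (cstar (phi j)) (phi j))).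
set Q := qnorm _ in hj *.
have Q0 : 0 <= Q by exact: qnorm_ge0.
have xu : rnorm (phi x - cmul (phi x) u) <= Num.sqrt (Q + e).
  rewrite -ler_sqr ?nnegrE ?rnorm_ge0 ?sqrtr_ge0// sqr_sqrtr; last by lra.
  pose z := phi (smul (sstar x) x) - cmul (phi (smul (sstar x) x)) u.
  have -> : rnorm (phi x - cmul (phi x) u) ^+ 2 = rnorm (z - cmul u z).
    rewrite -rnormC /z phiM phis; congr rnorm.
    by rewrite cstarB cstarM su cmulBl !cmulBr !cmulA.
  rewrite -rnorm_star cstarB cstarM su; apply: le_trans (uc _) _; rewrite rnorm_star.
  have -> : z = (phi (smul (sstar x) x - j) - cmul (phi (smul (sstar x) x - j)) u) +
      (phi j - cmul (phi j) u).
    by rewrite /z phiB cmulBl opprB addrACA subrK (addrAC (cmul (phi j) u)) subrr add0r.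
  apply: le_trans (rnormD _ _) _.
  have := uc (phi (smul (sstar x) x - j)); rewrite phiN; lra.
have : qnorm x <= Num.sqrt (Q + e).
  apply/ler_addgt0Pr => d d0; have px := rnorm_ge0 _ (phi x).
  have k1 : 0 < rnorm (phi x) + 1 by lra.
  have [|_ [i Ii <-] ui] := Su (d / (rnorm (phi x) + 1)); first by rewrite divr_gt0.
  apply: le_trans (qnorm_le x (Il x Ii)) _.
  rewrite -phiN phiB phiM.
  have -> : phi x - cmul (phi x) (phi i) =
      (phi x - cmul (phi x) u) + cmul (phi x) (u - phi i).
    by rewrite cmulBr addrA subrK.
  apply: le_trans (rnormD _ _) _; apply: lerD => //.
  apply: le_trans (rnormM _ _) _; move: ui; rewrite ler_pdivlMr//.
  have := rnorm_ge0 _ (u - phi i); nra.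
by rewrite -ler_sqr ?nnegrE ?qnorm_ge0 ?sqrtr_ge0// sqr_sqrtr//; lra.
Qed.

Lemma qnormC x : qnorm (smul (sstar x) x) = qnorm x ^+ 2.
Proof. exact: (cstar_norm_of_ineq (@sstarK R X) qnorm_ge0 qnormM qnorm_sqr). Qed.

Definition quot_csemi : csemi R := Csemi (@smulDl R X) (@smulDr R X) (@smulA R X)
  (@sstarD R X) (@sstarK R X) (@sstarM R X) qnorm_ge0 qnormD qnormZ qnormM qnormC.

End QuotientNorm.

(** * Matrix entries modulo J-compact operators *)

Section SingleEntry.
Variables (R : realType) (T : rtcat R).

Lemma iotaM_id n m (a : T n m) : iotaM a n m = a.
Proof.
rewrite /iotaM; case: eqP => // e1; case: eqP => // e2.
exact: hcast_id.
Qed.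

Lemma iotaM_off n m (a : T n m) i j : (n != i) || (m != j) -> iotaM a i j = 0.
Proof.
by rewrite /iotaM; case: eqP => //= e1; case: eqP.
Qed.

Lemma single_fin s l (t : T s l) : exists N, forall r, (N <= r)%N -> iotaM t r l = 0.
Proof. by exists s.+1 => r sr; rewrite iotaM_off// ltn_eqF. Qed.

Definition single s l (t : T s l) : fvec T l := Fvec (single_fin t).

Lemma single_id s l (t : T s l) : single t s = t.
Proof. exact: iotaM_id. Qed.

Lemma single_off s l (t : T s l) r : s != r -> single t r = 0.
Proof. by move=> h; rewrite /= iotaM_off// h. Qed.

Lemma sum_single (V : zmodType) (F : nat -> V) N s :
  (forall r, s != r -> F r = 0) -> (s < N)%N -> \sum_(0 <= r < N) F r = F s.
Proof.
move=> F0 sN; rewrite (bigD1_seq s) ?mem_index_iota ?iota_uniq//= big1 ?addr0// => i.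
by rewrite eq_sym => /F0.
Qed.

Lemma vnorm_single s l (t : T s l) : vnorm (single t) = rnorm t.
Proof.
rewrite /vnorm (@vform_supp _ _ _ s.+1) => [|r sr]; last first.
  by left; apply: single_off; rewrite ltn_eqF.
rewrite (@sum_single (endo T l) _ _ s)// => [|r sr]; last by rewrite single_off// cadj0 ccomp0l.
rewrite single_id -[LHS]/(Num.sqrt (rnorm (ccomp (cadj t) t))) rnorm_adj_sqr.
by rewrite sqrtr_sqr ger0_norm// rnorm_ge0.
Qed.

Lemma hcast_inv n n' m m' (en : n = n') (em : m = m') (a : T n m) (b : T n' m') :
  b = hcast en em a -> a = hcast (esym en) (esym em) b.
Proof. by move=> ->; case: _ / en; case: _ / em. Qed.

End SingleEntry.

Section Model.
Variables (R : realType) (T : rtcat R) (J : morset T).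
Arguments J : clear implicits.
Hypothesis hJ : is_ideal J.
Local Notation V := (aopv hJ).

Definition jcompact : set (opalg hJ) := [set x : V | is_Jop J (af x) /\ is_Jop J (ag x)].

Lemma jcompact0 : jcompact 0.
Proof. by split; exact: Jop0. Qed.

Lemma jcompact_comb (c : R[i]) (a b : opalg hJ) :
  jcompact a -> jcompact b -> jcompact (c *: a + b).
Proof.
move=> [a1 a2] [b1 b2]; split.
  by apply: (Jop_ext (Jop_comb hJ c a1 b1)) => l v; rewrite (@afD R T J hJ) (@afZ R T J hJ).
by apply: (Jop_ext (Jop_comb hJ c^* a2 b2)) => l v; rewrite (@agD R T J hJ) (@agZ R T J hJ).
Qed.

Lemma jcompact_mull (a b : opalg hJ) : jcompact b -> jcompact (smul a b).
Proof.
move=> [b1 b2]; split.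
  by have [h _] := @af_id _ _ _ a _ b1.
by have [_ h] := @ag_id _ _ _ a _ b2.
Qed.

Lemma jcompact_mulr (a b : opalg hJ) : jcompact a -> jcompact (smul a b).
Proof.
move=> [b1 b2]; split.
  by have [_ h] := @af_id _ _ _ b _ b1.
by have [h _] := @ag_id _ _ _ b _ b2.
Qed.

Lemma jcompact_star (a : opalg hJ) : jcompact a -> jcompact (sstar a).
Proof. by case. Qed.

(** Only columns supported at s with an entry in T(s,r) are tested; the choice t = x* already
    recovers |x|. *)
Definition entry (X : V) r s (x : T r s) := forall t : T s r,
  af X (single t) r = ccomp x t.

Lemma entry_comb (c : R[i]) (X Y : V) r s (x y : T r s) :
  entry X x -> entry Y y -> entry (c *: X + Y) (c *: x + y).
Proof.
by move=> hx hy t; rewrite afD afZ fvecD fvecZ hx hy ccompDDl ccompZl.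
Qed.

Lemma entryD (X Y : V) r s (x y : T r s) : entry X x -> entry Y y -> entry (X + Y) (x + y).
Proof. by move=> hx hy; have := entry_comb 1 hx hy; rewrite !scale1r. Qed.

Lemma entry_cast (X : V) r s r' s' (e1 : r = r') (e2 : s = s') (x : T r s) :
  entry X x -> entry X (hcast e1 e2 x).
Proof. by case: _ / e1; case: _ / e2. Qed.

Lemma entry_pia n m (a : T n m) k : entry (pia hJ a) (tensk k a).
Proof. by move=> t; rewrite af_pia pvec_add single_id. Qed.

Lemma entry_pia_low n m (a : T n m) r s : (r < n)%N -> entry (pia hJ a) (0 : T r s).
Proof. by move=> rn t; rewrite af_pia pvec_lt// ccomp0l. Qed.

Definition toeplitz_entry (X : V) n m (x : T n m) := forall k, entry X (tensk k x).

Lemma toeplitz_pia n m (a : T n m) : toeplitz_entry (pia hJ a) a.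
Proof. by move=> k; exact: entry_pia. Qed.

Lemma toeplitzD (X Y : V) n m (x y : T n m) :
  toeplitz_entry X x -> toeplitz_entry Y y -> toeplitz_entry (X + Y) (x + y).
Proof.
move=> hx hy k; have := entryD (hx k) (hy k).
by have := tensk_comb k 1 x y; rewrite !scale1r => ->.
Qed.

Lemma toeplitz_tens (X : V) n m (x : T n m) :
  toeplitz_entry X x -> toeplitz_entry X (tens x).
Proof.
move=> h k.
have e := tensk_tens x (esym (addSnnS k n)) (esym (addSnnS k m)).
by rewrite (hcast_inv e); apply: entry_cast; exact: h.
Qed.

Definition toeplitz_diag (x : matrices T) n m : V :=
  \sum_(j < (minn n m).+1) pia hJ (x (n - j)%N (m - j)%N).

Lemma toeplitz_diag0 x n m : minn n m = 0%N -> toeplitz_diag x n m = pia hJ (x n m).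
Proof. by move=> e; rewrite /toeplitz_diag e big_ord1 /= !subn0. Qed.

Lemma toeplitz_diagS x n m :
  toeplitz_diag x n.+1 m.+1 = pia hJ (x n.+1 m.+1) + toeplitz_diag x n m.
Proof. by rewrite /toeplitz_diag minnSS big_ord_recl. Qed.

Lemma toeplitz_diagP x n m : toeplitz_entry (toeplitz_diag x n m) (diag_sum x n m).
Proof.
elim: n m => [m|n IH [|m]].
- by rewrite toeplitz_diag0 ?min0n// diag_sum0 ?min0n//; exact: toeplitz_pia.
- by rewrite toeplitz_diag0 ?minn0// diag_sum0 ?minn0//; exact: toeplitz_pia.
rewrite toeplitz_diagS diag_sumS; apply: toeplitzD; first exact: toeplitz_pia.
by apply: toeplitz_tens; exact: IH.
Qed.

(** The Toeplitz operator of a morphism in T(n + i, m + i) with i > 0 has no rows before n + i, so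
    row n sees only the partial sum up to (n,m). *)
Lemma toeplitz_diag_low x n m j :
  entry (toeplitz_diag x (n + j) (m + j)) (diag_sum x n m).
Proof.
elim: j => [|j IH]; first by rewrite !addn0; exact: (@toeplitz_diagP x n m 0%N).
rewrite !addnS toeplitz_diagS -[diag_sum x n m]add0r; apply: entryD => //.
by apply: entry_pia_low; rewrite ltnS leq_addr.
Qed.

(** For z = x - j, applying X - y to the column with the single entry z* produces z z*, of norm
    |z|^2, in row r. Hence |z| <= |X - y|. *)
Lemma entry_dist (y : V) : jcompact y -> exists (j : forall r s, T r s) (N : nat),
  [/\ forall r s, J r s (j r s), forall r s, (N <= r)%N -> j r s = 0 &
   forall (X : V) r s (x : T r s), entry X x -> rnorm (x - j r s) <= anorm (X - y)].
Proof.
move=> [[j [N [j1 j2 hj]]] _]; exists j, N; split=> //.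
  by move=> r s Nr; apply: j2; left.
move=> X r s x hx; set z := x - j r s.
have hy : entry y (j r s).
  move=> t; rewrite hj; have [sN|Ns] := ltnP s N.
    by rewrite (@sum_single _ _ _ s) ?single_id// => r' rs; rewrite single_off// ccomp0r.
  rewrite j2 ?ccomp0l; last by right.
  rewrite big_nat big1// => i /andP[_ iN]; rewrite single_off ?ccomp0r//.
  by rewrite gtn_eqF// (leq_trans iN).
have hz : entry (X - y) z.
  by have := entry_comb (-1) hy hx; rewrite !scaleN1r addrC (addrC (- j r s)).
have h1 : rnorm z ^+ 2 <= anorm (X - y) * rnorm z.
  rewrite -(rnorm_adj z) -rnorm_adj_sqr cadjK -hz -(vnorm_single (cadj z)).
  exact: le_trans (coef_le_vnorm _ _) (anormP _ _).
have [->|z0] := eqVneq (rnorm z) 0; first exact: anorm_ge0.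
by rewrite -(@ler_pM2r _ (rnorm z)) -?expr2// lt_neqAle eq_sym z0 rnorm_ge0.
Qed.

(** The two Toeplitz operators agree in every row k + n with k > 0, and that of a (x) 1 has no row
    n. Their difference is the matrix with the single entry [a] at (n,m). *)
Lemma jcompact_coisom n m (a : T n m) : J n m a ->
  jcompact (pia hJ a - pia hJ (tens a)).
Proof.
have key n' m' (b : T n' m') : J n' m' b ->
    is_Jop J (fun l (v : fvec T l) => pvec b v - pvec (tens b) v).
  move=> Jb; exists (iotaM b), (maxn n' m').+1; split.
  - move=> r s; case: (eqVneq n' r) => [e1|e1]; last first.
      by rewrite iotaM_off ?e1//; case: hJ.
    case: (eqVneq m' s) => [e2|e2]; last by rewrite iotaM_off ?e2 ?orbT//; case: hJ.
    by subst r s; rewrite iotaM_id.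
  - move=> r s h; apply: iotaM_off; case: h => h; apply/orP; [left|right].
      by rewrite ltn_eqF// (leq_trans _ h)// ltnS leq_maxl.
    by rewrite ltn_eqF// (leq_trans _ h)// ltnS leq_maxr.
  move=> l v r; rewrite fvecD fvecN.
  have s1 : \sum_(0 <= s < (maxn n' m').+1) ccomp (iotaM b r s) (v s) =
      ccomp (iotaM b r m') (v m').
    apply: (@sum_single _ (fun s => ccomp (iotaM b r s) (v s))); last by rewrite ltnS leq_maxr.
    by move=> s sm; rewrite iotaM_off ?sm ?orbT// ccomp0l.
  rewrite s1; elim/(@leq_ind n'): r {s1} => [r rn|[|k]].
  - have rn1 : (r < n'.+1)%N by rewrite ltnS ltnW.
    by rewrite (pvec_lt b v rn) (pvec_lt _ v rn1) subr0 iotaM_off ?ccomp0l// gtn_eqF.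
  - have e : pvec b v n' = ccomp b (v m') := pvec_add b v 0%N.
    by rewrite !add0n iotaM_id e pvec_lt// subr0.
  rewrite iotaM_off ?ccomp0l; last by rewrite ltn_eqF// addSn ltnS leq_addl.
  apply/eqP; rewrite subr_eq0; apply/eqP.
  have e1 := esym (addSnnS k n'); have e2 := esym (addSnnS k m').
  rewrite pvec_add (fvec_cast (pvec (tens b) v) e1) pvec_add (tensk_tens b e1 e2).
  by rewrite (fvec_cast v e2) hcast_comp.
move=> Ja; split.
  apply: (Jop_ext (key _ _ _ Ja)) => l v.
  by rewrite (@afD R T J hJ) -scaleN1r (@afZ R T J hJ) scaleN1r.
apply: (Jop_ext (key _ _ _ (ideal_adj hJ Ja))) => l v.
rewrite (@agD R T J hJ) -scaleN1r (@agZ R T J hJ) rmorphN rmorph1 scaleN1r.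
by rewrite [ag (pia hJ (tens a)) v]/= -tens_adj.
Qed.

(** A vanishing value puts the Toeplitz operator of the diagonal at distance 0 from the J-compact
    ones. Its entries, the partial diagonal sums and the tensor powers of the top sum, are then
    limits of elements of [J]; since a J-compact matrix is finite, those far out are small. *)
Lemma fock_model : exists (B : cstarAlg R) (p : mor_maps T B),
  [/\ forall K, is_rt_repr K p, coisometric_on J p &
      forall (x : matrices T) n m, diag_eval p n m x = 0 ->
      [/\ forall n' m' j, (0 < j)%N -> (n' + j)%N = n -> (m' + j)%N = m ->
            J n' m' (diag_sum x n' m'),
          forall k, J _ _ (tensk k (diag_sum x n m)) &
          forall eps : R, 0 < eps -> exists k0, forall k, (k0 <= k)%N ->
            rnorm (tensk k (diag_sum x n m)) <= eps]].
Proof.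
pose Q := quot_csemi jcompact0 jcompact_comb jcompact_mull jcompact_mulr jcompact_star.
have [B [phi [phiL phiM phis phiN]]] := csemi_completion Q.
have phiD a b : phi (a + b) = phi a + phi b.
  by have := phiL 1 a b; rewrite !scale1r.
have phi0 : phi 0 = 0 by apply: (@addrI _ (phi 0)); rewrite -phiD !addr0.
pose p : mor_maps T B := fun n m a => phi (pia hJ a).
exists B, p; split.
- move=> K; split.
  + by move=> n m c a b _ _; rewrite /p pia_comb phiL.
  + by move=> n m a _; rewrite /p -phis; congr phi; exact: pia_star.
  + by move=> n m k l a b _ _; rewrite /p -phiM; congr phi; exact: pia_mul.
- move=> n m a Ja; apply/eqP; rewrite -subr_eq0; apply/eqP.
  have -> : p n m a - p n.+1 m.+1 (tens a) = phi (pia hJ a - pia hJ (tens a)).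
    by rewrite /p addrC -scaleN1r -phiL scaleN1r addrC.
  apply: rnorm_eq0; rewrite phiN; apply/eqP; rewrite eq_le snorm_ge0 andbT.
  apply: le_trans (qnorm_le _ (jcompact_coisom Ja)) _.
  by rewrite subrr snorm0.
move=> x n m px.
have qx : qnorm jcompact (toeplitz_diag x n m) = 0.
  have <- : rnorm (phi (toeplitz_diag x n m)) = qnorm jcompact (toeplitz_diag x n m).
    exact: phiN.
  suff -> : phi (toeplitz_diag x n m) = diag_eval p n m x by rewrite px rnorm0.
  by rewrite /toeplitz_diag (big_morph phi phiD phi0).
have appr (e : R) : 0 < e -> exists (j : forall r s, T r s) (N : nat),
    [/\ forall r s, J r s (j r s), forall r s, (N <= r)%N -> j r s = 0 &
     forall r s (z : T r s), entry (toeplitz_diag x n m) z -> rnorm (z - j r s) <= e].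
  move=> e0; have [y Iy hy] := qnorm_adh jcompact0 (toeplitz_diag x n m : opalg hJ) e0.
  rewrite qx add0r in hy; have [j [N [j1 j2 hj]]] := entry_dist Iy.
  by exists j, N; split=> // r s z /hj h; exact: le_trans h hy.
have inJ r s (z : T r s) : entry (toeplitz_diag x n m) z -> J r s z.
  move=> hz; case: (hJ) => Jc _ _ _ _; apply: (closed_approx (Jc _ _)) => e /appr.
  by move=> [j [N [j1 _ j3]]]; exists (j r s) => //; exact: j3.
split.
- by move=> n' m' j _ en em; apply: inJ; rewrite -en -em; exact: toeplitz_diag_low.
- by move=> k; apply: inJ; exact: toeplitz_diagP.
- move=> e /appr [j [N [_ j2 j3]]]; exists N => k Nk.
  have := j3 _ _ _ (@toeplitz_diagP x n m k).
  by rewrite j2 ?subr0// (leq_trans Nk)// leq_addr.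
Qed.

End Model.

(** * The reduction ideal and kernels of representations *)

Section ReductionIdeal.
Variables (R : realType) (T : rtcat R) (J : morset T).
Arguments J : clear implicits.
Hypothesis hJ : is_ideal J.

Lemma morset_cast (N : morset T) n n' m m' (en : n = n') (em : m = m') (a : T n m) :
  N n m a -> N n' m' (hcast en em a).
Proof. by case: _ / en; case: _ / em. Qed.

Lemma tensk_tens' k n m (a : T n m) :
  tensk k (tens a) = hcast (esym (esym (addSnnS k n))) (esym (esym (addSnnS k m))) (tensk k.+1 a).
Proof. by apply: hcast_inv; exact: tensk_tens. Qed.

Lemma hcast0 n n' m m' (en : n = n') (em : m = m') : hcast en em (0 : T n m) = 0.
Proof. by case: _ / en; case: _ / em. Qed.

Lemma Sfam0 k n m : Sfam J k n m 0.
Proof.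
case: (hJ) => _ J0 _ _ _.
elim: k n m => [//|k IH] n m; exists 0; last by exists 0; rewrite ?addr0.
by split => //; rewrite /pretens /= tens0; exact: IH.
Qed.

(** The element enters S_k with second summand 0, because a (x) 1 satisfies the hypotheses for k -
    1. *)
Lemma Sfam_tensk k n m (a : T n m) : (forall i, J _ _ (tensk i a)) -> tensk k a = 0 ->
  Sfam J k n m a.
Proof.
elim: k n m a => [//|k IH] n m a Ja a0.
exists a; last by exists 0; [exact: Sfam0|rewrite addr0].
split; first exact: (Ja 0%N).
apply: IH => [i|]; last by rewrite tensk_tens' a0 hcast0.
by rewrite tensk_tens'; apply: morset_cast.
Qed.

Definition tensor_core m : set (endo T m) := [set x | forall i, J _ _ (tensk i x)].
Arguments tensor_core : clear implicits.

Lemma tensor_core_subalg m : is_cstar_subalg (tensor_core m).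
Proof.
case: (hJ) => Jc J0 JD Jl Jr; split.
- apply: closedP => x h i; apply: (closed_approx (Jc _ _)) => e /h [y hy xy].
  exists (tensk i y); first exact: hy.
  by rewrite -tenskB; apply: le_trans (tensk_norm _ _) xy.
- by move=> i; rewrite tensk0.
- by move=> c a b ha hb i; rewrite tensk_comb; apply: JD.
- by move=> a b ha hb i; rewrite tenskM; apply: Jl.
- by move=> a ha i; rewrite tensk_adj; apply: ideal_adj.
Qed.

(** On the C*-algebra [tensor_core m] the map (x) 1^k is a homomorphism. For k with |a (x) 1^k|
    small, a cutoff of a* a gives u in its kernel with a - a u small, and a u lies in S_k by
    [Sfam_tensk]. *)
Lemma reduction_ideal_of_decay n m (a : T n m) : (forall k, J _ _ (tensk k a)) ->
  (forall eps : R, 0 < eps -> exists k0, forall k, (k0 <= k)%N -> rnorm (tensk k a) <= eps) ->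
  reduction_ideal J n m a.
Proof.
move=> Ja a0; case: (hJ) => Jc J0 JD Jl Jr.
have cl : closed (reduction_ideal J n m) by exact: closed_closure.
apply: (closed_approx cl) => e e0; have e2 : 0 < e / 2 by lra.
have [k hk] := a0 _ e2; have {}hk := hk k (leqnn _).
pose y : endo T m := ccomp (cadj a) a.
have Sy : tensor_core m y by move=> i; rewrite tenskM; apply: Jr.
have sy : cstar y = y by rewrite /cstar /= cadjM cadjK.
have hom : star_hom_on (tensor_core m) (fun x : endo T m => tensk k x : endo T (k + m)).
  have [h1 h2 h3] := @tensk_star_hom R T k m.
  by split=> *; [exact: h1|exact: h2|exact: h3].
have ed : 0 < (e / 2) ^+ 2 by rewrite exprn_gt0.
have [u [Su su fu _ ue]] := hom_cutoff (tensor_core_subalg m) hom Sy sy ed.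
have su' : cadj u = u := su.
exists (ccomp a u).
  apply: subset_closure; exists k => //; apply: Sfam_tensk => [i|].
    by rewrite tenskM; apply: Jr; exact: Su.
  by rewrite tenskM fu ccomp0r.
rewrite -ler_sqr ?nnegrE ?rnorm_ge0 ?(ltW e0)// -rnorm_adj_sqr.
have h1 : rnorm (tensk k y) <= (e / 2) ^+ 2.
  rewrite /y tenskM tensk_adj rnorm_adj_sqr ler_sqr ?nnegrE ?rnorm_ge0//; exact: ltW.
apply: (@le_trans _ _ (rnorm (tensk k y) + (e / 2) ^+ 2)); last by nra.
apply: le_trans ue.
rewrite cadjB cadjM su' ccompBl !ccompBr !ccompA opprB addrA addrAC.
by rewrite (addrAC (ccomp (cadj a) a)) /cmul /= !ccompA.
Qed.

End ReductionIdeal.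

(** * Kernels of representations and condition iii) *)

Section Representations.
Variables (R : realType) (T : rtcat R) (K J : morset T).
Arguments K : clear implicits.
Arguments J : clear implicits.
Hypotheses (hK : is_ideal K) (hJ : is_ideal J) (hJK : morset_sub J (Jideal K)).
Variables (B : cstarAlg R) (p : mor_maps T B).
Arguments p : clear implicits.
Hypotheses (hp : is_rt_repr K p) (hcois : coisometric_on J p).

Lemma ideal_subalg m : @is_cstar_subalg R (endo T m) (K m m).
Proof.
case: (hK) => Kc K0 KD Kl Kr; split.
- exact: Kc.
- exact: K0.
- by move=> c a b; exact: KD.
- by move=> a b Ka _; exact: Kl.
- by move=> a; exact: (ideal_adj hK).
Qed.

Lemma repr_star_hom m : @star_hom_on R (endo T m) B (K m m) (p m m).
Proof.
case: (hp) => pl ps pm; split.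
- by move=> c a b; exact: pl.
- by move=> a b Ka Kb; rewrite (pm m m 0%N m a b).
- by move=> a Ka; rewrite (ps m m a).
Qed.

Lemma reprD n m (a b : T n m) : K n m a -> K n m b -> p n m (a + b) = p n m a + p n m b.
Proof. by case: (hp) => pl _ _ Ka Kb; have := pl n m 1 a b Ka Kb; rewrite !scale1r. Qed.

Lemma repr0 n m : p n m 0 = 0.
Proof.
case: (hK) => _ K0 _ _ _; apply: (@addrI _ (p n m 0)).
by rewrite -reprD// !addr0.
Qed.

Lemma reprZ n m c (a : T n m) : K n m a -> p n m (c *: a) = c *: p n m a.
Proof.
case: (hK) => _ K0 _ _ _; case: (hp) => pl _ _ Ka.
by have := pl n m c a 0 Ka (K0 _ _); rewrite repr0 !addr0.
Qed.

Lemma reprB n m (a b : T n m) : K n m a -> K n m b -> p n m (a - b) = p n m a - p n m b.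
Proof.
case: (hp) => pl _ _ Ka Kb.
by rewrite addrC -scaleN1r pl// scaleN1r addrC.
Qed.

Lemma repr_adj_mul n m l (a : T n m) (b : T n l) : K n m a -> K n l b ->
  cmul (cstar (p n m a)) (p n l b) = p m l (ccomp (cadj a) b).
Proof.
case: (hp) => pl ps pm Ka Kb; rewrite ps//.
by rewrite (pm m n 0%N l (cadj a) b (ideal_adj hK Ka) Kb).
Qed.

Lemma repr_contract n m (a : T n m) : K n m a -> rnorm (p n m a) <= rnorm a.
Proof.
move=> Ka; case: (hK) => _ _ _ Kl Kr.
rewrite -ler_sqr ?nnegrE ?rnorm_ge0// -rnormC repr_adj_mul// -rnorm_adj_sqr.
apply: (hom_contract (ideal_subalg m) (repr_star_hom m)); exact: Kr.
Qed.

Lemma J_sub_K n m (a : T n m) : J n m a -> K n m a.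
Proof. by move=> /hJK []. Qed.

Lemma tens_J n m (a : T n m) : J n m a -> K n.+1 m.+1 (tens a).
Proof. by move=> /hJK []. Qed.

(** For the summand x in [J], coisometry replaces p(x) by p(x (x) 1), which vanishes by induction as
    x (x) 1 lies in S_{k-1}. *)
Lemma Sfam_ker k n m (a : T n m) : Sfam J k n m a -> K n m a /\ p n m a = 0.
Proof.
case: (hK) => _ K0 _ _ _.
elim: k n m a => [|k IH] n m a /=; first by move=> ->; rewrite repr0.
move=> [x [Jx tx] [y /IH [Ky py] <-]].
have Kx := J_sub_K Jx; split; first exact: (idealD hK).
by rewrite reprD// py addr0 hcois//; have [] := IH _ _ _ tx.
Qed.

Lemma reduction_ideal_ker n m (a : T n m) : reduction_ideal J n m a ->
  K n m a /\ p n m a = 0.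
Proof.
move=> ra; case: (hK) => Kc _ _ _ _.
have appr (e : R) : 0 < e -> exists y, [/\ K n m y, p n m y = 0 & rnorm (a - y) <= e].
  by move=> /(closure_approx ra) [y [k _ /Sfam_ker [Ky py]] ay]; exists y.
have Ka : K n m a.
  by apply: (closed_approx (Kc n m)) => e /appr [y [Ky _ ay]]; exists y.
split=> //; apply: rnorm_eps => e /appr [y [Ky py ay]].
have -> : p n m a = p n m (a - y) by rewrite reprB// py subr0.
by apply: le_trans ay; apply: repr_contract; exact: (idealB hK).
Qed.

Lemma diag_sum_sub (x y : matrices T) n m :
  diag_sum (matrix_sub x y) n m = diag_sum x n m - diag_sum y n m.
Proof.
elim: n m => [m|n IH [|m]]; try by rewrite !diag_sum0 ?min0n ?minn0.
have tB : tens (diag_sum x n m - diag_sum y n m) =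
  tens (diag_sum x n m) - tens (diag_sum y n m) := tenskB 1 _ _.
by rewrite !diag_sumS IH /matrix_sub tB opprD addrACA.
Qed.

Lemma seminormJ_iff n m x : seminormJ J n m x = 0 <-> diag_sum x n m = 0 /\
  forall n' m' j, (0 < j)%N -> (n' + j)%N = n -> (m' + j)%N = m -> J n' m' (diag_sum x n' m').
Proof.
split; first by move=> /(seminormJ_eq0 J hJ).
move=> [h1 h2]; rewrite /seminormJ h1 rnorm0.
rewrite big_nat_cond; rewrite (big_ind (fun r : R => r = 0)) ?maxxx//.
  by move=> a b -> ->; rewrite maxxx.
move=> j; rewrite andbT => /andP[j0 jm].
have Jd : J (n - j)%N (m - j)%N (diag_sum x (n - j) (m - j)) by apply: (h2 _ _ j); lia.
apply/eqP; rewrite eq_le (quot_norm_ge0 J hJ) andbT; apply: ge_inf.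
  by exists 0 => _ [b _ <-]; exact: rnorm_ge0.
by exists (diag_sum x (n - j) (m - j)) => //; rewrite subrr rnorm0.
Qed.

Lemma diag_sum_vanish (x : matrices T) n m :
  (forall j, (j <= n)%N -> (j <= m)%N -> x (n - j)%N (m - j)%N = 0) -> diag_sum x n m = 0.
Proof.
elim: n m => [m|n IH [|m]] h.
- by rewrite diag_sum0 ?min0n//; have := h 0%N; rewrite !subn0; apply.
- by rewrite diag_sum0 ?minn0//; have := h 0%N; rewrite !subn0; apply.
rewrite diag_sumS IH ?tens0 ?addr0.
  by have := h 0%N; rewrite !subn0; apply.
by move=> j jn jm; have := h j.+1; rewrite !subSS; apply.
Qed.

Lemma diag_sum_iotaM_low n m (a : T n m) j : (0 < j)%N -> (j <= n)%N -> (j <= m)%N ->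
  diag_sum (iotaM a) (n - j) (m - j) = 0.
Proof.
move=> j0 jn jm; apply: diag_sum_vanish => i i1 i2.
by rewrite iotaM_off// gtn_eqF//; lia.
Qed.

Lemma diag_sum_iotaM n m (a : T n m) : diag_sum (iotaM a) n m = a.
Proof.
case: n m a => [|n] [|m] a; try by rewrite diag_sum0 ?iotaM_id ?min0n ?minn0.
rewrite diag_sumS iotaM_id.
have := @diag_sum_iotaM_low _ _ a 1%N isT isT isT; rewrite !subSS !subn0 => ->.
by rewrite tens0 addr0.
Qed.

Lemma diag_eval_iotaM n m (a : T n m) : diag_eval p n m (iotaM a) = p n m a.
Proof.
rewrite /diag_eval (bigD1 ord0)//= !subn0 iotaM_id big1 ?addr0// => j j0.
rewrite iotaM_off ?repr0//; apply/orP; left; rewrite gtn_eqF//.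
have := ltn_ord j; move: j0; rewrite -val_eqE /=; lia.
Qed.

Lemma iotaM_in n m (a : T n m) i j : K n m a -> K i j (iotaM a i j).
Proof.
have [_ K0 _ _ _] := hK.
move=> Ka; have [e|] := boolP ((n != i) || (m != j)); first by rewrite iotaM_off.
by rewrite negb_or !negbK => /andP[/eqP <- /eqP <-]; rewrite iotaM_id.
Qed.

Lemma Mset_iotaM n m (a : T n m) : K n m a -> Mset K n m (iotaM a).
Proof.
case: (hK) => _ K0 _ _ _ Ka.
have off i j : (n != i) || (m != j) -> iotaM a i j = 0 by exact: iotaM_off.
split; first split.
- by move=> i j; exact: iotaM_in.
- apply: (@sub_finite_set _ _ [set (n, m)]); last exact: finite_set1.
  move=> [i j] /= h; apply: contrapT => ne; move/eqP: h; apply; apply: off.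
  by apply: contra_notT ne; rewrite negb_or !negbK => /andP[/eqP <- /eqP <-].
- move=> i j h; have [e|] := boolP ((n != i) || (m != j)); first by rewrite off// eqxx in h.
  by rewrite negb_or !negbK => /andP[/eqP <- /eqP <-].
Qed.

(* Condition iii) unfolded to matrices: the zero-seminorm elements and the classes of
   reduction ideal elements are described by the diagonal sums. *)
Definition kernel_condition := forall n m x, Mset K n m x -> diag_eval p n m x = 0 ->
  (forall n' m' j, (0 < j)%N -> (n' + j)%N = n -> (m' + j)%N = m -> J n' m' (diag_sum x n' m'))
  /\ reduction_ideal J n m (diag_sum x n m).

(** Let D be the top diagonal sum of x. The matrix with the single entry D has the same top sum and
    zero lower sums, so it represents the class of x exactly when the lower sums of x lie in [J]. *)
Lemma ker_tilde_kernel_condition : ker_tilde_is_reduction K J p <-> kernel_condition.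
Proof.
split=> [h n m x Mx px|h n m].
  have : ker_tilde K J p n m (KJclass K J n m x).
    split; first by exists x.
    by rewrite (tilde_reprE K J hK hJ hJK).
  rewrite h => -[a ra e].
  have : KJclass K J n m x x.
    by split => //; exact: seminormJ_refl.
  rewrite -e => -[_ /seminormJ_iff []]; rewrite diag_sum_sub diag_sum_iotaM.
  move=> /eqP; rewrite subr_eq0 => /eqP <- low; split=> // n' m' j j0 en em.
  have := low _ _ _ j0 en em; rewrite diag_sum_sub.
  have -> : diag_sum (iotaM a) n' m' = 0.
    have -> : n' = (n - j)%N by lia.
    have -> : m' = (m - j)%N by lia.
    by apply: diag_sum_iotaM_low => //; lia.
  rewrite sub0r => Jd; rewrite -[diag_sum _ _ _]opprK -[- - _]sub0r.
  by case: (hJ) => _ J0 _ _ _; exact: (idealB hJ).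
apply/seteqP; split=> c.
  move=> [[x Mx <-]]; rewrite (tilde_reprE K J hK hJ hJK)// => /(h _ _ _ Mx) [low red].
  exists (diag_sum x n m) => //; rewrite /embKJ.
  have eqv y : seminormJ J n m (matrix_sub (iotaM (diag_sum x n m)) y) = 0 <->
      seminormJ J n m (matrix_sub x y) = 0.
    rewrite !seminormJ_iff !diag_sum_sub diag_sum_iotaM.
    split=> -[e1 e2]; split=> // n' m' j j0 en em; have Jx := low _ _ _ j0 en em;
      have := e2 _ _ _ j0 en em; rewrite !diag_sum_sub;
      have -> : diag_sum (iotaM (diag_sum x n m)) n' m' = 0.
    - have -> : n' = (n - j)%N by lia.
      have -> : m' = (m - j)%N by lia.
      by apply: diag_sum_iotaM_low => //; lia.
    - by rewrite sub0r => Jy; exact: (idealD hJ).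
    - have -> : n' = (n - j)%N by lia.
      have -> : m' = (m - j)%N by lia.
      by apply: diag_sum_iotaM_low => //; lia.
    - move=> Jxy; have := idealB hJ Jxy Jx.
      by rewrite addrAC subrr.
  by apply/seteqP; split=> y [My /eqv ?]; split.
move=> [a ra <-]; have [Ka pa] := reduction_ideal_ker ra.
have Ma := Mset_iotaM Ka; split; first by exists (iotaM a).
by rewrite (tilde_reprE K J hK hJ hJK)// diag_eval_iotaM.
Qed.

End Representations.

(** * Condition iv) and the kernel condition *)

Section KernelCondition.
Variables (R : realType) (T : rtcat R) (K J : morset T).
Arguments K : clear implicits.
Arguments J : clear implicits.
Hypotheses (hK : is_ideal K) (hJ : is_ideal J) (hJK : morset_sub J (Jideal K)).

Lemma diag_sum_eq (x y : matrices T) n m :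
  (forall j, (j <= n)%N -> (j <= m)%N -> x (n - j)%N (m - j)%N = y (n - j)%N (m - j)%N) ->
  diag_sum x n m = diag_sum y n m.
Proof.
move=> h; apply/eqP; rewrite -subr_eq0 -diag_sum_sub; apply/eqP.
by apply: diag_sum_vanish => j jn jm; rewrite /matrix_sub h// subrr.
Qed.

Lemma K_diag_sum (x : matrices T) n m : (forall i j, K i j (x i j)) ->
  (forall n' m' j, (0 < j)%N -> (n' + j)%N = n -> (m' + j)%N = m -> J n' m' (diag_sum x n' m')) ->
  K n m (diag_sum x n m).
Proof.
move=> Kx; case: n m => [|n] [|m] Jd; try by rewrite diag_sum0 ?min0n ?minn0.
rewrite diag_sumS; apply: (idealD hK) => //.
by have /hJK [] := Jd n m 1%N isT (addn1 n) (addn1 m).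
Qed.

Section Repr.
Variables (B : cstarAlg R) (p : mor_maps T B).
Arguments p : clear implicits.
Hypotheses (hp : is_rt_repr K p) (hcois : coisometric_on J p).

Lemma reprN n m (a : T n m) : K n m a -> p n m (- a) = - p n m a.
Proof.
by have [_ K0 _ _ _] := hK => Ka; rewrite -[- a]sub0r (reprB hp)// (repr0 hK hp) sub0r.
Qed.

Lemma repr_hcast n n' m m' (en : n = n') (em : m = m') (a : T n m) :
  p n' m' (hcast en em a) = p n m a.
Proof. by case: _ / en; case: _ / em. Qed.

Lemma repr_iotaM n m (a : T n m) i j : n = i -> m = j -> p i j (iotaM a i j) = p n m a.
Proof. by move=> <- <-; rewrite iotaM_id. Qed.

Lemma diag_eval_split (x : matrices T) n m i :
  diag_eval p (i + n) (i + m) x =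
  diag_eval p n m x + \sum_(1 <= j < i.+1) p (j + n)%N (j + m)%N (x (j + n)%N (j + m)%N).
Proof.
elim: i => [|i IH]; first by rewrite big_geq// addr0.
rewrite big_nat_recr//= addrA -IH addrC.
by rewrite {1}/diag_eval !addSn minnSS big_ord_recl.
Qed.

(** Entries off the diagonal through (n,m), or beyond (n,m) on it, affect neither the value nor the
    sums, so [x] can be truncated to an element of [Mset]. *)
Lemma kernel_condition_all : kernel_condition K J p ->
  forall n m x, (forall i j, K i j (x i j)) -> diag_eval p n m x = 0 ->
  (forall n' m' j, (0 < j)%N -> (n' + j)%N = n -> (m' + j)%N = m -> J n' m' (diag_sum x n' m'))
  /\ reduction_ideal J n m (diag_sum x n m).
Proof.
move=> h n m x Kx px; have [_ K0 _ _ _] := hK.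
pose y : matrices T := fun i j => if ((i + m == j + n) && (j <= m))%N then x i j else 0.
have yx n' m' j : (n' + j)%N = n -> (m' + j)%N = m -> diag_sum y n' m' = diag_sum x n' m'.
  move=> en em; apply: diag_sum_eq => i i1 i2; rewrite /y ifT//.
  by apply/andP; split; [apply/eqP|]; lia.
have My : Mset K n m y.
  split; first split.
  - by move=> i j; rewrite /y; case: ifP.
  - apply: (@sub_finite_set _ _ (`I_n.+1 `*` `I_m.+1)); last first.
      by apply: finite_setX; exact: finite_II.
    move=> [i j] /=; rewrite /y; case: ifP => [/andP[/eqP e1 e2] _|]; last by rewrite eqxx.
    by split => /=; lia.
  - move=> i j; rewrite /y; case: ifP => [/andP[/eqP e1 e2] _|]; last by rewrite eqxx.
    by split => //; lia.
have py : diag_eval p n m y = 0.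
  rewrite -px; apply: eq_bigr => j _; rewrite /y ifT//.
  by have := ltn_ord j; rewrite ltnS leq_min => /andP[? ?]; apply/andP; split; [apply/eqP|]; lia.
have [h1 h2] := h n m y My py; split.
  by move=> n' m' j j0 en em; rewrite -(yx _ _ _ en em); exact: h1 en em.
by rewrite -(yx n m 0%N) ?addn0.
Qed.

(** For a in J(n,n) coisometry provides the single term b_1 = a (x) 1. Conversely, put a at (n,n)
    and -b_j at (n + j, n + j): this matrix has value 0, and its diagonal sum at (n,n) is a, which
    therefore lies in [J]. *)
Lemma kernel_condition_preimage : kernel_condition K J p -> ker_and_preimage_condition K J p.
Proof.
move=> /kernel_condition_all h; have [_ K0 _ _ _] := hK.
split=> [n m|n k k0]; apply/seteqP; split=> a.
- move=> [Ka pa]; have [|_] := h n m (iotaM a) (fun i j => iotaM_in hK i j Ka).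
    by rewrite (diag_eval_iotaM hK hp).
  by rewrite diag_sum_iotaM.
- by move=> /(reduction_ideal_ker hK hJK hp hcois).
- move=> Ja; split; first exact: (J_sub_K hJK).
  exists (fun j => iotaM (tens a) (n + j)%N (n + j)%N); split.
    by move=> j _; apply: (iotaM_in hK); exact: (tens_J hJK).
  rewrite hcois// (@big_ltn _ _ _ 1 k.+1)// big_nat big1 ?addr0; last first.
    move=> j /andP[j1 j2]; rewrite iotaM_off ?(repr0 hK hp)//.
    by apply/orP; left; rewrite neq_ltn; apply/orP; left; lia.
  by rewrite repr_iotaM// addn1.
move=> [Ka [b [Kb pab]]].
pose y : matrices T := fun i j => \sum_(1 <= l < k.+1) iotaM (b l) i j.
have Ky i j : K i j (y i j).
  rewrite /y big_nat; elim/big_rec: _ => // l z lk Kz.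
  by apply: (idealD hK) => //; apply: (iotaM_in hK); apply: Kb.
have y0 i : (i <= n)%N -> y i i = 0.
  move=> i_n; rewrite /y big_nat big1// => l lk; rewrite iotaM_off//.
  by apply/orP; left; rewrite neq_ltn; apply/orP; right; lia.
have ey j : (1 <= j <= k)%N ->
    p (j + n)%N (j + n)%N (y (j + n)%N (j + n)%N) = p (n + j)%N (n + j)%N (b j).
  move=> jk; rewrite -(repr_iotaM (b j) (addnC n j) (addnC n j)).
  congr (p _ _ _); rewrite /y (bigD1_seq j)/= ?mem_index_iota ?iota_uniq//.
  rewrite big1 ?addr0// => l lj; rewrite iotaM_off//.
  by apply/orP; left; move: lj; apply: contra => /eqP e; apply/eqP; lia.
pose x := matrix_sub (iotaM a) y.
have Kx i j : K i j (x i j) by apply: (idealB hK) => //; exact: (iotaM_in hK).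
have px : diag_eval p (k + n) (k + n) x = 0.
  rewrite diag_eval_split.
  have -> : diag_eval p n n x = p n n a.
    rewrite -(diag_eval_iotaM hK hp); apply: eq_bigr => j _.
    by rewrite /x /matrix_sub y0 ?subr0// leq_subr.
  rewrite pab -big_split/= big_nat big1// => j jk.
  rewrite /x /matrix_sub (reprB hp)//; last exact: (iotaM_in hK).
  rewrite iotaM_off; last by apply/orP; left; rewrite neq_ltn; apply/orP; left; lia.
  by rewrite (repr0 hK hp) sub0r ey// subrr.
have [low _] := h _ _ x Kx px.
have := low n n k k0 (addnC _ _) (addnC _ _).
rewrite diag_sum_sub diag_sum_iotaM (diag_sum_vanish (x := y)) ?subr0//.
by move=> j _ _; rewrite y0// leq_subr.
Qed.

(** Strong induction along the diagonal. Once the earlier sums lie in [J], p(D) for the sum D at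
    (n',m') is minus the sum of the later terms. Multiplying by the adjoint of p(D) moves the
    relation to the main diagonal, where the preimage condition gives D* D in [J], hence D in
    [J]. *)
Lemma preimage_kernel_condition : ker_and_preimage_condition K J p -> kernel_condition K J p.
Proof.
move=> [hker hpre] n m x [[Kx _] _] px; have [_ K0 _ Kl Kr] := hK; have [_ ps pm] := hp.
have low : forall n' m' j, (0 < j)%N -> (n' + j)%N = n -> (m' + j)%N = m ->
    J n' m' (diag_sum x n' m').
  move=> n'; elim/ltn_ind: n' => n' IH m' i i0 en em.
  have low' n1 m1 j : (0 < j)%N -> (n1 + j)%N = n' -> (m1 + j)%N = m' ->
      J n1 m1 (diag_sum x n1 m1).
    by move=> j0 en' em'; apply: (IH n1 _ m1 (j + i)%N); lia.
  set D := diag_sum x n' m'.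
  have KD : K n' m' D by exact: K_diag_sum.
  have pD : p n' m' D = - \sum_(1 <= j < i.+1) p (j + n')%N (j + m')%N (x (j + n')%N (j + m')%N).
    apply/eqP; rewrite -addr_eq0 -(diag_evalE K J hJK B p x n' m' hp hcois Kx low').
    by rewrite -diag_eval_split -px addnC en addnC em.
  suff : J m' m' (ccomp (cadj D) D) by move=> /(ideal_adj_sqr hJ) [].
  rewrite (hpre m' i i0); split; first exact: Kr.
  pose c j := ccomp (tensk j (cadj D)) (x (j + n')%N (j + m')%N).
  exists (fun j => - hcast (addnC j m') (addnC j m') (c j)).
  have Kc j : K (j + m')%N (j + m')%N (c j) by apply: Kr.
  split=> [j _|]; first by rewrite -sub0r; apply: (idealB hK) => //; apply: morset_cast.
  rewrite -(repr_adj_mul hK hp KD KD) {2}pD cmulNr.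
  rewrite (big_morph _ (cmulDDr (cstar (p n' m' D))) (cmul0r _)) -sumrN.
  apply: eq_bigr => j _; rewrite reprN; last exact: morset_cast.
  by rewrite repr_hcast ps// pm//; exact: (ideal_adj hK).
split=> //; rewrite -hker; split; first exact: K_diag_sum.
by rewrite -(diag_evalE K J hJK B p x n m hp hcois Kx low).
Qed.

End Repr.
End KernelCondition.

Section StarHom.
Variables (R : realType) (A B : cstarAlg R) (f : A -> B).
Hypothesis hf : star_hom f.

Lemma hom_sum (I : Type) (r : seq I) (P : pred I) (F : I -> A) :
  f (\sum_(i <- r | P i) F i) = \sum_(i <- r | P i) f (F i).
Proof.
apply: (big_morph f) => [a b|]; first exact: (homD hf).
exact: (star_hom_on0 (setT_cstar_subalg A) hf).
Qed.

Lemma star_homB a b : f (a - b) = f a - f b.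
Proof. exact: (homB (setT_cstar_subalg A) hf). Qed.

Lemma star_homZ c a : f (c *: a) = c *: f a.
Proof. exact: (homZ (setT_cstar_subalg A) hf). Qed.

Lemma star_hom_contract a : rnorm (f a) <= rnorm a.
Proof. exact: (hom_contract (setT_cstar_subalg A) hf). Qed.

Lemma star_homM a b : f (cmul a b) = cmul (f a) (f b).
Proof. by case: hf => _ h _; exact: h. Qed.

Lemma star_hom_star a : f (cstar a) = cstar (f a).
Proof. by case: hf => _ _ h; exact: h. Qed.

Lemma faithful_on_ker (E : set A) : (forall a b, E a -> E b -> E (a - b)) ->
  (forall a, E a -> f a = 0 -> a = 0) -> faithful_on E f.
Proof.
move=> EB h a b Ea Eb e; apply/eqP; rewrite -subr_eq0; apply/eqP.
by apply: h; [exact: EB|rewrite star_homB e subrr].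
Qed.

End StarHom.

(** * Spectral subspaces of the universal algebra *)

Section Spectral.
Variables (R : realType) (T : rtcat R) (K J : morset T).
Arguments K : clear implicits.
Arguments J : clear implicits.
Hypotheses (hK : is_ideal K) (hJ : is_ideal J) (hJK : morset_sub J (Jideal K)).
Variables (O : cstarAlg R) (iota : mor_maps T O).
Arguments iota : clear implicits.
Hypothesis hO : is_universal_pair K J iota.

Lemma integrates_diag_eval (B : cstarAlg R) (p : mor_maps T B) (Psi : O -> B) x n m :
  integrates_to K iota p Psi -> (forall i j, K i j (x i j)) ->
  Psi (diag_eval iota n m x) = diag_eval p n m x.
Proof.
move=> [hPsi Pi] Kx; rewrite (hom_sum hPsi); apply: eq_bigr => j _; exact: Pi.
Qed.

(** The Fock representation factors through the universal pair, so a relation satisfied by [iota]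
    also holds in the Fock model. *)
Lemma universal_kernel_condition : kernel_condition K J iota.
Proof.
have [B [p [hp cois hfock]]] := fock_model hJ.
have [_ _ _ univ] := hO; have [Psi hPsi] := univ _ _ (hp K) cois.
move=> n m x [[Kx _] _] e.
have : diag_eval p n m x = 0.
  rewrite -(integrates_diag_eval _ _ hPsi Kx) e.
  by case: hPsi => h _; exact: (star_hom_on0 (setT_cstar_subalg O) h).
move=> /hfock [low core dec]; split=> //.
exact: (reduction_ideal_of_decay hJ).
Qed.

Let gP z : `|z| = 1 -> gauge_at K iota z (gauge K iota z).
Proof. by apply: (gaugeP K J) => // n m a /hJK []. Qed.

Lemma spectral_diag_eval x n m : (forall i j, K i j (x i j)) ->
  spectral_subspace K iota (n%:Z - m%:Z) (diag_eval iota n m x).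
Proof.
move=> Kx z z1; have [hg gi] := gP z1.
rewrite /diag_eval (hom_sum hg) scaler_sumr; apply: eq_bigr => j _.
rewrite gi//; congr (z ^ _ *: _); have := ltn_ord j; lia.
Qed.

Lemma spectral_subspaceB k a b : spectral_subspace K iota k a ->
  spectral_subspace K iota k b -> spectral_subspace K iota k (a - b).
Proof.
move=> ha hb z z1; have [hg _] := gP z1.
by rewrite (star_homB hg) ha// hb// scalerBr.
Qed.

Lemma spectral_subspace_sqr k a : spectral_subspace K iota k a ->
  spectral_subspace K iota 0 (cmul (cstar a) a).
Proof.
move=> ha z z1; have [hg _] := gP z1.
have z0 : z != 0 by rewrite -normr_gt0 z1.
rewrite (star_homM hg) (star_hom_star hg) ha// cstarZ cmulZ; congr (_ *: _).
rewrite rmorphXz ?unitfE//= -expfzMl.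
by rewrite -normCKC z1 expr1n exp1rz expr0z.
Qed.

(** If a has degree k and is killed, then a* a has degree 0 and is killed, so |a|^2 = |a* a| = 0. *)
Lemma faithful_0_spectral_all (B : cstarAlg R) (p : mor_maps T B) :
  faithful_on_0_spectral K iota p -> faithful_on_all_spectral K iota p.
Proof.
move=> [Psi [hPsi inj]]; have [hP _] := hPsi; exists Psi; split=> // k.
apply: (faithful_on_ker hP); first exact: spectral_subspaceB.
move=> a ha Pa; apply: rnorm_eq0; apply/eqP; rewrite -sqrf_eq0 -rnormC.
have P0 := star_hom_on0 (setT_cstar_subalg O) hP.
rewrite (inj (cmul (cstar a) a) 0) ?rnorm0//.
- exact: spectral_subspace_sqr ha.
- by move=> z z1; have [hg _] := gP z1; rewrite (star_hom_on0 (setT_cstar_subalg O) hg) scaler0.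
- by rewrite P0 (star_homM hP) Pa cmul0r.
Qed.

Lemma faithful_all_kernel_condition (B : cstarAlg R) (p : mor_maps T B) :
  faithful_on_all_spectral K iota p -> kernel_condition K J p.
Proof.
move=> [Psi [hPsi inj]] n m x Mx px; have [[Kx _] _] := Mx.
apply: universal_kernel_condition => //; have [hP _] := hPsi.
have P0 := star_hom_on0 (setT_cstar_subalg O) hP.
apply: (inj (n%:Z - m%:Z)).
- exact: spectral_diag_eval.
- by move=> z z1; have [hg _] := gP z1; rewrite (star_hom_on0 (setT_cstar_subalg O) hg) scaler0.
- by rewrite (integrates_diag_eval _ _ hPsi)// px P0.
Qed.

End Spectral.

(** * Elements of degree zero *)

HB.saturate prod.

Section ProductAlgebra.
Variable R : realType.

Section Complete.
Variables U V : completeNormedModType R[i].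

Lemma prod_cauchy_cvg (F : set_system (U * V)%type) : ProperFilter F -> cauchy F -> cvg F.
Proof.
move=> PF /cauchyP cF.
have c1 : cauchy (fst @ F).
  apply/cauchyP => e /cF [x Fx]; exists x.1.
  by apply: (@filterS _ F) Fx => y [].
have c2 : cauchy (snd @ F).
  apply/cauchyP => e /cF [x Fx]; exists x.2.
  by apply: (@filterS _ F) Fx => y [].
move/cauchy_cvg/cvg_ex: c1 => [l1 h1]; move/cauchy_cvg/cvg_ex: c2 => [l2 h2].
apply/cvg_ex; exists (l1, l2); apply/cvg_ballP => e e0.
move/cvg_ballP: h1 => /(_ e e0) h1; move/cvg_ballP: h2 => /(_ e e0) h2.
by near=> x; split => /=; near: x.
Unshelve. all: by end_near.
Qed.

HB.instance Definition _ := Uniform_isComplete.Build (U * V)%type prod_cauchy_cvg.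

Lemma rnorm_prod (x : U * V) : rnorm x = Num.max (rnorm x.1) (rnorm x.2).
Proof.
rewrite {1}/rnorm prod_normE !rnormE !maxEle lecR.
by case: ifP.
Qed.

End Complete.

Variables A B : cstarAlg R.

Definition prod_mul (x y : A * B) : A * B := (cmul x.1 y.1, cmul x.2 y.2).
Definition prod_star (x : A * B) : A * B := (cstar x.1, cstar x.2).

Lemma prod_norm_le (x : A * B) (M : R) : (rnorm x <= M) = (rnorm x.1 <= M) && (rnorm x.2 <= M).
Proof. by rewrite rnorm_prod ge_max. Qed.

Lemma prod_mulDl (c : R[i]) a b x : prod_mul (c *: a + b) x = c *: prod_mul a x + prod_mul b x.
Proof. by rewrite /prod_mul !cmulDl. Qed.

Lemma prod_mulDr (c : R[i]) x a b : prod_mul x (c *: a + b) = c *: prod_mul x a + prod_mul x b.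
Proof. by rewrite /prod_mul !cmulDr. Qed.

Lemma prod_mulA a b c : prod_mul a (prod_mul b c) = prod_mul (prod_mul a b) c.
Proof. by rewrite /prod_mul !cmulA. Qed.

Lemma prod_normM a b : `|prod_mul a b| <= `|a| * `|b|.
Proof.
rewrite !rnormE -rmorphM lecR prod_norm_le; apply/andP.
have ha := lexx (rnorm a); have hb := lexx (rnorm b).
move: ha hb; rewrite {1}prod_norm_le {1}(prod_norm_le b) => /andP[a1 a2] /andP[b1 b2].
by split; apply: le_trans (rnormM _ _) _; apply: ler_pM => //; exact: rnorm_ge0.
Qed.

Lemma prod_starD (c : R[i]) a b : prod_star (c *: a + b) = c^* *: prod_star a + prod_star b.
Proof. by rewrite /prod_star !cstarD. Qed.

Lemma prod_starK a : prod_star (prod_star a) = a.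
Proof. by case: a => a b; rewrite /prod_star !cstarK. Qed.

Lemma prod_starM a b : prod_star (prod_mul a b) = prod_mul (prod_star b) (prod_star a).
Proof. by rewrite /prod_star !cstarM. Qed.

Lemma prod_star_norm a : `|prod_mul (prod_star a) a| = `|a| ^+ 2.
Proof.
rewrite !rnormE -rmorphXn; congr (_%:C)%C; rewrite !rnorm_prod !rnormC.
have h1 := rnorm_ge0 _ a.1; have h2 := rnorm_ge0 _ a.2.
rewrite !maxEle ler_sqr ?nnegrE//.
by case: ifP.
Qed.

Definition prod_alg : cstarAlg R := CstarAlg prod_mulDl prod_mulDr prod_mulA prod_normM
  prod_starD prod_starK prod_starM prod_star_norm.

End ProductAlgebra.

Section DegreeZero.
Variables (R : realType) (T : rtcat R) (K J : morset T).
Arguments K : clear implicits.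
Arguments J : clear implicits.
Hypotheses (hK : is_ideal K) (hJ : is_ideal J) (hJK : morset_sub J (Jideal K)).

(* An element [(D_0, ..., D_r)] collects the diagonal sums of a degree 0 matrix: the
   entry at [(s, s)] is recovered as [D_s - D_{s-1} (x) 1], and the product of degree 0
   matrices becomes the componentwise product. *)
Fixpoint tower (r : nat) : cstarAlg R :=
  match r with
  | 0 => endo T 0
  | r'.+1 => prod_alg (tower r') (endo T r'.+1)
  end.

Definition tower_last (r : nat) : tower r -> T r r :=
  match r return tower r -> T r r with
  | 0 => fun x => x
  | r'.+1 => fun x => x.2
  end.
Arguments tower_last : clear implicits.

Definition tower_top (r : nat) (x : tower r.+1) : T r.+1 r.+1 :=
  x.2 - tens (tower_last r x.1).
Arguments tower_top : clear implicits.

(** [K] is imposed on the recovered entries and not on the diagonal sums, which may leave [K] since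
    it need not be stable under tensoring. *)
Fixpoint tower_sub (r : nat) : set (tower r) :=
  match r return set (tower r) with
  | 0 => (K 0%N 0%N : set (endo T 0))
  | r'.+1 => fun x => tower_sub x.1 /\ K r'.+1 r'.+1 (tower_top r' x)
  end.
Arguments tower_sub : clear implicits.

Lemma tower_last_hom r : @star_hom R (tower r) (endo T r) (tower_last r).
Proof. by case: r => [|r]; split. Qed.

Lemma tower_last_norm r x : rnorm (tower_last r x) <= rnorm x.
Proof. by have := @star_hom_contract _ _ _ _ (tower_last_hom r) x. Qed.

Lemma tower_top_lin r c a b : tower_top r (c *: a + b) = c *: tower_top r a + tower_top r b.
Proof.
rewrite /tower_top; have [h _ _] := tower_last_hom r.
rewrite [tower_last _ _]h// tensD scalerBr addrACA -opprD.
reflexivity.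
Qed.

(** Every term contains a recovered entry of a or b, so the entries of a product stay in [K]
    although the tensored sums may not. *)
Lemma tower_topM r a b : tower_top r (cmul a b) =
  ccomp (tens (tower_last r a.1)) (tower_top r b) + ccomp (tower_top r a) (tens (tower_last r b.1))
  + ccomp (tower_top r a) (tower_top r b).
Proof.
rewrite /tower_top [tower_last _ _](star_homM (tower_last_hom r)) tensM.
rewrite !ccompBr !ccompBl -/(cmul _ _) /=; set x := ccomp a.2 b.2.
set y := ccomp a.2 (tens _); set z := ccomp (tens _) b.2; set w := ccomp _ _.
have -> : (z - w + (y - w) + (x - z - (y - w)) : T r.+1 r.+1) = x - w; last by [].
by rewrite addrACA subrr addr0 addrC addrA subrK.
Qed.

Lemma tower_top_star r a : tower_top r (cstar a) = cadj (tower_top r a).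
Proof.
by rewrite /tower_top [tower_last _ _](star_hom_star (tower_last_hom r)) tens_adj -cadjB.
Qed.

Lemma tower_sub_subalg r : is_cstar_subalg (tower_sub r).
Proof.
have [Kc K0 KD Kl Kr] := hK.
elim: r => [|r [c h0 hD hM hs]]; first exact: ideal_subalg.
split.
- apply: closedP => x h; split.
    apply: (closed_approx c) => e /h [y [hy _] xy]; exists y.1 => //.
    by move: xy; rewrite prod_norm_le => /andP[].
  apply: (closed_approx (Kc _ _)) => e e0; have e2 : 0 < e / 2 by lra.
  have [y [_ hy]] := h _ e2; rewrite prod_norm_le => /andP[x1 x2].
  exists (tower_top r y) => //.
  have -> : tower_top r x - tower_top r y = (x - y).2 - tens (tower_last r (x - y).1).
    rewrite /tower_top [tower_last _ (x - y).1](star_homB (tower_last_hom r)).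
    have tB (u v : T r r) : tens (u - v) = tens u - tens v := tenskB 1 u v.
    by rewrite tB [- (y.2 - _)]opprD addrACA -opprD.
  apply: le_trans (rnormB _ _) _; have h1 := tensk_norm 1 (tower_last r (x - y).1).
  have h2 := @tower_last_norm r (x - y).1; apply: (@le_trans _ _ (e / 2 + e / 2)); [apply: lerD => //; apply: le_trans h1 _; exact: le_trans h2 x1|lra].
- split; first exact: h0.
  by have := @tower_top_lin r (-1) 0 0; rewrite scaler0 addr0 scaleN1r addNr => ->; exact: K0.
- move=> c' a b [a1 a2] [b1 b2]; split; first exact: hD.
  by rewrite tower_top_lin; apply: KD.
- move=> a b [a1 a2] [b1 b2]; split; first exact: hM.
  rewrite tower_topM; apply: (idealD hK); last exact: Kl.
  by apply: (idealD hK); [exact: Kr|exact: Kl].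
- move=> a [a1 a2]; split; first exact: hs.
  by rewrite tower_top_star; apply: (ideal_adj hK).
Qed.

Section TowerEval.
Variables (B : cstarAlg R) (p : mor_maps T B).
Arguments p : clear implicits.
Hypotheses (hp : is_rt_repr K p) (hcois : coisometric_on J p).

Fixpoint tower_eval (r : nat) : tower r -> B :=
  match r return tower r -> B with
  | 0 => p 0%N 0%N
  | r'.+1 => fun x => tower_eval x.1 + p r'.+1 r'.+1 (tower_top r' x)
  end.
Arguments tower_eval : clear implicits.

Lemma repr_mul_hcast k n l q (a : T n n) (b : T q l) (e : (k + n)%N = q) :
  K n n a -> K q l b -> cmul (p n n a) (p q l b) = p q l (ccomp (hcast e e (tensk k a)) b).
Proof.
by case: (hp) => _ _ pm Ka; case: _ / e b => b Kb; rewrite pm.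
Qed.

(** Against a morphism starting at q >= r, every entry of the tower is tensored up to level q, and
    the differences D_s - D_{s-1} (x) 1 telescope to the last diagonal sum. *)
Lemma tower_eval_mul_repr r k q l (x : tower r) (b : T q l) (e : (k + r)%N = q) :
  tower_sub r x -> K q l b ->
  cmul (tower_eval r x) (p q l b) = p q l (ccomp (hcast e e (tensk k (tower_last r x))) b).
Proof.
have [_ _ _ _ Kr] := hK.
elim: r k x e => [|r IH] k x e; first by move=> Kx Kb; rewrite (repr_mul_hcast e).
move=> [x1 x2] Kb; rewrite /= cmulDDl (repr_mul_hcast e)//.
have e' : (k.+1 + r)%N = q by rewrite addSnnS.
rewrite (IH k.+1 x.1 e')// -(reprD hp); try exact: Kr.
rewrite -ccompDDl; congr (p q l (ccomp _ b)).
rewrite /tower_top tenskB; set y := tower_last r x.1.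
have -> : hcast e' e' (tensk k.+1 y) = hcast e e (tensk k (tens y)).
  rewrite tensk_tens'; move: (esym (esym _)) => f.
  by case: _ / e e' f {b Kb IH} => e' f; rewrite hcast_id (eq_irrelevance f e').
have hB (u v : T (k + r.+1)%N (k + r.+1)%N) : hcast e e (u - v) = hcast e e u - hcast e e v.
  by case: _ / e {b Kb IH e'}.
by rewrite hB addrC subrK.
Qed.

Lemma tower_eval_hom r : star_hom_on (tower_sub r) (tower_eval r).
Proof.
elim: r => [|r [hl hM hs]]; first exact: repr_star_hom.
have [_ _ _ Kl Kr] := hK.
split.
- move=> c a b [a1 a2] [b1 b2] /=; rewrite hl// tower_top_lin.
  case: (hp) => pl _ _; rewrite pl// scalerDr addrACA.
  reflexivity.
- move=> a b [a1 a2] [b1 b2] /=.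
  have Ka (d : tower r) (u : T r.+1 r.+1) : tower_sub r d -> K r.+1 r.+1 u ->
      cmul (tower_eval r d) (p r.+1 r.+1 u) = p r.+1 r.+1 (ccomp (tens (tower_last r d)) u).
    by move=> hd Kb; rewrite (@tower_eval_mul_repr _ 1 _ _ _ _ erefl).
  rewrite hM// tower_topM cmulDDl !cmulDDr Ka//.
  (* The opposite order of the factors follows from the previous computation by taking adjoints. *)
  have -> : cmul (p r.+1 r.+1 (tower_top r a)) (tower_eval r b.1) =
      p r.+1 r.+1 (ccomp (tower_top r a) (tens (tower_last r b.1))).
    have [_ _ _ _ Ss] := tower_sub_subalg r.
    have Kt := ideal_adj hK a2.
    case: (hp) => _ ps _.
    rewrite -[LHS]cstarK cstarM -hs// ps// Ka//; last exact: Ss.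
    rewrite ps; last exact: Kr.
    by rewrite cadjM cadjK -tens_adj [tower_last _ _](star_hom_star (tower_last_hom r)) cadjK.
  case: (repr_star_hom hp r.+1) => _ pM _.
  rewrite -(pM _ _ a2 b2)//.
  rewrite (reprD hp); [|apply: (idealD hK)|]; [|exact: Kr|exact: Kl|exact: Kl].
  rewrite (reprD hp); [|exact: Kr|exact: Kl].
  by rewrite pM// !addrA.
- move=> a [a1 a2] /=; rewrite hs// tower_top_star cstarDD.
  by case: (hp) => _ ps _; rewrite ps.
Qed.

End TowerEval.

End DegreeZero.

Section DegreeZeroIsometry.
Variables (R : realType) (T : rtcat R) (K J : morset T).
Arguments K : clear implicits.
Arguments J : clear implicits.
Hypotheses (hK : is_ideal K) (hJ : is_ideal J) (hJK : morset_sub J (Jideal K)).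

Fixpoint tower_mx (r : nat) : tower T r -> matrices T :=
  match r return tower T r -> matrices T with
  | 0 => fun x => iotaM (x : T 0%N 0%N)
  | r'.+1 => fun x i j => tower_mx x.1 i j + iotaM (tower_top x) i j
  end.

Lemma tower_mx_high r (x : tower T r) i j : (r < i)%N -> tower_mx x i j = 0.
Proof.
elim: r x => [|r IH] x ri /=; first by rewrite iotaM_off// neq_ltn ri.
by rewrite IH ?(ltnW ri)// iotaM_off ?addr0// neq_ltn ri.
Qed.

Lemma tower_mx_in r (x : tower T r) i j : tower_sub K x -> K i j (tower_mx x i j).
Proof.
elim: r x => [|r IH] x /=; first exact: iotaM_in.
by move=> [x1 x2]; apply: (idealD hK); [exact: IH|exact: iotaM_in].
Qed.

Lemma tower_mx_low r (x : tower T r.+1) i : (i <= r)%N ->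
  tower_mx x i i = tower_mx x.1 i i.
Proof. by move=> ir; rewrite /= (@iotaM_off _ _ r.+1) ?addr0// neq_ltn orbC ltnS ir. Qed.

Lemma diag_eval_tower_mx (B : cstarAlg R) (p : mor_maps T B) r (x : tower T r) :
  is_rt_repr K p -> diag_eval p r r (tower_mx x) = tower_eval p x.
Proof.
move=> hp; elim: r x => [|r IH] x.
  by rewrite /diag_eval big_ord1 /= iotaM_id.
rewrite /diag_eval minnSS big_ord_recl subn0 [tower_mx x _ _]/= tower_mx_high// add0r iotaM_id addrC [RHS]/=.
congr (_ + _); rewrite -IH; apply: eq_bigr => j _.
have -> : (r.+1 - lift ord0 j = r - j)%N by rewrite lift0 subSS.
by rewrite (tower_mx_low x) ?leq_subr.
Qed.

Fixpoint tower_of (b : forall j, T j j) (r : nat) : tower T r :=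
  match r return tower T r with
  | 0 => b 0%N
  | r'.+1 => (tower_of b r', b r'.+1 + tens (tower_last (tower_of b r')))
  end.

Lemma tower_top_of b r : tower_top (tower_of b r.+1) = b r.+1.
Proof. by rewrite /tower_top /= addrK. Qed.

Lemma tower_of_sub b r : (forall j, K j j (b j)) -> tower_sub K (tower_of b r).
Proof.
by move=> Kb; elim: r => [|r IH]; [exact: Kb|split=> //; rewrite tower_top_of].
Qed.

Lemma tower_eval_of (B : cstarAlg R) (p : mor_maps T B) b r :
  tower_eval p (tower_of b r) = \sum_(j < r.+1) @p j j (b j).
Proof.
elim: r => [|r IH]; first by rewrite big_ord1.
by rewrite big_ord_recr -IH /= -[in RHS](tower_top_of b r).
Qed.

Variables (O B : cstarAlg R) (iota : mor_maps T O) (p : mor_maps T B).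
Arguments iota : clear implicits.
Arguments p : clear implicits.
Hypotheses (hi : is_rt_repr K iota) (ci : coisometric_on J iota).
Hypotheses (hp : is_rt_repr K p) (hcois : coisometric_on J p).

(* Elements of the kernel of [tower_eval p] are killed by [iota], and they approximate
   the distance to that kernel. *)
Lemma degree_zero_norm_le b r : kernel_condition K J p -> (forall j, K j j (b j)) ->
  rnorm (\sum_(j < r.+1) iota j j (b j)) <= rnorm (\sum_(j < r.+1) p j j (b j)).
Proof.
move=> hker Kb; rewrite -(tower_eval_of iota) -(tower_eval_of p); set x := tower_of b r.
have Sx : tower_sub K x by exact: tower_of_sub.
have hP := tower_eval_hom hK hp r; have hI := tower_eval_hom hK hi r.
have hS := tower_sub_subalg hK r.
have ker u : tower_sub K u -> tower_eval p u = 0 -> tower_eval iota u = 0.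
  move=> Su; rewrite -!diag_eval_tower_mx// => pu.
  have Kx i j : K i j (tower_mx u i j) by exact: tower_mx_in.
  have [low red] := kernel_condition_all hK hker Kx pu.
  rewrite (diag_evalE K J hJK _ iota _ _ _ hi ci Kx low).
  by have [] := reduction_ideal_ker hK hJK hi ci red.
rewrite -ler_sqr ?nnegrE ?rnorm_ge0//; apply/ler_addgt0Pr => e e0.
have [u [Su pu xu]] := hom_dist_kernel hS hP Sx e0.
apply: le_trans xu; rewrite ler_sqr ?nnegrE ?rnorm_ge0//.
have [_ _ _ SM _] := hS; have [_ hIM _] := hI.
have Sxu : tower_sub K (cmul x u) by exact: SM.
have -> : tower_eval iota x = tower_eval iota (x - cmul x u).
  by rewrite (homB hS hI)// hIM// (ker _ u)// cmul0r subr0.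
by apply: (hom_contract hS hI); apply: (csubB hS).
Qed.

End DegreeZeroIsometry.

(** * Graded elements and gauge actions *)

Section Averaging.
Variable R : realType.

Lemma root_of_minus1 s : exists2 z : R[i], `|z| = 1 & z ^+ (2 ^ s) = -1.
Proof.
elim: s => [|s [z z1 zs]]; first by exists (-1); rewrite ?normrN1.
exists (sqrtC z); last by rewrite expnS exprM sqrtCK.
by apply/eqP; rewrite -sqrp_eq1// -normrX sqrtCK z1.
Qed.

Lemma norm1_exprz (z : R[i]) (k : int) : `|z| = 1 -> complex.Re `|z ^ k| = 1.
Proof.
by move=> z1; case: k => n; rewrite ?NegzE -?exprnN ?normfV normrX z1 expr1n ?invr1.
Qed.

Lemma dyadic_exprz (z : R[i]) s (m : int) : z ^+ (2 ^ s) = -1 -> (((2 ^ s)%N : int) %| m)%Z ->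
  z ^ m = if (((2 ^ s.+1)%N : int) %| m)%Z then 1 else -1.
Proof.
move=> zs /dvdzP [q ->]; rewrite mulrC -exprz_exp -exprnP zs.
have -> : (((2 ^ s.+1)%N : int) %| (2 ^ s)%N%:Z * q)%Z = ~~ odd `|q|%N.
  by rewrite dvdzE abszM /= expnS mulnC dvdn_pmul2l ?expn_gt0// dvdn2.
have e n : (-1 : R[i]) ^+ n = if ~~ odd n then 1 else -1.
  by rewrite -signr_odd; case: odd.
case: q => n; first exact: e.
by rewrite -[LHS]/(((-1) ^+ n.+1)^-1) e /=; case: ifP; rewrite ?invr1 ?invrN1.
Qed.

Variables (C : cstarAlg R) (S : set C) (g : R[i] -> C -> C).
Hypotheses (hS : is_cstar_subalg S)
  (ghom : forall z, `|z| = 1 -> star_hom_on S (g z)).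
Variable (y : int -> C).
Hypotheses (Sy : forall l, S (y l))
  (gy : forall z l, `|z| = 1 -> g z (y l) = z ^ l *: y l).

Lemma sub_sum (r : seq int) (P : pred int) : S (\sum_(l <- r | P l) y l).
Proof.
have [_ S0 _ _ _] := hS.
by elim/big_rec: _ => // l x _ Sx; exact: (csubD hS).
Qed.

(** With z^(2^s) = -1, the mean of Y and z^(-k) g_z(Y) keeps the degrees congruent to k modulo
    2^(s+1) and cancels the others in Y. Both terms have norm at most |Y|. *)
Lemma sum_dyadic_norm_le (r : seq int) k s :
  rnorm (\sum_(l <- r | (((2 ^ s)%N : int) %| (l - k))%Z) y l) <= rnorm (\sum_(l <- r) y l).
Proof.
elim: s => [|s IH]; first by under eq_bigl do rewrite dvd1z.
apply: le_trans IH; set Y := \sum_(l <- r | (((2 ^ s)%N : int) %| (l - k))%Z) y l.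
have [z z1 zs] := root_of_minus1 s.
have SY : S Y by exact: sub_sum.
have z0 : z != 0 by rewrite -normr_gt0 z1.
have gY : g z Y = \sum_(l <- r | (((2 ^ s)%N : int) %| (l - k))%Z) z ^ l *: y l.
  rewrite /Y; elim: (r) => [|a t IHt].
    by rewrite !big_nil; exact: (star_hom_on0 hS (ghom z1)).
  rewrite !big_cons; case: ifP => _; last exact: IHt.
  by rewrite (homD (ghom z1)) ?IHt ?gy//; exact: sub_sum.
have -> : \sum_(l <- r | (((2 ^ s.+1)%N : int) %| (l - k))%Z) y l =
    2^-1 *: (Y + z ^ (- k) *: g z Y).
  rewrite gY scaler_sumr /Y -big_split scaler_sumr /=.
  rewrite [LHS]big_mkcond [RHS]big_mkcond; apply: eq_bigr => l _.
  have ds : (((2 ^ s.+1)%N : int) %| l - k)%Z -> (((2 ^ s)%N : int) %| l - k)%Z.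
    by rewrite !dvdzE /=; apply: dvdn_trans; rewrite expnS dvdn_mull.
  case: ifP => h1; [have h2 := ds h1|case: ifP => // h2]; rewrite ?h2 scalerA -expfzDr//
    addrC [- k + l]addrC (dyadic_exprz zs)// h1.
    by rewrite -[X in _ + X]scale1r -scalerDl scalerA mulVf ?scale1r// pnatr_eq0.
  by rewrite scaleN1r addNr scaler0.
rewrite rnormZ.
have -> : complex.Re `|2^-1 : R[i]| = 2^-1.
  have e2 : (2^-1 : R[i]) = ((2^-1 : R)%:C)%C by rewrite fmorphV rmorph_nat.
  by rewrite e2 normc_def /= expr0n addr0 sqrtr_sqr ger0_norm ?invr_ge0.
rewrite ler_pdivrMl// mulrDl mul1r; apply: le_trans (rnormD _ _) _; apply: lerD => //.
rewrite rnormZ norm1_exprz// mul1r; exact: (hom_contract hS (ghom z1)).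
Qed.

(** As soon as 2^s exceeds every |l - k|, the degree k is alone in its residue class. *)
Lemma graded_part_norm_le (r : seq int) k : uniq r -> k \in r -> rnorm (y k) <= rnorm (\sum_(l <- r) y l).
Proof.
move=> ur kr.
have [s hs] : exists s, forall l, l \in r -> (`|l - k| < 2 ^ s)%N.
  elim: (r) => [|a t [s hs]]; first by exists 0%N.
  exists (s + `|a - k|)%N => l; rewrite inE => /orP[/eqP ->|/hs h].
    apply: leq_trans (ltn_expl _ (isT : 1 < 2)%N) _; rewrite leq_exp2l//; lia.
  by apply: leq_trans h _; rewrite leq_exp2l//; lia.
apply: le_trans (sum_dyadic_norm_le r k s).
rewrite [X in _ <= rnorm X]big_mkcond (bigD1_seq k)//= subrr dvdz0 big_seq_cond big1 ?addr0// => l.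
move=> /andP[lr lk]; case: ifP => // /dvdzP [q e]; exfalso; have := hs _ lr.
rewrite e abszM /=; have : q != 0 by apply: contra lk => /eqP q0; rewrite -subr_eq0 e q0 mul0r.
by rewrite -absz_gt0 => q0; rewrite ltnNge leq_pmull.
Qed.

End Averaging.

Section GradedSpan.
Variables (R : realType) (T : rtcat R) (K : morset T).
Arguments K : clear implicits.
Hypothesis hK : is_ideal K.
Variables (C : cstarAlg R) (q : mor_maps T C).
Arguments q : clear implicits.
Hypothesis hq : is_rt_repr K q.

(** The linear span of the generators of degree in [P]; scalars are absorbed into the generators, as
    [gspanZ] shows. *)
Inductive gspan (P : set int) : C -> Prop :=
| gspan0 : gspan P 0
| gspan_cons n m (a : T n m) x : K n m a -> P (n%:Z - m%:Z) -> gspan P x ->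
    gspan P (q n m a + x).

Lemma gspan_gen (P : set int) n m (a : T n m) : K n m a -> P (n%:Z - m%:Z) -> gspan P (q n m a).
Proof. by move=> Ka Pa; rewrite -[q n m a]addr0; apply: gspan_cons => //; exact: gspan0. Qed.

Lemma gspanS (P Q : set int) x : P `<=` Q -> gspan P x -> gspan Q x.
Proof.
move=> PQ; elim=> [|n m a y Ka Pa _ IH]; first exact: gspan0.
by apply: gspan_cons => //; exact: PQ.
Qed.

Lemma gspanD P x y : gspan P x -> gspan P y -> gspan P (x + y).
Proof.
move=> hx hy; elim: hx => [|n m a u Ka Pa _ IH]; first by rewrite add0r.
by rewrite -addrA; exact: gspan_cons.
Qed.

Lemma gspanZ P (c : R[i]) x : gspan P x -> gspan P (c *: x).
Proof.
have [_ K0 KD _ _] := hK.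
elim=> [|n m a u Ka Pa _ IH]; first by rewrite scaler0; exact: gspan0.
rewrite scalerDr -(reprZ hK hq)//; apply: gspan_cons => //.
by rewrite -[c *: a]addr0; apply: KD.
Qed.

Lemma gspan_star (P Q : set int) x : (forall k, P k -> Q (- k)) -> gspan P x -> gspan Q (cstar x).
Proof.
move=> PQ; elim=> [|n m a u Ka Pa _ IH]; first by rewrite cstar0; exact: gspan0.
case: (hq) => _ qs _; rewrite cstarDD qs//; apply: gspan_cons => //.
  exact: (ideal_adj hK).
by have := PQ _ Pa; rewrite opprB.
Qed.

(** The defining relation of a representation covers only m <= n'; the case n' < m is its
    adjoint. *)
Lemma repr_mul_gen n m n' m' (a : T n m) (b : T n' m') : K n m a -> K n' m' b ->
  exists i j (c : T i j), [/\ K i j c, cmul (q n m a) (q n' m' b) = q i j c &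
    i%:Z - j%:Z = (n%:Z - m%:Z) + (n'%:Z - m'%:Z)].
Proof.
have [_ _ _ Kl Kr] := hK; case: (hq) => _ qs qm.
have aux n1 m1 k l (a1 : T n1 m1) (b1 : T (k + m1)%N l) : K n1 m1 a1 -> K (k + m1)%N l b1 ->
    exists i j (c : T i j), [/\ K i j c, cmul (q n1 m1 a1) (q (k + m1)%N l b1) = q i j c &
      i%:Z - j%:Z = (n1%:Z - m1%:Z) + ((k + m1)%N%:Z - l%:Z)].
  move=> Ka Kb; exists (k + n1)%N, l, (ccomp (tensk k a1) b1); split; [exact: Kr|exact: qm|lia].
move=> Ka Kb; have [mn|nm] := leqP m n'.
  by move: b Kb; rewrite -(subnK mn) => b Kb; exact: aux.
have [k e] : exists k, m = (k + n')%N by exists (m - n')%N; rewrite subnK// ltnW.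
subst m; have Kas := ideal_adj hK Ka; have Kbs := ideal_adj hK Kb.
have [i [j [c [Kc e d]]]] := aux _ _ _ _ _ _ Kbs Kas.
exists j, i, (cadj c); split; [exact: (ideal_adj hK)| |by move: d; clear; lia].
by rewrite -(qs _ _ c)// -e cstarM !qs ?cadjK.
Qed.

Lemma gspanM (P Q S : set int) x y : (forall k l, P k -> Q l -> S (k + l)) ->
  gspan P x -> gspan Q y -> gspan S (cmul x y).
Proof.
move=> PQS hx hy; elim: hx => [|n m a u Ka Pa _ IH]; first by rewrite cmul0l; exact: gspan0.
rewrite cmulDDl; apply: gspanD => // {IH}.
elim: hy => [|n' m' b v Kb Qb _ IH]; first by rewrite cmul0r; exact: gspan0.
rewrite cmulDDr; apply: gspanD => // {IH}.
have [i [j [c [Kc -> d]]]] := repr_mul_gen Ka Kb.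
by apply: gspan_gen => //; rewrite d; exact: PQS.
Qed.

Lemma gspan_bounded x : gspan setT x -> exists d : nat, gspan [set k | (`|k| <= d)%N] x.
Proof.
elim=> [|n m a u Ka _ _ [d hd]]; first by exists 0%N; exact: gspan0.
exists (d + `|n%:Z - m%:Z|)%N; apply: gspan_cons => //=; first exact: leq_addl.
by apply: gspanS hd => k /= kd; apply: leq_trans kd (leq_addr _ _).
Qed.

Lemma gspan_graded (P : set int) (r : seq int) x : uniq r -> (forall k, P k -> k \in r) ->
  gspan P x -> exists2 y : int -> C, forall l, gspan [set l] (y l) & x = \sum_(l <- r) y l.
Proof.
move=> ur Pr; elim=> [|n m a u Ka Pa _ [y hy ->]].
  by exists (fun _ => 0); [move=> l; exact: gspan0|rewrite big1].
exists (fun l => (if l == n%:Z - m%:Z then q n m a else 0) + y l).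
  by move=> l; case: eqP => [->|_]; [exact: gspan_cons|rewrite add0r].
rewrite big_split /=; congr (_ + _).
rewrite (bigD1_seq (n%:Z - m%:Z) (Pr _ Pa) ur) /= ifT// big1 ?addr0// => l.
by move=> /negbTE ->.
Qed.

(** The expansion is claimed for all large r, so that another diagonal entry of arbitrary index can
    be added in the induction. *)
Lemma gspan_deg0 x : gspan [set 0] x -> exists (b : forall j, T j j) (r0 : nat),
  (forall j, K j j (b j)) /\ forall r, (r0 <= r)%N -> x = \sum_(j < r.+1) q j j (b j).
Proof.
have [_ K0 _ _ _] := hK.
elim=> [|n m a u Ka]; first exists (fun _ => 0), 0%N.
  by apply: conj => [//|r _]; rewrite big1// => j _; exact: (repr0 hK hq).
move=> /= /eqP; rewrite subr_eq0 => /eqP [e]; case: _ / e a Ka => a Ka _ [b [r0 [Kb hb]]].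
exists (fun j => iotaM a j j + b j), (r0 + n)%N; split.
  by move=> j; apply: (idealD hK) => //; exact: iotaM_in.
move=> r hr; rewrite (eq_bigr (fun j : 'I_r.+1 => q j j (iotaM a j j) + q j j (b j))); last first.
  by move=> j _; rewrite (reprD hq)//; exact: iotaM_in.
rewrite big_split /= -hb; last by lia.
congr (_ + _); have nr : (n < r.+1)%N by lia.
rewrite (bigD1 (Ordinal nr))//= iotaM_id big1 ?addr0// => j jn.
rewrite iotaM_off ?(repr0 hK hq)// orbb eq_sym.
by move: jn; apply: contra => /eqP e; apply/eqP/val_inj.
Qed.

Lemma Cstar_of_gspan x : Cstar_of K q x -> approx_closure (gspan setT) x.
Proof.
apply; split; last first.
  move=> _ [n [m [a [Ka ->]]]]; apply: sub_approx_closure; exact: gspan_gen.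
apply: approx_closure_subalg.
- exact: gspan0.
- by move=> c a b ha hb; apply: gspanD => //; exact: gspanZ.
- by move=> a b; exact: gspanM.
- by move=> a; exact: gspan_star.
Qed.

Lemma gspan_Cstar_of P x : gspan P x -> Cstar_of K q x.
Proof.
move=> hx S [[_ S0 SD _ _] gS]; elim: hx => [//|n m a u Ka _ _ Su].
by rewrite -[q n m a]scale1r; apply: SD => //; apply: gS; exists n, m, a.
Qed.

Definition degrees (d : nat) : seq int := [seq i%:Z - d%:Z | i <- iota 0 (d + d).+1].

Lemma degrees_uniq d : uniq (degrees d).
Proof. by rewrite map_inj_uniq ?iota_uniq// => i j; lia. Qed.

Lemma mem_degrees d (k : int) : (`|k| <= d)%N -> k \in degrees d.
Proof.
move=> kd; apply/mapP; exists (absz (k + d%:Z)%R); last by lia.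
by rewrite mem_iota; lia.
Qed.

End GradedSpan.

(** * Ranges of injective homomorphisms and removal of a linear constant *)

Section CstarGenerated.
Variables (R : realType) (A : cstarAlg R).

Lemma cstar_generated_subalg (G : set A) : is_cstar_subalg (cstar_generated G).
Proof.
split.
- apply: closedP => x h S [hS GS]; have [c _ _ _ _] := hS.
  by apply: (closed_approx c) => e /h [y hy xy]; exists y => //; exact: hy.
- by move=> S [[]].
- by move=> c a b ha hb S [hS GS]; have [_ _ h _ _] := hS; apply: h; [exact: ha|exact: hb].
- by move=> a b ha hb S [hS GS]; have [_ _ _ h _] := hS; apply: h; [exact: ha|exact: hb].
- by move=> a ha S [hS GS]; have [_ _ _ _ h] := hS; apply: h; exact: ha.
Qed.

(** An injective homomorphism is isometric, so a limit of images is the image of the limit of a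
    Cauchy sequence. *)
Lemma inj_range_subalg (B : cstarAlg R) (f : A -> B) : star_hom f -> injective f ->
  is_cstar_subalg (range f).
Proof.
move=> hf finj; have hT := setT_cstar_subalg A.
have iso a : rnorm (f a) = rnorm a.
  apply: (hom_inj_isometric hT hf) => // b _ fb; apply: finj.
  by rewrite fb (star_hom_on0 hT hf).
split.
- apply: closedP => x h.
  have /choice [a ha] : forall n, exists a, rnorm (x - f a) <= rate R n.
    by move=> n; have [_ [a _ <-] xa] := h _ (rate_gt0 R n); exists a.
  have [|l hl] := @cauchy_limit R A a.
    move=> e e0; have [|n0 hn] := @rate_small R (e / 2); first lra.
    exists n0 => n m /hn h1 /hn h2; rewrite -iso (star_homB hf).
    have := rnorm_tri x (f (a n)) (f (a m)); rewrite (rnormBC (f (a n)) x).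
    by have := ha n; have := ha m; lra.
  exists l => //; apply/esym/eqP; rewrite -subr_eq0; apply/eqP/rnorm_eps => e e0.
  have [|n0 hn] := @rate_small R (e / 2); first lra.
  have [|n1 hn1] := hl (e / 2); first lra.
  have h1 := hn (maxn n0 n1) (leq_maxl _ _); have := hn1 (maxn n0 n1) (leq_maxr _ _).
  rewrite -iso (star_homB hf); have := ha (maxn n0 n1).
  have := rnorm_tri (f (a (maxn n0 n1))) x (f l); lra.
- by exists 0; rewrite ?(star_hom_on0 hT hf).
- move=> c _ _ [a _ <-] [b _ <-]; exists (c *: a + b) => //.
  by case: hf => h _ _; exact: h.
- by move=> _ _ [a _ <-] [b _ <-]; exists (cmul a b) => //; rewrite (star_homM hf).
- by move=> _ [a _ <-]; exists (cstar a) => //; rewrite (star_hom_star hf).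
Qed.

End CstarGenerated.

(** If a = b (1 + c) with c > 0, then by the Bernoulli inequality (1 + c)^(2^(i+1)) is at least (1 +
    2^i c)^2, quadratic in 2^i, whereas the allowed constant is only linear in 2^i. *)
Lemma le_of_dyadic_powers (R : realType) (a b : R) (d : nat) : 0 <= a -> 0 <= b ->
  (forall i, a ^+ (2 ^ i) <= (d * 2 ^ i).+1%:R * b ^+ (2 ^ i)) -> a <= b.
Proof.
move=> a0 b0 h; rewrite leNgt; apply/negP => ba.
have [b00|bn0] := eqVneq b 0.
  have := h 0%N; rewrite b00 expn0 expr1 mulr0; lra.
have bp : 0 < b by rewrite lt_neqAle eq_sym bn0.
pose c := a / b - 1.
have c0 : 0 < c by rewrite /c subr_gt0 ltr_pdivlMr// mul1r.
have bern n : 1 + n%:R * c <= (1 + c) ^+ n.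
  elim: n => [|n IH]; first by rewrite mul0r addr0 expr0.
  rewrite exprS; apply: (@le_trans _ _ ((1 + c) * (1 + n%:R * c))).
    by rewrite -natr1; have : 0 <= n%:R :> R by []; nra.
  by apply: ler_wpM2l IH; lra.
have key i : (1 + (2 ^ i)%:R * c) ^+ 2 <= (d * 2 ^ i.+1)%:R + 1 :> R.
  have := h i.+1.
  have -> : a = b * (1 + c) by rewrite /c addrC subrK mulrC divfK.
  rewrite exprMn mulrC ler_pM2r ?exprn_gt0// -natr1 => /(le_trans _); apply.
  have p1 : 0 <= 1 + (2 ^ i)%:R * c by have : 0 <= (2 ^ i)%:R :> R by []; nra.
  by rewrite expnSr exprM; apply: lerXn2r; rewrite ?nnegrE// (le_trans p1).
have [i hi] : exists i, (d + d)%:R / c ^+ 2 < (2 ^ i)%:R :> R.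
  exists (Num.truncn ((d + d)%:R / c ^+ 2)).+1.
  apply: lt_trans (truncnS_gt _) _; rewrite ltr_nat; exact: ltn_expl.
have := key i; rewrite expnS mulnA natrM muln2 -addnn.
move: hi; rewrite ltr_pdivrMr ?exprn_gt0//.
have : 0 < (2 ^ i)%:R :> R by rewrite ltr0n expn_gt0.
set M := (2 ^ i)%:R; set D := (d + d)%:R; move=> M0; nra.
Qed.

(** * Norm estimates on graded sums and faithfulness *)

Section Faithfulness.
Variables (R : realType) (T : rtcat R) (K J : morset T).
Arguments K : clear implicits.
Arguments J : clear implicits.
Hypotheses (hK : is_ideal K) (hJ : is_ideal J) (hJK : morset_sub J (Jideal K)).
Variables (O : cstarAlg R) (iota : mor_maps T O).
Arguments iota : clear implicits.
Hypothesis hO : is_universal_pair K J iota.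
Variables (B : cstarAlg R) (p : mor_maps T B).
Arguments p : clear implicits.
Hypotheses (hp : is_rt_repr K p) (hcois : coisometric_on J p).
Variable Psi : O -> B.
Hypothesis hPsi : integrates_to K iota p Psi.

Let hi : is_rt_repr K iota. Proof. by case: hO. Qed.
Let ci : coisometric_on J iota. Proof. by case: hO. Qed.
Let hP : star_hom Psi. Proof. by case: hPsi. Qed.
Let gP z : `|z| = 1 -> gauge_at K iota z (gauge K iota z).
Proof. by apply: (gaugeP K J) => // n m a /hJK []. Qed.

Lemma gspan_dense x (e : R) : 0 < e -> exists2 y, gspan K iota setT y & rnorm (x - y) <= e.
Proof.
have : Cstar_of K iota x by case: hO => _ _ -> _.
by move=> /(Cstar_of_gspan hK hi) h /h.
Qed.

Lemma gspan_image P x : gspan K iota P x -> gspan K p P (Psi x).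
Proof.
case: hPsi => _ Pi.
elim=> [|n m a y Ka Pa _ IH].
  by rewrite (star_hom_on0 (setT_cstar_subalg _) hP); exact: gspan0.
by rewrite (homD hP)// Pi//; exact: gspan_cons.
Qed.

Lemma gauge_gspan z l x : `|z| = 1 -> gspan K iota [set l] x -> gauge K iota z x = z ^ l *: x.
Proof.
move=> /gP [hg gi]; elim=> [|n m a y Ka /= <- _ IH].
  by rewrite (star_hom_on0 (setT_cstar_subalg _) hg) scaler0.
by rewrite (homD hg)// gi// IH scalerDr.
Qed.

Lemma image_Cstar_of x : Cstar_of K p (Psi x).
Proof.
have [c _ _ _ _] := cstar_generated_subalg (repr_image K p).
apply: (closed_approx c) => e /(gspan_dense x) [y hy xy].
exists (Psi y); first by apply: gspan_Cstar_of (gspan_image hy).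
by rewrite -(star_homB hP); apply: le_trans (star_hom_contract hP _) xy.
Qed.

Lemma gspan_graded_part x d :
  gspan K iota [set k | (`|k| <= d)%N] x ->
  exists2 y : int -> O, (forall l, gspan K iota [set l] (y l)) & x = \sum_(l <- degrees d) y l.
Proof. by apply: gspan_graded; [exact: degrees_uniq|move=> k; exact: mem_degrees]. Qed.

Section Kernel.
Hypothesis hker : kernel_condition K J p.

Lemma degree_zero_le x : gspan K iota [set 0] x -> rnorm x <= rnorm (Psi x).
Proof.
move=> /(gspan_deg0 hK hi) [b [r [Kb hx]]]; rewrite (hx r (leqnn r)) (hom_sum hP).
apply: le_trans (degree_zero_norm_le hK hJK hi ci hp r hker Kb) _.
by case: hPsi => _ Pi; rewrite le_eqVlt; apply/orP; left; apply/eqP; congr rnorm;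
   apply: eq_bigr => j _; rewrite Pi.
Qed.

Lemma homogeneous_le l x : gspan K iota [set l] x -> rnorm x <= rnorm (Psi x).
Proof.
move=> hx; rewrite -ler_sqr ?nnegrE ?rnorm_ge0// -!rnormC -(star_hom_star hP) -(star_homM hP).
apply: degree_zero_le.
have hs : gspan K iota [set - l] (cstar x) by apply: gspan_star hx => // k ->.
by apply: gspanM hs hx => // i j -> ->; rewrite addNr.
Qed.

(** An element of degree 0 is near a graded sum, hence as near to the degree 0 part of that sum, and
    on this part the norm is controlled by [Psi]. *)
Lemma kernel_condition_spectral : faithful_on (spectral_subspace K iota 0) Psi.
Proof.
apply: (faithful_on_ker hP) => [a b|x hx Px]; first exact: (spectral_subspaceB hK hJK hO).
apply: rnorm_eps => e e0; have e2 : 0 < e / 2 by lra.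
have [y /gspan_bounded [d /gspan_graded_part [u hu ey]] xy] := gspan_dense x e2.
have xu : rnorm (x - u 0) <= e / 2.
  apply: le_trans xy.
  (* x - y is itself written as a graded sum with x in degree 0, so the averaging estimate applies
     although x need not lie in the span. *)
  pose v l := (if l == 0 then x else 0) - u l.
  have -> : x - y = \sum_(l <- degrees d) v l.
    rewrite /v sumrB -ey; congr (_ - _).
    rewrite (bigD1_seq 0 (mem_degrees _) (degrees_uniq _)) ?absz0//= big1 ?addr0// => l.
    by move=> /negbTE ->.
  have -> : x - u 0 = v 0 by rewrite /v eqxx.
  apply: (graded_part_norm_le (setT_cstar_subalg O) (g := gauge K iota)) => //.
  - by move=> z z1; have [] := gP z1.
  - move=> z l z1; have [hg _] := gP z1; rewrite /v (star_homB hg) (gauge_gspan z1 (hu l)).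
    rewrite scalerBr; congr (_ - _); case: eqP => [->|_]; first exact: hx.
    by rewrite (star_hom_on0 (setT_cstar_subalg _) hg) scaler0.
  - exact: degrees_uniq.
  - by apply: mem_degrees; rewrite absz0.
have h0 := degree_zero_le (hu 0).
have := star_hom_contract hP (u 0 - x); rewrite (star_homB hP) Px subr0 rnormBC => h1.
have := rnorm_tri (u 0) x 0; rewrite !subr0; lra.
Qed.

Hypothesis hgauge : admits_gauge_action K p.

(** There are 2d + 1 homogeneous parts. Each is bounded by its image, and the gauge action on the
    range bounds that image by the image of the whole sum. *)
Lemma banded_le d x : gspan K iota [set k | (`|k| <= d)%N] x ->
  rnorm x <= (d + d).+1%:R * rnorm (Psi x).
Proof.
move=> /gspan_graded_part [y hy ->]; rewrite (hom_sum hP).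
have [g hg] : exists g : R[i] -> B -> B, forall z, `|z| = 1 ->
    [/\ forall b, Cstar_of K p b -> Cstar_of K p (g z b),
        star_hom_on (Cstar_of K p) (g z) &
        forall n m (a : T n m), K n m a -> g z (p n m a) = z ^ (n%:Z - m%:Z) *: p n m a].
  (* Off the unit circle the identity is a default value. *)
  have /choice [g hg] : forall z : R[i], exists b : B -> B, `|z| = 1 -> [/\ forall c, Cstar_of K p c -> Cstar_of K p (b c),
        star_hom_on (Cstar_of K p) b &
        forall n m (a : T n m), K n m a -> b (p n m a) = z ^ (n%:Z - m%:Z) *: p n m a].
    move=> z; have [/hgauge [b hb]|nz] := eqVneq `|z| 1; first by exists b.
    by exists id => z1; rewrite z1 eqxx in nz.
  by exists g.
have hS := cstar_generated_subalg (repr_image K p).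
have part l : l \in degrees d -> rnorm (y l) <= rnorm (\sum_(i <- degrees d) Psi (y i)).
  move=> ld; apply: le_trans (homogeneous_le (hy l)) _.
  apply: (@graded_part_norm_le _ _ _ g hS _ (fun l => Psi (y l))) => //.
  - by move=> z /hg [].
  - by move=> i; exact: image_Cstar_of.
  - move=> z i /hg [_ gh gp]; elim: (gspan_image (hy i)) => [|n m a u Ka /= <- hu IH].
      by rewrite (star_hom_on0 hS gh) scaler0.
    rewrite (homD gh) ?gp ?IH ?scalerDr//; last exact: (gspan_Cstar_of hu).
    by move=> S [_]; apply; exists n, m, a.
  - exact: degrees_uniq.
have sz : size (degrees d) = (d + d).+1 by rewrite size_map size_iota.
rewrite -[in (_.+1)%:R]sz; move: (rnorm (\sum_(i <- _) _)) part => M.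
elim: (degrees d) => [|a t IH] h; first by rewrite big_nil rnorm0 mul0r.
rewrite big_cons; apply: le_trans (rnormD _ _) _.
rewrite -[size _]/(size t).+1 -natr1 mulrDl mul1r addrC; apply: lerD.
  by apply: IH => l lt; apply: h; rewrite inE lt orbT.
by apply: h; rewrite inE eqxx.
Qed.

(** Squaring a self-adjoint element doubles the degree bound and squares both norms, so the constant
    grows only linearly in the exponent 2^i. *)
Lemma banded_sa_le d w : gspan K iota [set k | (`|k| <= d)%N] w -> cstar w = w ->
  rnorm w <= rnorm (Psi w).
Proof.
move=> hw sw; apply: (@le_of_dyadic_powers _ _ _ (d + d)); try exact: rnorm_ge0.
move=> i; elim: i d w hw sw => [|i IH] d w hw sw.
  by rewrite expn0 muln1 !expr1; exact: banded_le.
have hww : gspan K iota [set k | (`|k| <= d + d)%N] (cmul w w).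
  by apply: (gspanM hK hi _ hw hw) => k l /= kd ld; lia.
have := IH _ _ hww; rewrite cstarM sw => /(_ erefl).
have -> : rnorm (cmul w w) = rnorm w ^+ 2 by rewrite -{1}sw rnormC.
have -> : rnorm (Psi (cmul w w)) = rnorm (Psi w) ^+ 2.
  by rewrite -{1}sw (star_homM hP) (star_hom_star hP) rnormC.
rewrite -!exprM -expnS => h; apply: le_trans h _.
by rewrite addnn -muln2 -mulnA -expnS.
Qed.

Lemma gspan_le x : gspan K iota setT x -> rnorm x <= rnorm (Psi x).
Proof.
move=> hx; rewrite -ler_sqr ?nnegrE ?rnorm_ge0// -!rnormC -(star_hom_star hP) -(star_homM hP).
have : gspan K iota setT (cmul (cstar x) x).
  have hs : gspan K iota setT (cstar x) by apply: gspan_star hx.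
  by apply: gspanM hs hx.
move=> /gspan_bounded [d hd]; apply: (banded_sa_le hd).
by rewrite cstarM cstarK.
Qed.

Lemma gauge_injective : injective Psi.
Proof.
suff h : faithful_on setT Psi by move=> x y; exact: h.
apply: (faithful_on_ker hP) => // x _ Px; apply: rnorm_eps => e e0.
have e2 : 0 < e / 2 by lra.
have [y hy xy] := gspan_dense x e2; have h0 := gspan_le hy.
have := star_hom_contract hP (y - x); rewrite (star_homB hP) Px subr0 rnormBC => h1.
have := rnorm_tri y x 0; rewrite !subr0; lra.
Qed.

End Kernel.

(** The range of [Psi] is a C*-algebra containing the generators, hence all of C*(p), so the gauge
    action is transported through the inverse of [Psi] on its range. *)
Lemma injective_admits_gauge : injective Psi -> admits_gauge_action K p.
Proof.
move=> Pinj z z1; have [hg gi] := gP z1.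
have rng b : Cstar_of K p b -> exists a, Psi a = b.
  move=> hb; have [a _ <-] : range Psi b; last by exists a.
  apply: hb; split; first exact: inj_range_subalg.
  move=> _ [n [m [a [Ka ->]]]]; exists (iota n m a) => //.
  by case: hPsi => _ Pi; exact: Pi.
pose inv b := xget 0 [set a | Psi a = b].
have invP a : inv (Psi a) = a.
  by rewrite /inv; case: xgetP => [u -> /Pinj //|/(_ a) []].
exists (fun b => Psi (gauge K iota z (inv b))); split.
- by move=> b _; exact: image_Cstar_of.
- split.
  + move=> c a b /rng [u <-] /rng [v <-].
    have -> : c *: Psi u + Psi v = Psi (c *: u + v) by case: hP => h _ _; rewrite h.
    by rewrite !invP; case: hg => hgl _ _; rewrite hgl//; case: hP => h _ _; rewrite h.
  + move=> a b /rng [u <-] /rng [v <-].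
    by rewrite -(star_homM hP) !invP (star_homM hg) (star_homM hP).
  + move=> a /rng [u <-].
    by rewrite -(star_hom_star hP) !invP (star_hom_star hg) (star_hom_star hP).
- move=> n m a Ka; case: hPsi => _ Pi.
  by rewrite -(Pi _ _ _ Ka) invP gi// (star_homZ hP).
Qed.

End Faithfulness.

Theorem theorem7p3 (R : realType) (T : rtcat R) (K J : morset T)
    (hK : is_ideal K) (hJ : is_ideal J) (hJK : morset_sub J (Jideal K))
    (O : cstarAlg R) (iota : mor_maps T O) (hO : is_universal_pair K J iota)
    (B : cstarAlg R) (p : mor_maps T B)
    (hp : is_rt_repr K p) (hcois : coisometric_on J p) :
  [<-> faithful_on_0_spectral K iota p;
       faithful_on_all_spectral K iota p;
       ker_tilde_is_reduction K J p;
       ker_and_preimage_condition K J p] /\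
  (integrates_faithfully K iota p <->
     admits_gauge_action K p /\
     (faithful_on_0_spectral K iota p \/
      faithful_on_all_spectral K iota p \/
      ker_tilde_is_reduction K J p \/
      ker_and_preimage_condition K J p)).
Proof.
have hKt := ker_tilde_kernel_condition hK hJ hJK hp hcois.
have univ : exists Psi, integrates_to K iota p Psi by case: hO => _ _ _; apply.
have spectral : kernel_condition K J p -> faithful_on_0_spectral K iota p.
  move=> h; case: univ => Psi hPsi; exists Psi; split => //.
  exact: (kernel_condition_spectral hK hJK hO hp hPsi h).
have kernel : faithful_on_all_spectral K iota p -> kernel_condition K J p.
  exact: (faithful_all_kernel_condition hK hJ hJK hO).
have all0 : faithful_on_0_spectral K iota p -> faithful_on_all_spectral K iota p.
  exact: (faithful_0_spectral_all hK hJK hO).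
have iv : kernel_condition K J p <-> ker_and_preimage_condition K J p.
  split; first exact: (kernel_condition_preimage hK hJK hp hcois).
  exact: (preimage_kernel_condition hK hJ hJK hp hcois).
split.
  tfae=> [//|/kernel/hKt //|/hKt/iv //|/iv/spectral //].
split=> [[Psi [hPsi Pinj]]|[hg hc]].
  split; first exact: (injective_admits_gauge hK hJK hO hPsi Pinj).
  by left; exists Psi; split=> // x y _ _; exact: Pinj.
have hker : kernel_condition K J p.
  by case: hc => [/all0/kernel //|[/kernel //|[/hKt //|/iv //]]].
case: univ => Psi hPsi; exists Psi; split=> //.
exact: (gauge_injective hK hJK hO hp hPsi hker hg).
Qed.
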